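(* Let $d\ge3$, $\delta\in(0,1)$, and $\alpha>\frac34\cdot\frac{d-\frac23}{d-1}$ with $\alpha<1$. Then \[ \big\|\mathcal{L}(\mathcal{H}_\alpha)-\widetilde\nu_{\alpha,n}\big\|_{\mathrm{TV}}\to0\quad\text{as }n\to\infty. \]
   Context: Let $(\phi_x)$ be the discrete Gaussian free field on $[0,n]^d\cap\mathbb{Z}^d$ with zero boundary condition on $\partial[0,n]^d$: a centred Gaussian process with $\mathrm{Cov}(\phi_x,\phi_y)=\mathbb{E}_x\big[\sum_{i=0}^{\tau}\mathbf 1(X_i=y)\big]$, where $X$ is simple random walk on $[0,n]^d\cap\mathbb{Z}^d$ and $\tau$ its first hitting time of $\partial[0,n]^d\cap\mathbb{Z}^d$. Let $G$ be the Green's function of simple random walk on $\mathbb{Z}^d$ and $G(0)=G(0,0)$. The set of $\alpha$-high points is $\mathcal{H}_\alpha=\{x\in[\delta n,(1-\delta)n]^d\cap\mathbb{Z}^d:\phi_x\ge\sqrt{2\alpha dG(0)\log n}\}$. $\widetilde\nu_{\alpha,n}$ is the law of $\{x\in[\delta n,(1-\delta)n]^d\cap\mathbb{Z}^d:\widetilde Z_x=1\}$ where $(\widetilde Z_x)$ are independent Bernoulli with $\mathbb{P}(\widetilde Z_x=1)=\mathbb{P}(\phi_x\ge\sqrt{2\alpha dG(0)\log n})$. Total variation distance: $\|\mu-\nu\|_{\mathrm{TV}}=\max_A|\mu(A)-\nu(A)|$. *)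

(* Defs.v *)
From HB Require Import structures.
From mathcomp Require Import all_boot all_order all_algebra.
From mathcomp Require Import all_classical all_reals all_analysis.
Set Implicit Arguments. Unset Strict Implicit. Unset Printing Implicit Defensive.
Import Order.TTheory GRing.Theory Num.Theory.
Import numFieldNormedType.Exports.
Local Open Scope classical_set_scope.
Local Open Scope ring_scope.

Section DGFF.
Variable R : realType.

Definition zpt (d : nat) := {ffun 'I_d -> int}.
Definition zshift d (x : zpt d) (i : 'I_d) (s : int) : zpt d :=
  [ffun j => x j + (if j == i then s else 0)].

Fixpoint srw_p (d : nat) (k : nat) (x : zpt d) : R :=
  match k with
  | 0 => if [forall i, x i == 0] then 1 else 0
  | k'.+1 => (d.*2)%:R^-1 *
      \sum_(i < d) (@srw_p d k' (zshift x i (-1)) + @srw_p d k' (zshift x i 1))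
  end.

Definition green0 (d : nat) : R :=
  fine (\sum_(0 <= k <oo) (@srw_p d k [ffun=> 0])%:E)%E.

Definition bpt (d n : nat) := {ffun 'I_d -> 'I_n.+1}.

Definition interior d n (x : bpt d n) : bool :=
  [forall i, (0 < x i)%N && (x i < n)%N].

Definition adjb d n (x y : bpt d n) : bool :=
  (\sum_(i < d) `|(x i)%:Z - (y i)%:Z|%N == 1)%N.

(* killed walk: q k x y = P_x(X_0,...,X_k all interior, X_k = y) *)
Fixpoint killed_q (d n : nat) (k : nat) (x y : bpt d n) : R :=
  match k with
  | 0 => if (x == y) && interior x then 1 else 0
  | k'.+1 => (if interior x then 1 else 0) *
      \sum_(z : bpt d n)
         (if adjb x z then (d.*2)%:R^-1 else 0) * @killed_q d n k' z y
  end.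

(* Cov(phi_x, phi_y) = E_x[ sum_{i < tau} 1(X_i = y) ]; zero on the boundary *)
Definition green_box (d n : nat) (x y : bpt d n) : R :=
  fine (\sum_(0 <= k <oo) (@killed_q d n k x y)%:E)%E.

Definition gaussian_law (v : R) : set R -> \bar R :=
  if v == 0 then \d_(0 : R) else normal_prob 0 (Num.sqrt v).

Definition is_centred_gaussian_field (dT : measure_display)
    (T : measurableType dT) (P : probability T R) (I : finType)
    (C : I -> I -> R) (phi : I -> T -> R) : Prop :=
  (forall x, measurable_fun setT (phi x)) /\
  forall (a : I -> R) (B : set R), measurable B ->
    P [set w | \sum_(x : I) a x * phi x w \in B] =
    gaussian_law (\sum_(x : I) \sum_(y : I) a x * a y * C x y) B.

Definition is_DGFF (dT : measure_display) (T : measurableType dT)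
    (P : probability T R) (d n : nat) (phi : bpt d n -> T -> R) : Prop :=
  is_centred_gaussian_field P (@green_box d n) phi.

Definition inner_box (d n : nat) (delta : R) (x : bpt d n) : bool :=
  [forall i, (delta * n%:R <= (x i)%:R) && ((x i)%:R <= (1 - delta) * n%:R)].

Definition threshold (d n : nat) (alpha : R) : R :=
  Num.sqrt (2 * alpha * d%:R * green0 d * ln n%:R).

Definition high_set (dT : measure_display) (T : measurableType dT)
    (d n : nat) (delta alpha : R) (phi : bpt d n -> T -> R) (w : T)
    : {set bpt d n} :=
  [set x | inner_box delta x && (threshold d n alpha <= phi x w)].

Definition law_high (dT : measure_display) (T : measurableType dT)
    (P : probability T R) (d n : nat) (delta alpha : R)
    (phi : bpt d n -> T -> R) (S : {set bpt d n}) : R :=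
  fine (P [set w | high_set delta alpha phi w = S]).

Definition nu_tilde (dT : measure_display) (T : measurableType dT)
    (P : probability T R) (d n : nat) (delta alpha : R)
    (phi : bpt d n -> T -> R) (S : {set bpt d n}) : R :=
  let p x := fine (P [set w | threshold d n alpha <= phi x w]) in
  if S \subset [set x | inner_box delta x] then
    \prod_(x | inner_box delta x) (if x \in S then p x else 1 - p x)
  else 0.

Definition tv_dist (U : finType) (mu nu : U -> R) : R :=
  \big[Num.max/0]_(A : {set U}) `|\sum_(S in A) mu S - \sum_(S in A) nu S|.

End DGFF.

(* Main.v *)
(* Lindeberg replacement: resampling the sites one at a time as independent
   Bernoulli variables changes the law of the high set by at most the sum over x
   of (a) the covariance of the indicator of x with functions of the high set
   outside a ball B(x) and (b) the probabilities that x and another site of B(x)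
   are both high.

   For (a), sweep the unit mass at x out of B(x): phi_x = xi + psi, where psi is
   the harmonic average of phi over the exterior of B(x) and xi has zero
   covariance with every phi_y, y outside B(x). Such a xi is independent of those
   phi_y: means of products of cosines factor, since the Gaussian characteristic
   function is multiplicative in the variance, and indicators of half-lines are
   bounded limits of trigonometric polynomials. The variance of psi is
   at most the supremum of G(x, y) over y outside B(x), so psi only matters when
   xi lies in a narrow window around the threshold.

   For (b), phi_x + phi_y has variance at most 2 (G(0) + G(x, y)). The Green
   function is bounded by comparison with explicit superharmonic functions: it
   decays like |z|^(-2b) for every b < (d - 2) / 2, and off the diagonal it is at
   most d / (2 (d - 1)) G(0). The latter ratio, together with balls of radius
   nearly n^(2 alpha - 1), gives the range of alpha. *)
Require Import Defs.
From HB Require Import structures.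
From mathcomp Require Import all_boot all_order all_algebra.
From mathcomp Require Import all_classical all_reals all_analysis.
From mathcomp Require Import measurable_realfun zify lra ring.
Import Order.TTheory GRing.Theory Num.Theory.
Import numFieldNormedType.Exports.
Local Open Scope classical_set_scope.
Local Open Scope ring_scope.
Set Implicit Arguments. Unset Strict Implicit. Unset Printing Implicit Defensive.

(** * Lindeberg replacement for random finite sets *)

(** The exponents are forced as follows. There are about n^d sites, so a site may cost only
    o(n^(-d)), while it is high with probability about n^(-alpha d). In (a), the window has about
    the width n^(-b kap) of psi for a ball of radius n^kap, which asks for d (1 - alpha) < b kap. In
    (b), a pair with covariance q is high with probability at most n^(-2 alpha d / (1 + q / G(0))):
    the n^(d + d kap) distant pairs ask for kap < 2 alpha - 1, the close ones for 1 + q / G(0) < 2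
    alpha. With b near (d - 2) / 2, the first two conditions are compatible exactly when alpha > (3
    d - 2) / (4 (d - 1)), and the ratio d / (2 (d - 1)) turns the third into the same condition: a
    sharper ratio would not extend the range.

    The field is given only through the one-dimensional laws of its linear forms. This is why
    independence of xi from the exterior is derived from characteristic functions and not from a
    joint density or a conditional law. *)

Section Lindeberg.
Variables (R : realFieldType) (I : finType) (mu : {set I} -> R).
Hypothesis mu_ge0 : forall S, 0 <= mu S.
Hypothesis mu_sum1 : \sum_S mu S = 1.

Definition mean (m f : {set I} -> R) : R := \sum_S m S * f S.
Definition marg (x : I) : R := mean mu (fun S => (x \in S)%:R).
Definition marg2 (x y : I) : R := mean mu (fun S => ((x \in S) && (y \in S))%:R).
Definition prod_law (p : I -> R) (S : {set I}) : R :=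
  \prod_x (if x \in S then p x else 1 - p x).
Definition resample (p : I -> R) (x : I) (h : {set I} -> R) (S : {set I}) : R :=
  p x * h (x |: S) + (1 - p x) * h (S :\ x).
Definition discr (x : I) (h : {set I} -> R) (S : {set I}) : R :=
  h (x |: S) - h (S :\ x).

Lemma meanD m f g : mean m (fun S => f S + g S) = mean m f + mean m g.
Proof. by rewrite /mean -big_split; apply: eq_bigr => S _; rewrite mulrDr. Qed.

Lemma meanB m f g : mean m (fun S => f S - g S) = mean m f - mean m g.
Proof. by rewrite /mean -sumrB; apply: eq_bigr => S _; rewrite mulrBr. Qed.

Lemma meanZ m c f : mean m (fun S => c * f S) = c * mean m f.
Proof. by rewrite /mean mulr_sumr; apply: eq_bigr => S _; rewrite mulrCA. Qed.

Lemma eq_mean m f g : f =1 g -> mean m f = mean m g.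
Proof. by move=> fg; apply: eq_bigr => S _; rewrite fg. Qed.

Lemma mean_cst c : mean mu (fun=> c) = c.
Proof. by rewrite /mean -mulr_suml mu_sum1 mul1r. Qed.

Lemma mean_le (f g : {set I} -> R) : (forall S, f S <= g S) -> mean mu f <= mean mu g.
Proof. by move=> fg; apply: ler_sum => S _; exact: ler_wpM2l. Qed.

Lemma mean_norm f : `|mean mu f| <= mean mu (fun S => `|f S|).
Proof.
apply: le_trans (ler_norm_sum _ _ _) _; apply: ler_sum => S _.
by rewrite normrM ger0_norm.
Qed.

Lemma mean_sum m (J : finType) (Q : pred J) (f : J -> {set I} -> R) :
  mean m (fun S => \sum_(j | Q j) f j S) = \sum_(j | Q j) mean m (f j).
Proof.
rewrite /mean exchange_big /=; apply: eq_bigr => S _.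
by rewrite mulr_sumr.
Qed.

Lemma marg_ge0 x : 0 <= marg x.
Proof. by apply: sumr_ge0 => S _; rewrite mulr_ge0. Qed.

Lemma marg_le1 x : marg x <= 1.
Proof.
rewrite -[leRHS](mean_cst 1); apply: mean_le => S.
by case: (x \in S).
Qed.

Lemma prod_law_sum1 p : \sum_S prod_law p S = 1.
Proof.
have /= := @bigA_distr R 0 1 *%R +%R I p (fun x => 1 - p x).
rewrite (eq_bigr (fun=> 1)) => [|i _]; last by ring.
by rewrite big1_eq => ->; apply: eq_big.
Qed.

(** [discr x h] ignores whether [x] is in the set, so the error of one replacement is a covariance
    between the indicator of [x] and a function of the other sites. *)
Lemma resampleE p x h S : resample p x h S = h S - ((x \in S)%:R - p x) * discr x h S.
Proof.
rewrite /resample /discr; case: (boolP (x \in S)) => xS.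
- by rewrite (finset.setUidPr _) ?finset.sub1set//=; ring.
- rewrite (_ : S :\ x = S) /=; last first.
    by apply/finset.setP => y; rewrite !inE; case: eqP => // ->; rewrite (negbTE xS).
  ring.
Qed.

Lemma discrU x h S : discr x h (x |: S) = discr x h (S :\ x).
Proof.
rewrite /discr; congr (h _ - h _); apply/finset.setP => y; rewrite !inE.
- by case: eqP.
- by case: eqP.
Qed.

Lemma discrD1 x h S : discr x h (S :\ x) = discr x h S.
Proof.
rewrite /discr; congr (h _ - h _); apply/finset.setP => y; rewrite !inE.
- by case: eqP.
- by case: eqP.
Qed.

Lemma prod_lawD1 p x (S : {set I}) : x \notin S ->
  p x * prod_law p S = (1 - p x) * prod_law p (x |: S).
Proof.
move=> xS; rewrite /prod_law (bigD1 x)//= (negbTE xS).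
rewrite [in RHS](bigD1 x)//= finset.in_setU1 eqxx /=.
rewrite [in RHS](eq_bigr (fun i => if i \in S then p i else 1 - p i)).
  by ring.
by move=> i ix; rewrite finset.in_setU1 (negbTE ix).
Qed.

(** Pair each [S] avoiding [x] with [x |: S]: [discr] takes the same value on both, and the weights
    of the centred indicator cancel by [prod_lawD1]. *)
Lemma prod_law_resample p x h :
  mean (prod_law p) (resample p x h) = mean (prod_law p) h.
Proof.
rewrite (eq_mean _ (resampleE p x h)) meanB -[RHS]subr0; congr (_ - _).
rewrite /mean (bigID (fun S : {set I} => x \in S)) /=.
rewrite (reindex_onto (fun S => x |: S) (fun S => S :\ x)) /=; last first.
  by move=> S; exact: finset.setD1K.
rewrite (eq_bigl (fun S : {set I} => x \notin S)); last first.
  move=> S; rewrite finset.in_setU1 eqxx /=.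
  apply/eqP/idP => [<-|xS]; first by rewrite !inE eqxx.
  by apply/finset.setP => y; rewrite !inE; case: eqP => // ->; rewrite (negbTE xS).
rewrite -big_split /= big1// => S xS.
rewrite finset.in_setU1 eqxx (negbTE xS) /= discrU discrD1.
have := prod_lawD1 p xS; set a := prod_law p S; set b := prod_law p _ => e.
rewrite !mulrA -mulrDl (_ : b * _ + _ = 0) ?mul0r//=.
by lra.
Qed.

Lemma resample_bnd p x (h : {set I} -> R) : 0 <= p x <= 1 -> (forall S, 0 <= h S <= 1) ->
  forall S, 0 <= resample p x h S <= 1.
Proof.
move=> /andP[p0 p1] h01 S; rewrite /resample.
have /andP[a0 a1] := h01 (x |: S); have /andP[b0 b1] := h01 (S :\ x).
by apply/andP; split; nra.
Qed.

Lemma resample_indep p x (h : {set I} -> R) (D : {set I}) :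
  (forall S T, S :\: D = T :\: D -> h S = h T) ->
  forall S T, S :\: (x |: D) = T :\: (x |: D) -> resample p x h S = resample p x h T.
Proof.
move=> hD S T ST; rewrite /resample; congr (_ * _ + _ * _); apply: hD.
- apply/finset.setP => y; move/finset.setP: ST => /(_ y); rewrite !inE.
  by case: eqP => //= _ ->.
- apply/finset.setP => y; move/finset.setP: ST => /(_ y); rewrite !inE.
  by case: eqP => //= _; case: (y \in D).
Qed.

Variables (B : I -> {set I}) (e : I -> R).
Hypothesis decoupled : forall x (F : {set I} -> R), (forall S, 0 <= F S <= 1) ->
  `|mean mu (fun S => ((x \in S)%:R - marg x) * F (S :\: B x))| <= e x.

Definition pair_err x := \sum_(y in B x | y != x) (marg2 x y + marg x * marg y).

Lemma resample_err x (h : {set I} -> R) : (forall S, 0 <= h S <= 1) ->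
  `|mean mu h - mean mu (resample marg x h)| <= 2 * e x + 2 * pair_err x.
Proof.
move=> h01; rewrite (eq_mean _ (resampleE marg x h)) meanB opprB addrC subrK.
set D := discr x h.
have D1 S : -1 <= D S <= 1.
  rewrite /D /discr; have /andP[a0 a1] := h01 (x |: S).
  have /andP[b0 b1] := h01 (S :\ x); apply/andP; split; lra.
pose N (S : {set I}) : R := \sum_(y in B x | y != x) (y \in S)%:R.
have N0 S : 0 <= N S by apply: sumr_ge0.
(* [N S] counts the points of [S] in [B x] other than [x]. If there are none, [S] and [S :\: B x]
   differ at most in [x], which [D] ignores. *)
have DN S : `|D S - D (S :\: B x)| <= 2 * N S.
  have [ex|/existsPn nex] := boolP [exists y, [&& y \in B x, y != x & y \in S]].
    have [y /and3P[yB yx yS]] := existsP ex.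
    have : 1 <= N S.
      rewrite /N (bigD1 y)/=; last by rewrite yB.
      by rewrite yS lerDl; apply: sumr_ge0.
    have /andP[a0 a1] := D1 S; have /andP[b0 b1] := D1 (S :\: B x).
    by move=> N1; rewrite ler_norml; apply/andP; split; lra.
  rewrite (_ : D (S :\: B x) = D S) ?subrr ?normr0 ?mulr_ge0//.
  rewrite -[LHS]discrD1 -[RHS]discrD1; congr (discr x h _); apply/finset.setP => y.
  have := nex y; rewrite !inE; case: (y == x) => //=.
  by case: (y \in B x) => //=; case: (y \in S).
have -> : mean mu (fun S => ((x \in S)%:R - marg x) * D S) =
   mean mu (fun S => ((x \in S)%:R - marg x) * D (S :\: B x)) +
   mean mu (fun S => ((x \in S)%:R - marg x) * (D S - D (S :\: B x))).
  by rewrite -meanD; apply: eq_mean => S; ring.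
apply: le_trans (ler_normD _ _) _; apply: lerD.
  (* Rescaling [D] into [[0, 1]] only costs a factor 2: the added constant is killed by the centred
     indicator. *)
  pose F S := (D S + 1) / 2.
  have -> : mean mu (fun S => ((x \in S)%:R - marg x) * D (S :\: B x)) =
    2 * mean mu (fun S => ((x \in S)%:R - marg x) * F (S :\: B x)).
    rewrite -meanZ -[RHS]subr0 -(_ : mean mu (fun S => (x \in S)%:R - marg x) = 0).
      by rewrite -meanB; apply: eq_mean => S; rewrite /F; field.
    by rewrite meanB mean_cst subrr.
  rewrite normrM ger0_norm// ler_pM2l//; apply: decoupled => S.
  by rewrite /F; have /andP[a0 a1] := D1 S; apply/andP; split; lra.
apply: le_trans (mean_norm _) _.
have -> : 2 * pair_err x = mean mu (fun S => ((x \in S)%:R + marg x) * (2 * N S)).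
  rewrite (@eq_mean _ _ (fun S => 2 * \sum_(y in B x | y != x)
      (((x \in S) && (y \in S))%:R + marg x * (y \in S)%:R))); last first.
    move=> S; rewrite mulrCA; congr (2 * _); rewrite /N mulr_sumr.
    by apply: eq_bigr => y _; rewrite mulrDl -natrM mulnb.
  rewrite meanZ mean_sum; congr (2 * _); apply: eq_bigr => y _.
  by rewrite meanD meanZ.
apply: mean_le => S; rewrite normrM; apply: ler_pM => //.
by apply: le_trans (ler_normB _ _) _; rewrite !ger0_norm ?marg_ge0.
Qed.

Lemma lindeberg (h : {set I} -> R) : (forall S, 0 <= h S <= 1) ->
  `|mean mu h - mean (prod_law marg) h| <= \sum_x (2 * e x + 2 * pair_err x).
Proof.
move=> h01.
(* Resampling never moves the mean under [prod_law marg], and costs [resample_err] under [mu]. Once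
   every site is resampled the function is constant, so the two means agree. *)
pose hs (s : seq I) := foldr (resample marg) h s.
have hs01 s S : 0 <= hs s S <= 1.
  elim: s S => [//|x s IH] S /=; apply: resample_bnd => //.
  by rewrite marg_ge0 marg_le1.
have nuhs s : mean (prod_law marg) (hs s) = mean (prod_law marg) h.
  by elim: s => [//|x s <-] /=; rewrite prod_law_resample.
have muhs s : `|mean mu h - mean mu (hs s)| <= \sum_(x <- s) (2 * e x + 2 * pair_err x).
  elim: s => [|x s IH] /=; first by rewrite subrr normr0 big_nil.
  rewrite big_cons [leRHS]addrC.
  rewrite (_ : _ - _ = (mean mu h - mean mu (hs s)) +
     (mean mu (hs s) - mean mu (resample marg x (hs s)))); last by ring.
  by apply: le_trans (ler_normD _ _) _; apply: lerD => //; exact: resample_err.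
have ind s S T : S :\: [set x in s] = T :\: [set x in s] -> hs s S = hs s T.
  elim: s S T => [|x s IH] S T.
    move=> ST; congr h; move/finset.setP: ST => ST; apply/finset.setP => y.
    by have := ST y; rewrite !inE.
  have := @resample_indep marg x (hs s) _ IH S T; rewrite /= => H ST.
  apply: H; move/finset.setP: ST => ST; apply/finset.setP => y; have := ST y.
  by rewrite !inE.
have cst S : hs (enum I) S = hs (enum I) finset.set0.
  by apply: ind; apply/finset.setP => y; rewrite !inE mem_enum.
have := muhs (enum I).
rewrite (_ : mean mu (hs _) = mean (prod_law marg) h).
  by rewrite big_enum.
rewrite -(nuhs (enum I)) (eq_mean _ cst) mean_cst (eq_mean _ cst).
by rewrite /mean -mulr_suml prod_law_sum1 mul1r.
Qed.

End Lindeberg.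

(** * Gaussian laws on the line *)

Section GaussMean.
Local Open Scope charge_scope.
Variable R : realType.
Notation leb := (@lebesgue_measure R).
Implicit Types (v w : R) (f g : R -> R).

Definition bounded_mf d (T : measurableType d) (f : T -> R) : Prop :=
  measurable_fun setT f /\ exists M : R, forall x, `|f x| <= M.

Lemma bounded_mf_integrable d (T : measurableType d)
    (P : {finite_measure set T -> \bar R}) (f : T -> R) :
  bounded_mf f -> P.-integrable setT (EFin \o f).
Proof.
move=> [mf [M fM]]; apply: measurable_bounded_integrable => //.
  exact: fin_num_fun_lty.
exists M; split; first by rewrite num_real.
by move=> x Mx y _; apply: le_trans (fM y) (ltW Mx).
Qed.

Lemma normal_pdf_integrableM (m s : R) f :
  bounded_mf f -> leb.-integrable setT (fun x => (f x * normal_pdf m s x)%:E).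
Proof.
move=> [mf [M fM]].
have := integrable_normal_pdf m s => /(integrableZl measurableT M) ig.
apply: le_integrable ig => //=.
  by apply/measurable_EFinP; apply: measurable_funM => //; exact: measurable_normal_pdf.
move=> x _; rewrite lee_fin !normrM; apply: ler_wpM2r => //.
exact: le_trans (fM x) (ler_norm _).
Qed.

(** The density integrates to [normal_prob] on every measurable set, hence equals the Radon-Nikodym
    derivative almost everywhere. *)
Lemma integral_normal_prob (m s : R) f : bounded_mf f ->
  (\int[normal_prob m s]_x (f x)%:E = \int[leb]_x (f x * normal_pdf m s x)%:E)%E.
Proof.
move=> bf.
have numu := normal_prob_dominates m s.
pose nu : {finite_measure set (measurableTypeR R) -> \bar R} := normal_prob m s.
rewrite -(@Radon_Nikodym_change_of_variables _ _ _ nu leb numu _ setT)//; last first.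
  exact: (@bounded_mf_integrable _ _ nu).
apply: ae_eq_integral => //.
- apply: emeasurable_funM; first by apply/measurable_EFinP; case: bf.
  apply: measurable_int; exact: Radon_Nikodym_integrable.
- by apply: measurable_int; exact: normal_pdf_integrableM.
- have H : ae_eq leb setT (fun x => (normal_pdf m s x)%:E)
      ('d (charge_of_finite_measure nu) '/d leb).
    apply: integral_ae_eq => //.
    + exact: integrable_normal_pdf.
    + by move=> E _ mE; rewrite -Radon_Nikodym_integral.
  by apply: filterS H => x /= + xT => /(_ xT) <-; rewrite EFinM.
Qed.

Lemma normal_pdf_sqrtE (m v x : R) : 0 < v ->
  normal_pdf m (Num.sqrt v) x =
  (Num.sqrt (v * pi *+ 2))^-1 * expR (- (x - m) ^+ 2 / (v *+ 2)).
Proof.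
move=> v0; rewrite normal_pdfE ?gt_eqF ?sqrtr_gt0// /normal_peak /normal_fun.
by rewrite sqr_sqrtr ?ltW.
Qed.

(** Completing the square: the joint density of [x] and [z], where [z - x] is independent of [x], is
    the density of the sum [z] times the conditional density of [x] given [z]. *)
Lemma normal_pdf_mul v w x z : 0 < v -> 0 < w ->
  normal_pdf x (Num.sqrt w) z * normal_pdf 0 (Num.sqrt v) x =
  normal_pdf 0 (Num.sqrt (v + w)) z *
  normal_pdf (z * v / (v + w)) (Num.sqrt (v * w / (v + w))) x.
Proof.
move=> v0 w0; have vw0 : 0 < v + w by rewrite addr_gt0.
have ? : 0 < v * w / (v + w) by rewrite divr_gt0// mulr_gt0.
rewrite !normal_pdf_sqrtE// mulrACA [RHS]mulrACA -!expRD; congr (_ * expR _).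
  rewrite -!invfM -!sqrtrM; try by rewrite mulrn_wge0// mulr_ge0 ?pi_ge0// ltW.
  rewrite (_ : w * pi *+ 2 * (v * pi *+ 2) =
    (v + w) * pi *+ 2 * (v * w / (v + w) * pi *+ 2))//.
  by rewrite !mulr2n; field; rewrite gt_eqF.
rewrite !mulr2n; field; rewrite -!mulr2n !mulrn_eq0/= !gt_eqF//; exact: mulr_gt0.
Qed.

(* The characteristic function of N(0, v). Only its multiplicativity in [v] is
   needed, not its closed form. *)
Definition cos_mean v : R :=
  if v == 0 then 1 else \int[leb]_x (cos x * normal_pdf 0 (Num.sqrt v) x).

Lemma bounded_mf_cos : bounded_mf (@cos R).
Proof.
split; last by exists 1 => x; exact: cos_max.
by apply: continuous_measurable_fun; exact: continuous_cos.
Qed.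

Lemma bounded_mf_sin : bounded_mf (@sin R).
Proof.
split; last by exists 1 => x; exact: sin_max.
by apply: continuous_measurable_fun; exact: continuous_sin.
Qed.

Lemma sin_pdf0 (v : R) : 0 < v ->
  \int[leb]_x (sin x * normal_pdf 0 (Num.sqrt v) x) = 0.
Proof.
move=> v0; set p := normal_pdf 0 (Num.sqrt v).
have is1 : leb.-integrable setT (EFin \o (fun x => sin x * p x)).
  by apply: normal_pdf_integrableM; exact: bounded_mf_sin.
have pN x : p (- x) = p x by rewrite /p !normal_pdf_sqrtE// !subr0 sqrrN.
have H : \int[leb]_x (sin x * p x) = \int[leb]_x (- (sin x * p x)).
  rewrite /Rintegral; congr fine.
  transitivity (\int[pushforward leb (-%R : measurableTypeR R -> measurableTypeR R)]_x
    (sin x * p x)%:E)%E.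
    by apply: eq_measure_integral => //= A mA _; exact/esym/lebesgue_measureN.
  rewrite integral_pushforward//=.
  - by apply: eq_integral => x _ /=; rewrite sinN pN mulNr.
  - by apply: measurable_int is1.
  - have := integrableN is1; apply: eq_integrable => // x _ /=.
    by rewrite sinN pN mulNr EFinN.
have : \int[leb]_x (- (sin x * p x)) = - \int[leb]_x (sin x * p x).
  rewrite -mulN1r -RintegralZl//.
  by apply: eq_Rintegral => x _; rewrite mulN1r.
rewrite -H => /eqP; rewrite -addr_eq0 -mulr2n mulrn_eq0/= => /eqP.
by [].
Qed.

Lemma integral_pdf (m s : R) : \int[leb]_x normal_pdf m s x = 1.
Proof. by rewrite /Rintegral integral_normal_pdf. Qed.

Lemma integral_affine_pdf (m s c : R) f : bounded_mf f ->
  \int[leb]_x ((1 + c * f x) * normal_pdf m s x) =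
  1 + c * \int[leb]_x (f x * normal_pdf m s x).
Proof.
move=> bf; have fi := normal_pdf_integrableM m s bf.
rewrite -{2}(integral_pdf m s) -RintegralZl// -RintegralD//.
- by apply: eq_Rintegral => x _; ring.
- exact: integrable_normal_pdf.
- by have := integrableZl measurableT c fi; exact: eq_integrable.
Qed.

(** [1 + cos] replaces [cos] because the substitution rule here and Tonelli in [cos_mean_add_gt0]
    are applied to nonnegative integrands. *)
Lemma integral_normal_translate (x w : R) : 0 < w ->
  (\int[leb]_z ((1 + cos z) * normal_pdf x (Num.sqrt w) z)%:E =
   \int[leb]_y ((1 + cos (x + y)) * normal_pdf 0 (Num.sqrt w) y)%:E)%E.
Proof.
move=> w0; have s0 : Num.sqrt w != 0 by rewrite gt_eqF ?sqrtr_gt0.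
have dF : (fun y : R^o => x + y : R^o)^`()%classic = cst 1.
  apply/funext => y; rewrite derive1E deriveD// derive_cst add0r derive_id //.
rewrite (@increasing_ge0_integration_by_substitutionT _ (fun y => x + y)).
- apply: eq_integral => y _ /=; rewrite dF /= !fctE /= mulr1; congr (_ * _)%:E.
  by rewrite !normal_pdf_sqrtE// subr0 addrC addKr.
- by move=> a b ab; rewrite ltrD2l.
- by rewrite dF => ?; exact: cvg_cst.
- by rewrite dF; exact: is_cvg_cst.
- by rewrite dF; exact: is_cvg_cst.
- by [].
- exact: cvg_addrl_Ny.
- exact: cvg_addrl.
- move=> z; apply: cvgM; last exact: continuous_normal_pdf.
  by apply: cvgD; [exact: cvg_cst|exact: continuous_cos].
- by move=> z; rewrite mulr_ge0 ?normal_pdf_ge0//; have := cos_geN1 z; lra.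
Qed.

Lemma cos_mean_gt0E v : 0 < v ->
  cos_mean v = \int[leb]_x (cos x * normal_pdf 0 (Num.sqrt v) x).
Proof. by move=> v0; rewrite /cos_mean gt_eqF. Qed.

Lemma cos_phase_pdf v t : 0 < v ->
  \int[leb]_x (cos (x + t) * normal_pdf 0 (Num.sqrt v) x) = cos t * cos_mean v.
Proof.
move=> v0; rewrite cos_mean_gt0E//.
have ci := normal_pdf_integrableM 0 (Num.sqrt v) bounded_mf_cos.
have si := normal_pdf_integrableM 0 (Num.sqrt v) bounded_mf_sin.
transitivity (cos t * \int[leb]_x (cos x * normal_pdf 0 (Num.sqrt v) x) -
  sin t * \int[leb]_x (sin x * normal_pdf 0 (Num.sqrt v) x)); last first.
  by rewrite sin_pdf0// mulr0 subr0.
rewrite -!RintegralZl// -RintegralB//.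
- by apply: eq_Rintegral => x _; rewrite cosD; ring.
- by have := integrableZl measurableT (cos t) ci; exact: eq_integrable.
- by have := integrableZl measurableT (sin t) si; exact: eq_integrable.
Qed.

Lemma bounded_mf_cosD t : bounded_mf (fun x : R => cos (x + t)).
Proof.
split; last by exists 1 => x; exact: cos_max.
apply: measurableT_comp; first by case: bounded_mf_cos.
exact: measurable_funD.
Qed.

Lemma EFin_integral_affine_pdf (m s c : R) f : bounded_mf f ->
  (\int[leb]_x ((1 + c * f x) * normal_pdf m s x)%:E)%E =
  (1 + c * \int[leb]_x (f x * normal_pdf m s x))%:E.
Proof.
move=> bf; rewrite -integral_affine_pdf// /Rintegral fineK//.
apply: integrable_fin_num => //; apply: normal_pdf_integrableM.
have [mf [M fM]] := bf; split.
  by apply: measurable_funD => //; apply: measurable_funM.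
exists (1 + `|c| * M) => x; apply: le_trans (ler_normD _ _) _.
by rewrite normr1 lerD2l normrM ler_wpM2l.
Qed.

(** Integrating [f] over [z] first gives [1 + cos_mean w * cos_mean v]; integrating over [x] first
    gives [1 + cos_mean (v + w)], by [normal_pdf_mul]. *)
Lemma cos_mean_add_gt0 v w : 0 < v -> 0 < w ->
  cos_mean (v + w) = cos_mean v * cos_mean w.
Proof.
move=> v0 w0; have vw0 : 0 < v + w by rewrite addr_gt0.
pose f (xz : R * R) : \bar R := ((1 + cos xz.2) *
  (normal_pdf xz.1 (Num.sqrt w) xz.2 * normal_pdf 0 (Num.sqrt v) xz.1))%:E.
have f0 xz : (0 <= f xz)%E.
  rewrite lee_fin mulr_ge0// ?mulr_ge0 ?normal_pdf_ge0//; have := cos_geN1 xz.2; lra.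
have mf : measurable_fun setT f.
  apply/measurable_EFinP; rewrite /f; apply: measurable_funM.
    apply: measurable_funD => //; apply: measurableT_comp => //.
    by case: bounded_mf_cos.
  apply: measurable_funM; last first.
    by apply: measurableT_comp => //; exact: measurable_normal_pdf.
  under eq_fun do rewrite normal_pdf_sqrtE//.
  apply: measurable_funM => //; apply: measurableT_comp => //.
  apply: measurable_funM => //; apply: measurableT_comp => //.
  apply: measurable_funX; exact: measurable_funB.
have := @fubini_tonelli _ _ _ _ _ leb leb f mf f0.
have inner x : (\int[leb]_z f (x, z) =
    ((1 + cos_mean w * cos x) * normal_pdf 0 (Num.sqrt v) x)%:E)%E.
  rewrite /f /=; under eq_integral do rewrite mulrA EFinM.
  rewrite ge0_integralZr//=.
  - rewrite integral_normal_translate// [RHS]EFinM; congr (_ * _)%E.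
    under eq_integral do rewrite addrC [x + _]addrC -[cos _]mul1r addrC.
    rewrite (EFin_integral_affine_pdf _ _ _ (bounded_mf_cosD x)) mul1r.
    by rewrite cos_phase_pdf// mulrC.
  - apply/measurable_EFinP; apply: measurable_funM; last exact: measurable_normal_pdf.
    by apply: measurable_funD => //; case: bounded_mf_cos.
  - by move=> z _; rewrite lee_fin mulr_ge0 ?normal_pdf_ge0//; have := cos_geN1 z; lra.
  - by rewrite lee_fin normal_pdf_ge0.
under eq_integral do rewrite inner.
rewrite (EFin_integral_affine_pdf _ _ _ bounded_mf_cos) -(cos_mean_gt0E v0).
have outer z : (\int[leb]_x f (x, z) =
    ((1 + 1 * cos z) * normal_pdf 0 (Num.sqrt (v + w)) z)%:E)%E.
  rewrite /f /=; under eq_integral do rewrite normal_pdf_mul// mulrA EFinM.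
  rewrite ge0_integralZl//=; first by rewrite integral_normal_pdf mule1 mul1r.
  - by apply/measurable_EFinP; exact: measurable_normal_pdf.
  - by move=> x _; rewrite lee_fin normal_pdf_ge0.
  - by rewrite lee_fin mulr_ge0 ?normal_pdf_ge0//; have := cos_geN1 z; lra.
under eq_integral do rewrite outer.
rewrite (EFin_integral_affine_pdf 0 (Num.sqrt (v + w)) 1 bounded_mf_cos).
rewrite -(cos_mean_gt0E vw0) !mul1r.
move=> H; move: (EFin_inj H); clear.
by move: (cos_mean (v + w)) (cos_mean w) (cos_mean v) => a b c; lra.
Qed.

Lemma cos_mean_add v w : 0 <= v -> 0 <= w ->
  cos_mean (v + w) = cos_mean v * cos_mean w.
Proof.
rewrite !le_eqVlt => /predU1P[<-|v0]; first by rewrite /cos_mean eqxx mul1r add0r.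
move=> /predU1P[<-|w0]; first by rewrite {3}/cos_mean eqxx mulr1 addr0.
exact: cos_mean_add_gt0.
Qed.

Section Law.
Context dT (T : measurableType dT) (P : probability T R) (X : T -> R).

Definition has_gaussian_law v : Prop := measurable_fun setT X /\
  forall B, measurable B -> P (X @^-1` B) = gaussian_law v B.

(** The phase lets cosines stand for sines too, so that the linear span of these functions is closed
    under products. *)
Lemma mean_cos_phase v t : 0 <= v -> has_gaussian_law v ->
  \int[P]_w cos (X w + t) = cos t * cos_mean v.
Proof.
move=> v0 [mX XP].
have bc := bounded_mf_cosD t.
have intX : P.-integrable setT ((EFin \o (fun x => cos (x + t))) \o X).
  have bX : bounded_mf (fun w : T => cos (X w + t)).
    split; last by exists 1 => w; exact: cos_max.
    by have [mc _] := bc; have := measurableT_comp mc mX.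
  by have := bounded_mf_integrable P bX.
have -> : \int[P]_w cos (X w + t) =
    fine (\int[pushforward P (X : T -> measurableTypeR R)]_x (cos (x + t))%:E)%E.
  rewrite integral_pushforward//.
  by apply/measurable_EFinP; case: bc.
have [v00|v00] := eqVneq v 0.
  rewrite v00 /cos_mean eqxx mulr1.
  rewrite (@eq_measure_integral _ _ _ _ (dirac (0 : measurableTypeR R))).
    rewrite integral_dirac//; first by rewrite diracT mul1e /= add0r.
    by apply/measurable_EFinP; case: bc.
  by move=> A mA _; have := XP A mA; rewrite /gaussian_law v00 eqxx.
rewrite -cos_phase_pdf ?lt_def ?v00//.
rewrite (@eq_measure_integral _ _ _ _ (normal_prob 0 (Num.sqrt v))).
  by rewrite integral_normal_prob.
by move=> A mA _; have := XP A mA; rewrite /gaussian_law (negbTE v00).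
Qed.

End Law.

End GaussMean.

Section GaussTail.
Variable R : realType.
Notation leb := (@lebesgue_measure R).
Implicit Types (v : R).

(** For [x >= t >= 0] one has [x ^+ 2 >= t ^+ 2 + (x - t) ^+ 2], so the density is at most the
    exponential times the density centred at [t], which has mass 1. *)
Lemma normal_tail v (t : R) : 0 < v -> 0 <= t ->
  (normal_prob 0 (Num.sqrt v) [set x | (t <= x)%R] <= (expR (- t ^+ 2 / (v *+ 2)))%:E)%E.
Proof.
move=> v0 t0.
have mt : measurable [set x : R | t <= x].
  by rewrite (_ : [set _ | _] = `[t, +oo[%classic)//; apply/seteqP; split => x /=;
    rewrite in_itv/= andbT.
apply: (@le_trans _ _ ((expR (- t ^+ 2 / (v *+ 2)))%:E *
    normal_prob t (Num.sqrt v) [set x | (t <= x)%R])%E); last first.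
  rewrite -[leRHS]mule1; apply: lee_wpmul2l; first by rewrite lee_fin expR_ge0.
  exact: (@probability_le1 _ _ _ (normal_prob t (Num.sqrt v))).
rewrite /normal_prob -ge0_integralZl//=.
- apply: ge0_le_integral => //=.
  + by move=> x _; rewrite lee_fin normal_pdf_ge0.
  + apply/measurable_EFinP/measurable_funTS; exact: measurable_normal_pdf.
  + apply/measurable_EFinP/measurable_funTS; apply: measurable_funM => //.
    exact: measurable_normal_pdf.
  + move=> x /= tx; rewrite -EFinM lee_fin !normal_pdf_sqrtE// mulrCA.
    rewrite ler_wpM2l ?invr_ge0 ?sqrtr_ge0// -expRD ler_expR -mulrDl.
    have xt : 0 <= t * (x - t) by rewrite mulr_ge0// subr_ge0.
    by rewrite ler_wpM2r ?invr_ge0 ?(mulrn_wge0 _ (ltW v0))//; lra.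
- apply/measurable_EFinP/measurable_funTS; exact: measurable_normal_pdf.
- by move=> x _; rewrite lee_fin normal_pdf_ge0.
Qed.

(** [1 / 2 <= v] keeps the peak of the density, the inverse square root of [2 * pi * v], below 1. *)
Lemma normal_interval v (b c : R) : 1 / 2 <= v -> 0 <= b -> b <= c ->
  (normal_prob 0 (Num.sqrt v) `[b, c]%classic <=
   ((c - b) * expR (- b ^+ 2 / (v *+ 2)))%:E)%E.
Proof.
move=> v0 b0 bc; have v00 : 0 < v by lra.
rewrite /normal_prob.
apply: (@le_trans _ _ (\int[leb]_(x in `[b, c]) (expR (- b ^+ 2 / (v *+ 2)))%:E)%E).
  apply: ge0_le_integral => //=.
  - by move=> x _; rewrite lee_fin normal_pdf_ge0.
  - apply/measurable_EFinP/measurable_funTS; exact: measurable_normal_pdf.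
  - move=> x; rewrite in_itv/= => /andP[bx xc].
    rewrite lee_fin normal_pdf_sqrtE// subr0 -[leRHS]mul1r.
    apply: ler_pM; rewrite ?invr_ge0 ?sqrtr_ge0 ?expR_ge0//.
      rewrite invf_le1 ?sqrtr_gt0 -?[leLHS]sqrtr1.
        apply: ler_wsqrtr; rewrite mulr2n; have := pi_ge2 R; nra.
      by rewrite mulrn_wgt0// mulr_gt0// pi_gt0.
    rewrite ler_expR ler_wpM2r ?invr_ge0 ?(mulrn_wge0 _ (ltW v00))//.
    by rewrite lerN2 ler_sqr ?nnegrE// (le_trans b0).
rewrite integral_cst//= lebesgue_measure_itv/= lte_fin.
case: ltgtP bc => // [bc _|-> _]; first by rewrite -EFinB -EFinM lee_fin mulrC.
by rewrite mule0 subrr mul0r.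
Qed.

Section Law.
Context dT (T : measurableType dT) (P : probability T R) (X : T -> R).

(** The variance may vanish, as it does on the boundary of the box; [0 < t] then keeps the atom at 0
    out of the event. *)
Lemma gaussian_tail v V (t : R) : 0 <= v <= V -> 0 < V -> 0 < t ->
  has_gaussian_law P X v ->
  fine (P [set w | t <= X w]) <= expR (- t ^+ 2 / (V *+ 2)).
Proof.
move=> /andP[v0 vV] V0 t0 [mX XP].
have mt : measurable [set x : R | t <= x].
  by rewrite (_ : [set _ | _] = `[t, +oo[%classic)//; apply/seteqP; split => x /=;
    rewrite in_itv/= andbT.
have := XP _ mt; rewrite /preimage/= => ->; rewrite /gaussian_law.
case: eqP => [_|/eqP vn0].
  by rewrite diracE memNset ?expR_ge0//= => /(lt_le_trans t0); rewrite ltxx.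
have vp : 0 < v by rewrite lt_def vn0.
have H := normal_tail vp (ltW t0).
have : fine (normal_prob 0 (Num.sqrt v) [set x | (t <= x)%R]) <= expR (- t ^+ 2 / (v *+ 2)).
  rewrite -lee_fin fineK//.
  exact: (@fin_num_measure _ _ _ (normal_prob 0 (Num.sqrt v))).
move/le_trans; apply; rewrite ler_expR !mulNr lerN2.
by rewrite ler_wpM2l ?sqr_ge0// lef_pV2 ?posrE ?mulrn_wgt0// lerMn2r.
Qed.

Lemma gaussian_interval v V (b c : R) : 1 / 2 <= v <= V -> 0 <= b -> b <= c ->
  has_gaussian_law P X v ->
  fine (P [set w | b <= X w <= c]) <= (c - b) * expR (- b ^+ 2 / (V *+ 2)).
Proof.
move=> /andP[v0 vV] b0 bc [mX XP].
have := XP `[b, c]%classic (measurable_itv _); rewrite /preimage/=.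
rewrite (_ : [set t | X t \in `[b, c]] = [set w | b <= X w <= c]); last first.
  by apply/seteqP; split => w /=; rewrite in_itv.
move=> ->; rewrite /gaussian_law gt_eqF; last by lra.
have H := normal_interval v0 b0 bc.
have : fine (normal_prob 0 (Num.sqrt v) `[b, c]%classic) <=
    (c - b) * expR (- b ^+ 2 / (v *+ 2)).
  rewrite -lee_fin fineK//.
  by apply: (@fin_num_measure _ _ _ (normal_prob 0 (Num.sqrt v))).
move/le_trans; apply; rewrite ler_wpM2l ?subr_ge0// ler_expR !mulNr lerN2.
rewrite ler_wpM2l ?sqr_ge0// lef_pV2 ?posrE ?mulrn_wgt0// ?lerMn2r//; lra.
Qed.

End Law.
End GaussTail.

(** * Indicators as limits of trigonometric polynomials *)

Section StepPoly.
Variable R : realType.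
Implicit Types (u y : R) (k : nat).

(* The exponent [k * 2 ^ k] makes [k * 2 ^ k * u ^ k] tend to 0 or to infinity
   according to whether [u < 1 / 2] or not. *)
Definition step_poly k u : R := 1 - (1 - u ^+ k) ^+ (k * 2 ^ k).

Lemma step_poly_bnd k u : 0 <= u <= 1 -> 0 <= step_poly k u <= 1.
Proof.
move=> /andP[u0 u1]; rewrite /step_poly subr_ge0 gerBl.
have a0 : 0 <= 1 - u ^+ k by rewrite subr_ge0 exprn_ile1.
by rewrite exprn_ile1 ?exprn_ge0// gerBl exprn_ge0.
Qed.

(** Each of the [k] terms of the geometric sum of [(1 - y ^+ k) / (1 - y)] is at least [y ^+ k]. *)
Lemma mulrn_exp_le y k : 0 <= y <= 1 -> k%:R * y ^+ k * (1 - y) <= 1 - y ^+ k.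
Proof.
move=> /andP[y0 y1]; elim: k => [|k IH]; first by rewrite !mul0r expr0 subrr.
have yk : 0 <= y ^+ k.+1 <= 1 by rewrite exprn_ge0// exprn_ile1.
rewrite -natr1 mulrDl mul1r mulrDl.
have : y * (k%:R * y ^+ k * (1 - y)) <= y * (1 - y ^+ k) by rewrite ler_wpM2l.
rewrite exprS in yk *.
set z := y ^+ k in yk *; set c := k%:R; move=> h.
have /andP[a b] := yk; nra.
Qed.

Lemma bernoulli_ge y k : 0 <= y <= 1 -> 1 - k%:R * y <= (1 - y) ^+ k.
Proof.
move=> /andP[y0 y1]; elim: k => [|k IH]; first by rewrite mul0r subr0 expr0.
rewrite exprS.
have : (1 - y) * (1 - k%:R * y) <= (1 - y) * (1 - y) ^+ k.
  by rewrite ler_wpM2l// subr_ge0.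
apply: le_trans; rewrite -natr1; have : 0 <= k%:R * (y * y) by rewrite !mulr_ge0.
by lra.
Qed.

Lemma cvg_step_poly u : 0 <= u <= 1 ->
  step_poly k u @[k --> \oo] --> (((1 / 2 <= u)%R)%:R : R).
Proof.
move=> /andP[u0 u1].
have [u2|u2] := leP (1 / 2) u.
  have up1 k : u ^+ k <= 1 by exact: exprn_ile1.
  suff : (1 - u ^+ k) ^+ (k * 2 ^ k) @[k --> \oo] --> (0 : R).
    by move=> h; rewrite -[X in _ --> X]subr0; apply: cvgB => //; exact: cvg_cst.
  apply: (@squeeze_cvgr _ _ _ _ (cst 0) (fun k => (expR (-1)) ^+ k)).
  - near=> k; rewrite exprn_ge0 ?subr_ge0//= mulnC exprM.
    rewrite lerXn2r ?nnegrE ?exprn_ge0 ?expR_ge0 ?subr_ge0//.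
    (* Raising this to the power [2 ^ k] gives at most [expR (-1)]; the remaining factor [k] of the
       exponent drives the bound to 0. *)
    have h : 1 - u ^+ k <= expR (- (1 / 2) ^+ k).
      apply: le_trans (expR_ge1Dx _); rewrite lerD2l lerN2.
      by rewrite lerXn2r// nnegrE.
    apply: (le_trans (lerXn2r _ _ _ h)); rewrite ?nnegrE ?subr_ge0 ?expR_ge0//.
    rewrite -expRM_natl mulrN natrX -exprMn mulrC.
    by rewrite mul1r mulVf// expr1n.
  - exact: cvg_cst.
  - by apply: cvg_expr; rewrite ger0_norm ?expR_ge0// -[ltRHS]expR0 ltr_expR; lra.
(* [k * 2 ^ k * u ^ k] is [k * y ^ k * y ^ k] with [y < 1]: one factor [y ^ k] absorbs [k], the
   other tends to 0. *)
pose y := Num.sqrt (2 * u).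
have y2 : y ^+ 2 = 2 * u by rewrite sqr_sqrtr//; lra.
have y0 : 0 <= y := sqrtr_ge0 _.
have y1 : y < 1 by rewrite -sqrtr1 ltr_sqrt//; lra.
apply: (@squeeze_cvgr _ _ _ _ (cst 0) (fun k => (1 - y)^-1 * y ^+ k)).
- near=> k; have u01 : 0 <= u <= 1 by rewrite u0 u1.
  have /andP[-> _] /= := step_poly_bnd k u01.
  have uk : 0 <= u ^+ k <= 1 by rewrite exprn_ge0// exprn_ile1.
  have := bernoulli_ge (k * 2 ^ k) uk; rewrite /step_poly => h.
  have {h} : 1 - (1 - u ^+ k) ^+ (k * 2 ^ k) <= (k * 2 ^ k)%:R * u ^+ k by lra.
  move=> /le_trans; apply.
  rewrite natrM natrX -mulrA -exprMn -y2 exprAC expr2 mulrA.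
  rewrite ler_wpM2r ?exprn_ge0// -[leRHS]mul1r ler_pdivlMr ?subr_gt0//.
  apply: (le_trans (@mulrn_exp_le y k _)); rewrite ?y0 ?(ltW y1)//.
  by rewrite gerBl exprn_ge0.
- exact: cvg_cst.
- rewrite -[X in _ --> X](mulr0 ((1 - y)^-1)); apply: cvgM; first exact: cvg_cst.
  by apply: cvg_expr; rewrite ger0_norm.
Unshelve. all: by end_near. Qed.

End StepPoly.

Section IndicatorClosure.
Variables (R : realType) (dT : measure_display) (T : measurableType dT).
Variables (K : (T -> R) -> Prop) (Y : T -> R).
Hypothesis mY : measurable_fun setT Y.
Hypothesis K_bmf : forall f, K f -> bounded_mf f.
Hypothesis K_lin : forall a (f : T -> R) b (g : T -> R), K f -> K g ->
  K (fun w => a * f w + b * g w).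
Hypothesis K_lim : forall (f_ : nat -> T -> R) (f : T -> R) M, (forall k, K (f_ k)) ->
  (forall k w, `|f_ k w| <= M) -> measurable_fun setT f ->
  (forall w, f_ k w @[k --> \oo] --> f w) -> K f.
Hypothesis K_cos : forall (f : T -> R) r t, K f -> K (fun w => f w * cos (r * Y w + t)).

(** Multipliers of [K] are closed under products even where [K] itself is not known to be. *)
Definition multiplier (g : T -> R) := forall f : T -> R, K f -> K (fun w => f w * g w).

Lemma multiplier_cst c : multiplier (fun=> c).
Proof.
move=> f Kf; have := K_lin c 0 Kf Kf; congr K; apply/funext => w.
by rewrite mul0r addr0 mulrC.
Qed.

Lemma multiplier_lin a g b h : multiplier g -> multiplier h ->
  multiplier (fun w => a * g w + b * h w).
Proof.
move=> mg mh f Kf; have := K_lin a b (mg _ Kf) (mh _ Kf); congr K.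
by apply/funext => w; rewrite mulrDr !(mulrCA (f w)).
Qed.

Lemma multiplierX g k : multiplier g -> multiplier (fun w => g w ^+ k).
Proof.
move=> mg; elim: k => [|k IH]; first exact: multiplier_cst.
move=> f Kf; have := IH _ (mg _ Kf); congr K; apply/funext => w.
by rewrite exprS mulrA.
Qed.

Lemma multiplier_lim (g_ : nat -> T -> R) (g : T -> R) : (forall k, multiplier (g_ k)) ->
  (forall k w, `|g_ k w| <= 1) -> measurable_fun setT g ->
  (forall w, g_ k w @[k --> \oo] --> g w) -> multiplier g.
Proof.
move=> mg_ g1 mg cg f Kf; have [mf [M fM]] := K_bmf Kf.
apply: (@K_lim (fun k w => f w * g_ k w) _ M).
- by move=> k; exact: mg_.
- move=> k w; rewrite normrM -[leRHS]mulr1.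
  by apply: ler_pM => //; rewrite fM.
- exact: measurable_funM.
- by move=> w; apply: cvgM => //; exact: cvg_cst.
Qed.

Lemma multiplier_sin_ge0 (r t : R) :
  multiplier (fun w => ((0 <= sin (r * Y w + t))%R)%:R).
Proof.
(* [u] is affine in a cosine, and it is at least 1 / 2, the cut point of [step_poly], exactly where
   the sine is nonnegative. *)
pose u w : R := (1 + sin (r * Y w + t)) / 2.
have u01 w : 0 <= u w <= 1.
  by rewrite /u; have := sin_geN1 (r * Y w + t); have := sin_le1 (r * Y w + t); lra.
have mu : multiplier u.
  have : multiplier (fun w => 1 / 2 * 1 + 1 / 2 * cos (r * Y w + (t - pi / 2))).
    apply: multiplier_lin; first exact: multiplier_cst.
    by move=> f Kf; exact: K_cos.
  congr multiplier; apply/funext => w; rewrite addrA cosBpihalf /u.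
  by field.
have mstep k : multiplier (fun w => step_poly k (u w)).
  have h : multiplier (fun w => 1 * 1 + (-1) * (u w) ^+ k).
    by apply: multiplier_lin; [exact: multiplier_cst|exact: multiplierX].
  have : multiplier (fun w => 1 * 1 + (-1) * (1 * 1 + (-1) * (u w) ^+ k) ^+ (k * 2 ^ k)).
    by apply: multiplier_lin; [exact: multiplier_cst|exact: multiplierX].
  congr multiplier; apply/funext => w; rewrite /step_poly.
  by rewrite !mul1r !mulN1r.
apply: (multiplier_lim mstep).
- by move=> k w; have /andP[a b] := step_poly_bnd k (u01 w); rewrite ger0_norm.
- rewrite (_ : (fun w => _) = \1_[set w | 0 <= sin (r * Y w + t)]); last first.
    by apply/funext => w; rewrite indicE mem_setE.
  apply: measurable_indic.
  have ms : measurable_fun setT (fun w => sin (r * Y w + t)).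
    apply: (@measurableT_comp _ _ _ _ _ _ (@sin R)); first by have [] := bounded_mf_sin R.
    by apply: measurable_funD => //; apply: measurable_funM.
  rewrite -[X in measurable X]setTI.
  rewrite (_ : [set w | _] = (fun w => sin (r * Y w + t)) @^-1` `[0, +oo[%classic).
    by apply: ms => //.
  by apply/seteqP; split => w /=; rewrite in_itv/= andbT.
- move=> w; have := cvg_step_poly (u01 w).
  rewrite (_ : (1 / 2 <= u w) = (0 <= sin (r * Y w + t)))//.
  by rewrite /u; apply/idP/idP; lra.
Qed.

(* [Y w - t] and [sin ((Y w - t) / k)] have the same sign once [k * pi] exceeds
   [`|Y w - t|]. *)
Lemma multiplier_ge (t : R) : multiplier (fun w => ((t <= Y w)%R)%:R).
Proof.
apply: (multiplier_lim (fun k => multiplier_sin_ge0 (k.+1%:R^-1) (- (k.+1%:R^-1 * t)))).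
- by move=> k w; case: (0 <= _); rewrite ?normr1 ?normr0.
- rewrite (_ : (fun w => _) = \1_[set w | t <= Y w]); last first.
    by apply/funext => w; rewrite indicE mem_setE.
  apply: measurable_indic; rewrite -[X in measurable X]setTI.
  rewrite (_ : [set w | _] = Y @^-1` `[t, +oo[%classic).
    by apply: mY => //.
  by apply/seteqP; split => w /=; rewrite in_itv/= andbT.
- move=> w; apply: cvg_near_cst.
  near=> k.
  rewrite -mulrBr; have k0 : 0 < k.+1%:R^-1 :> R by rewrite invr_gt0.
  have kb : `|Y w - t| * k.+1%:R^-1 < pi.
    rewrite ltr_pdivrMr// -ltr_pdivrMl ?pi_gt0//.
    apply: (@lt_trans _ _ k%:R); last by rewrite ltr_nat.
    by near: k; exact: nbhs_infty_gtr.
  move: kb; have [ty|ty] := leP t (Y w).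
    rewrite ger0_norm ?subr_ge0// mulrC => kb.
    rewrite sin_ge0_pi// (ltW kb) andbT mulr_ge0 ?subr_ge0// ltW.
  rewrite ltr0_norm ?subr_lt0// => kb.
  suff : 0 < sin (- (k.+1%:R^-1 * (Y w - t))) by rewrite sinN oppr_gt0 ltNge => /negbTE ->.
  apply: sin_gt0_pi; rewrite -mulrN mulrC kb andbT mulr_gt0// oppr_gt0 subr_lt0.
  by [].
Unshelve. all: by end_near. Qed.

End IndicatorClosure.

Section BoundedMean.
Variables (R : realType) (dT : measure_display) (T : measurableType dT).
Variable P : probability T R.
Implicit Types (f g : T -> R).
Local Notation E f := (\int[P]_w f w).

Lemma bounded_mfM f g : bounded_mf f -> bounded_mf g -> bounded_mf (fun w => f w * g w).
Proof.
move=> [mf [M fM]] [mg [N gN]]; split; first exact: measurable_funM.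
exists (M * N) => w; rewrite normrM; exact: ler_pM.
Qed.

Lemma bounded_mf_lin a f b g : bounded_mf f -> bounded_mf g ->
  bounded_mf (fun w => a * f w + b * g w).
Proof.
move=> [mf [M fM]] [mg [N gN]]; split.
  by apply: measurable_funD; apply: measurable_funM.
exists (`|a| * M + `|b| * N) => w; apply: le_trans (ler_normD _ _) _.
by rewrite !normrM lerD// ler_wpM2l.
Qed.

Lemma mean_lin a f b g : bounded_mf f -> bounded_mf g ->
  E (fun w => a * f w + b * g w) = a * E f + b * E g.
Proof.
move=> bf bg.
have fi := bounded_mf_integrable P bf; have gi := bounded_mf_integrable P bg.
rewrite -!RintegralZl// -RintegralD//.
- by have := integrableZl measurableT a fi; exact: eq_integrable.
- by have := integrableZl measurableT b gi; exact: eq_integrable.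
Qed.

Lemma mean_lim (f_ : nat -> T -> R) f M : (forall k, measurable_fun setT (f_ k)) ->
  (forall k w, `|f_ k w| <= M) -> measurable_fun setT f ->
  (forall w, f_ k w @[k --> \oo] --> f w) -> E (f_ k) @[k --> \oo] --> E f.
Proof.
move=> mf_ fM mf cf.
have [] := @dominated_convergence _ T R P setT measurableT
  (fun k w => (f_ k w)%:E) (fun w => (f w)%:E) (fun=> M%:E).
- by move=> k; apply/measurable_EFinP.
- exact/measurable_EFinP.
- apply: aeW => w _; apply: cvg_EFin; first by apply: nearW.
  exact: cf.
- exact: (@finite_measure_integrable_cst _ _ _ P).
- by apply: aeW => w k _; rewrite lee_fin.
move=> fi _ cv; apply: fine_cvg; rewrite /Rintegral fineK//.
exact: integrable_fin_num.
Qed.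

Lemma eq_mean_fun f g : f =1 g -> E f = E g.
Proof. by move=> fg; congr Rintegral; apply/funext. Qed.

Lemma mean_cst_fun c : E (fun=> c) = c.
Proof.
rewrite Rintegral_cst//.
exact: etrans (congr1 (fun z => c * fine z) (probability_setT P)) (mulr1 c).
Qed.

End BoundedMean.

(** * Uncorrelated linear forms of a Gaussian field are independent *)

Section GaussianIndependence.
Variables (R : realType) (dT : measure_display) (T : measurableType dT).
Variables (P : probability T R) (I : finType) (C : I -> I -> R).
Variable phi : I -> T -> R.
Hypothesis phi_field : is_centred_gaussian_field P C phi.
Hypothesis C_sym : forall x y, C x y = C y x.
Local Notation E f := (\int[P]_w f w).

Definition lin (a : I -> R) (w : T) : R := \sum_x a x * phi x w.
Definition cov (a b : I -> R) : R := \sum_x \sum_y a x * b y * C x y.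

Lemma lin_law a : has_gaussian_law P (lin a) (cov a a).
Proof.
have [mphi H] := phi_field; split.
  by apply: measurable_sum => x; apply: measurable_funM.
move=> B mB; rewrite -H//; congr (P _).
by apply/seteqP; split => w /=; rewrite ?inE// => /set_mem.
Qed.

Lemma measurable_lin a : measurable_fun setT (lin a).
Proof. by have [] := lin_law a. Qed.

Lemma linD a b w : lin (fun x => a x + b x) w = lin a w + lin b w.
Proof. by rewrite -big_split; apply: eq_bigr => x _; rewrite mulrDl. Qed.

Lemma linZ c a w : lin (fun x => c * a x) w = c * lin a w.
Proof. by rewrite mulr_sumr; apply: eq_bigr => x _; rewrite mulrA. Qed.

Lemma lin_single y w : lin (fun x => (x == y)%:R) w = phi y w.
Proof.
rewrite /lin (bigD1 y)//= eqxx mul1r big1 ?addr0// => x /negbTE ->.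
by rewrite mul0r.
Qed.

Lemma covC a b : cov a b = cov b a.
Proof.
rewrite /cov exchange_big; apply: eq_bigr => x _; apply: eq_bigr => y _.
by rewrite C_sym (mulrC (a y)).
Qed.

Lemma covDl a b c : cov (fun x => a x + b x) c = cov a c + cov b c.
Proof.
rewrite -big_split; apply: eq_bigr => x _; rewrite -big_split.
by apply: eq_bigr => y _; rewrite !mulrDl.
Qed.

Lemma covZl s a c : cov (fun x => s * a x) c = s * cov a c.
Proof.
rewrite mulr_sumr; apply: eq_bigr => x _; rewrite mulr_sumr.
by apply: eq_bigr => y _; rewrite !mulrA.
Qed.

Lemma covDr a b c : cov c (fun x => a x + b x) = cov c a + cov c b.
Proof. by rewrite covC covDl !(covC c). Qed.

Lemma covZr s a c : cov c (fun x => s * a x) = s * cov c a.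
Proof. by rewrite covC covZl (covC c). Qed.

(* If [cov a a < 0], both [lin a] and [- lin a] would follow the junk law of
   [gaussian_law], the uniform one on [[0, 1]]. *)
Lemma cov_ge0 a : 0 <= cov a a.
Proof.
rewrite leNgt; apply/negP => v0.
have [mX XP] := lin_law a; have [_ YP] := lin_law (fun x => -1 * a x).
have vE : cov (fun x => -1 * a x) (fun x => -1 * a x) = cov a a.
  by rewrite covZl covZr mulrA mulrNN !mul1r.
have gE B : gaussian_law (cov a a) B = normal_prob 0 0 B.
  by rewrite /gaussian_law lt_eqF// ler0_sqrtr ?ltW.
have N01 : normal_prob (0 : R) 0 `[0, 1]%classic = 1%E.
  rewrite /normal_prob /normal_pdf eqxx integral_indic//= setIid.
  by rewrite lebesgue_measure_itv/= lte01 oppr0 adde0.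
have N0 : normal_prob (0 : R) 0 [set 0] = 0%E.
  by rewrite /normal_prob integral_set1.
have P1 := XP _ (measurable_itv `[0, 1]); rewrite gE N01 in P1.
have P2 := YP _ (measurable_itv `[0, 1]); rewrite vE gE N01 in P2.
have P0 := XP _ (measurable_set1 (0 : R)); rewrite gE N0 in P0.
set A1 := lin a @^-1` _ in P1; set A2 := lin _ @^-1` _ in P2.
have mA1 : measurable A1.
  by rewrite -[A1]setTI; exact: (mX measurableT _ (measurable_itv `[0, 1])).
have mA2 : measurable A2.
  rewrite -[A2]setTI.
  exact: (measurable_lin (fun x => -1 * a x) measurableT (measurable_itv `[0, 1])).
(* Almost surely [lin a] and its opposite both lie in [[0, 1]], so [lin a] is 0; but the uniform law
   gives no mass to a point. *)
have : (P (~` (A1 `&` A2)) = 0)%E.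
  have Q1 : P (~` A1) = 0%E by rewrite probability_setC// P1 subee.
  have Q2 : P (~` A2) = 0%E by rewrite probability_setC// P2 subee.
  apply/eqP; rewrite -measure_le0 setCI.
  apply: (@le_trans _ _ (P (~` A1) + P (~` A2))%E); last by rewrite Q1 Q2 adde0.
  by apply: measureU2; exact: measurableC.
rewrite probability_setC; last exact: measurableI.
have -> : A1 `&` A2 = lin a @^-1` [set 0].
  apply/seteqP; split => w.
    rewrite /A1 /A2 /= !in_itv/= linZ => -[/andP[h1 _] /andP[h2 _]].
    by apply/eqP; rewrite eq_le h1 andbT; lra.
  rewrite /A1 /A2 /= !in_itv/= linZ => ->.
  by rewrite mulr0 lexx ler01.
by rewrite P0 sube0 => /eqP; rewrite eqe oner_eq0.
Qed.

Lemma mean_cos_lin a t : E (fun w => cos (lin a w + t)) = cos t * cos_mean (cov a a).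
Proof. by rewrite (mean_cos_phase _ (cov_ge0 a) (lin_law a)). Qed.

Lemma bounded_mf_cos_lin a t : bounded_mf (fun w => cos (lin a w + t)).
Proof.
split; last by exists 1 => w; exact: cos_max.
have [mc _] := bounded_mf_cosD t.
exact: (measurableT_comp mc (measurable_lin a)).
Qed.

Lemma cos_mul (a b : R) : cos a * cos b = 1 / 2 * cos (a + b) + 1 / 2 * cos (a - b).
Proof. by rewrite cosD cosB; field. Qed.

Variables (a0 : I -> R) (J : {set I}).
Hypothesis orth : forall y, y \in J -> \sum_x a0 x * C x y = 0.

Definition supported (b : I -> R) := forall y, y \notin J -> b y = 0.

Lemma cov_orth b : supported b -> cov a0 b = 0.
Proof.
move=> bJ; rewrite /cov exchange_big big1// => y _.
have [yJ|yJ] := boolP (y \in J).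
  transitivity (b y * \sum_x a0 x * C x y); last by rewrite orth// mulr0.
  by rewrite mulr_sumr; apply: eq_bigr => x _; ring.
by rewrite big1// => x _; rewrite bJ// mulr0 mul0r.
Qed.

Lemma cov_add_orth b s : supported b ->
  cov (fun x => b x + s * a0 x) (fun x => b x + s * a0 x) =
  cov b b + s ^+ 2 * cov a0 a0.
Proof.
move=> bJ; rewrite !(covDl, covDr, covZl, covZr) (covC b) cov_orth//; ring.
Qed.

(** The product is a half-sum of cosines of [lin b] plus or minus [s * lin a0]. By orthogonality
    both forms have the variance [cov b b + s ^+ 2 * cov a0 a0], over which [cos_mean] is
    multiplicative. *)
Lemma cos_orth b s t t' : supported b ->
  E (fun w => cos (lin b w + t) * cos (s * lin a0 w + t')) =
  E (fun w => cos (lin b w + t)) * E (fun w => cos (s * lin a0 w + t')).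
Proof.
move=> bJ.
have -> : E (fun w => cos (lin b w + t) * cos (s * lin a0 w + t')) =
   E (fun w => 1 / 2 * cos (lin (fun x => b x + s * a0 x) w + (t + t')) +
               1 / 2 * cos (lin (fun x => b x + (- s) * a0 x) w + (t - t'))).
  apply: eq_mean_fun => w; rewrite cos_mul !linD !linZ.
  by congr (_ * cos _ + _ * cos _); ring.
rewrite mean_lin; try exact: bounded_mf_cos_lin.
rewrite !mean_cos_lin !cov_add_orth// sqrrN.
have -> : E (fun w => cos (s * lin a0 w + t')) =
    E (fun w => cos (lin (fun x => s * a0 x) w + t')).
  by apply: eq_mean_fun => w; rewrite linZ.
rewrite mean_cos_lin covZl covZr (_ : s * (s * _) = s ^+ 2 * cov a0 a0); last by ring.
rewrite cos_mean_add ?(mulr_ge0 (sqr_ge0 s)) ?cov_ge0//.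
rewrite (cosD t t') (cosB t t').
move: (cos_mean _) (cos_mean _) (cos t) (cos t') (sin t) (sin t') => m1 m2 c1 c2 s1 s2.
by field.
Qed.

(* The extra factor [cos (lin b w + t)] makes this property stable under
   multiplication by [cos (r * phi y w + t)] for [y \in J]. *)
Definition splits (f : T -> R) := bounded_mf f /\ forall b s t t', supported b ->
  E (fun w => f w * cos (lin b w + t) * cos (s * lin a0 w + t')) =
  E (fun w => f w * cos (lin b w + t)) * E (fun w => cos (s * lin a0 w + t')).

Lemma bounded_mf_cos_scale s t : bounded_mf (fun w => cos (s * lin a0 w + t)).
Proof.
have := bounded_mf_cos_lin (fun x => s * a0 x) t; congr bounded_mf.
by apply/funext => w; rewrite linZ.
Qed.

Lemma bounded_mf_cst (c : R) : bounded_mf (fun _ : T => c).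
Proof. by split => //; exists `|c|. Qed.

Lemma splits_lin a f b g : splits f -> splits g -> splits (fun w => a * f w + b * g w).
Proof.
move=> [bf hf] [bg hg]; split; first exact: bounded_mf_lin.
move=> c s t t' cJ.
have bc := bounded_mf_cos_lin c t; have bs := bounded_mf_cos_scale s t'.
have bfc := bounded_mfM bf bc; have bgc := bounded_mfM bg bc.
rewrite (@eq_mean_fun _ _ _ P _ (fun w =>
   a * (f w * cos (lin c w + t) * cos (s * lin a0 w + t')) +
   b * (g w * cos (lin c w + t) * cos (s * lin a0 w + t')))); last first.
  by move=> w; ring.
rewrite mean_lin; try exact: bounded_mfM.
rewrite hf// hg// !mulrA -mulrDl; congr (_ * _).
by rewrite -mean_lin//; apply: eq_mean_fun => w; ring.
Qed.

Lemma splits_lim (f_ : nat -> T -> R) (f : T -> R) M : (forall k, splits (f_ k)) ->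
  (forall k w, `|f_ k w| <= M) -> measurable_fun setT f ->
  (forall w, f_ k w @[k --> \oo] --> f w) -> splits f.
Proof.
move=> sf_ fM mf cf.
have bf : bounded_mf f.
  split => //; exists M => w.
  by apply: (cvgr_to_le (cvg_norm (cf w))); apply: nearW => k.
split => // b s t t' bJ.
have bc := bounded_mf_cos_lin b t; have bs := bounded_mf_cos_scale s t'.
have fcM k w g : bounded_mf g -> (forall w, `|g w| <= 1) -> `|f_ k w * g w| <= M.
  move=> _ g1; rewrite normrM -[leRHS]mulr1; exact: ler_pM.
have lim1 : E (fun w => f_ k w * cos (lin b w + t)) @[k --> \oo] -->
    E (fun w => f w * cos (lin b w + t)).
  apply: (@mean_lim _ _ _ _ _ _ M).
  - by move=> k; have [h _] := bounded_mfM (sf_ k).1 bc.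
  - by move=> k w; apply: (fcM k w (fun w => cos (lin b w + t))) => // ?; exact: cos_max.
  - by have [h _] := bounded_mfM bf bc.
  - by move=> w; apply: cvgM => //; exact: cvg_cst.
have lim2 : E (fun w => f_ k w * cos (lin b w + t) * cos (s * lin a0 w + t'))
    @[k --> \oo] -->
    E (fun w => f w * cos (lin b w + t) * cos (s * lin a0 w + t')).
  apply: (@mean_lim _ _ _ _ _ _ M).
  - by move=> k; have [h _] := bounded_mfM (bounded_mfM (sf_ k).1 bc) bs.
  - move=> k w; rewrite -mulrA.
    apply: (fcM k w (fun w => cos (lin b w + t) * cos (s * lin a0 w + t'))).
      exact: bounded_mfM.
    by move=> ?; rewrite normrM -[leRHS]mulr1; apply: ler_pM => //; exact: cos_max.
  - by have [h _] := bounded_mfM (bounded_mfM bf bc) bs.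
  - by move=> w; apply: cvgM; [apply: cvgM => //|]; exact: cvg_cst.
rewrite -(cvg_lim _ lim2)//; apply: cvg_lim => //.
under eq_cvg do rewrite (sf_ _).2//.
by apply: cvgM => //; exact: cvg_cst.
Qed.

Lemma splits_cos y : y \in J -> forall f r t, splits f ->
  splits (fun w => f w * cos (r * phi y w + t)).
Proof.
move=> yJ f r t [bf hf].
have rE w : r * phi y w = lin (fun x => r * (x == y)%:R) w by rewrite linZ lin_single.
have bc : bounded_mf (fun w => cos (r * phi y w + t)).
  under eq_fun do rewrite rE; exact: bounded_mf_cos_lin.
split; first exact: bounded_mfM.
move=> b s u u' bJ.
pose b1 x := b x + r * (x == y)%:R; pose b2 x := b x + (- r) * (x == y)%:R.
have s1 : supported b1.
  move=> z zJ; rewrite /b1 bJ// add0r; case: eqP => [zy|_]; last by rewrite mulr0.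
  by rewrite zy yJ in zJ.
have s2 : supported b2.
  move=> z zJ; rewrite /b2 bJ// add0r; case: eqP => [zy|_]; last by rewrite mulr0.
  by rewrite zy yJ in zJ.
have cE w : cos (r * phi y w + t) * cos (lin b w + u) =
   1 / 2 * cos (lin b1 w + (u + t)) + 1 / 2 * cos (lin b2 w + (u - t)).
  rewrite mulrC cos_mul !linD !linZ lin_single.
  by congr (_ * cos _ + _ * cos _); ring.
have bcl c v := bounded_mfM bf (bounded_mf_cos_lin c v).
have bs := bounded_mf_cos_scale s u'.
transitivity (E (fun w => 1 / 2 * (f w * cos (lin b1 w + (u + t)) * cos (s * lin a0 w + u'))
   + 1 / 2 * (f w * cos (lin b2 w + (u - t)) * cos (s * lin a0 w + u')))).
  by apply: eq_mean_fun => w; rewrite -(mulrA (f w)) cE; ring.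
rewrite mean_lin; try by apply: bounded_mfM.
rewrite !hf// !mulrA -mulrDl; congr (_ * _).
rewrite -mean_lin; try exact: bcl.
by apply: eq_mean_fun => w; rewrite -(mulrA (f w)) cE; ring.
Qed.

Lemma lin0 w : lin (fun=> 0) w = 0.
Proof. by rewrite /lin big1// => x _; rewrite mul0r. Qed.

Lemma splits1 : splits (fun=> 1).
Proof.
split; first exact: bounded_mf_cst.
move=> b s t t' bJ; rewrite -(@eq_mean_fun _ _ _ P _ _ (fun w => esym (mul1r _))).
by rewrite -cos_orth//; apply: eq_mean_fun => w; rewrite mul1r.
Qed.

Lemma multiplier_prod (K : (T -> R) -> Prop) (s : seq I) (Q : pred I) (g : I -> T -> R) :
  (forall i, Q i -> multiplier K (g i)) ->
  multiplier K (fun w => \prod_(i <- s | Q i) g i w).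
Proof.
move=> mg; elim: s => [|i s IH] f Kf.
  by move: Kf; congr K; apply/funext => w; rewrite big_nil mulr1.
have [Qi|Qi] := boolP (Q i); last first.
  by have := IH _ Kf; congr K; apply/funext => w; rewrite big_cons (negbTE Qi).
have := IH _ (mg _ Qi _ Kf); congr K; apply/funext => w.
by rewrite big_cons Qi mulrA.
Qed.

Lemma multiplier_sum (K : (T -> R) -> Prop) (U : Type) (s : seq U) (Q : pred U)
    (g : U -> T -> R) :
  (forall a (f : T -> R) b (g : T -> R), K f -> K g -> K (fun w => a * f w + b * g w)) ->
  (forall i, Q i -> multiplier K (g i)) ->
  multiplier K (fun w => \sum_(i <- s | Q i) g i w).
Proof.
move=> Klin mg; elim: s => [|i s IH] f Kf.
  have := Klin 0 f 0 f Kf Kf; congr K; apply/funext => w.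
  by rewrite big_nil !mul0r mulr0 addr0.
have [Qi|Qi] := boolP (Q i); last first.
  by have := IH _ Kf; congr K; apply/funext => w; rewrite big_cons (negbTE Qi).
have := Klin 1 _ 1 _ (mg _ Qi _ Kf) (IH _ Kf); congr K; apply/funext => w.
by rewrite big_cons Qi !mul1r mulrDr.
Qed.

Variable t : I -> R.

Definition active (w : T) : {set I} := [set y in J | t y <= phi y w].

(** The indicator of [active w = S] for [S] inside [J], written as a product of multipliers;
    [1 * 1 + (-1) * _] is the shape that [multiplier_lin] produces. *)
Definition pattern (S : {set I}) (w : T) : R :=
  \prod_(y in J) (if y \in S then ((t y <= phi y w)%R)%:R
                  else 1 * 1 + (-1) * ((t y <= phi y w)%R)%:R).

Lemma patternE (S : {set I}) w : S \subset J -> pattern S w = (S == active w)%:R.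
Proof.
move=> /fintype.subsetP SJ; case: eqP => [->|neq].
  rewrite /pattern big1// => y yJ; rewrite inE yJ/=.
  by case: (t y <= phi y w) => /=; ring.
have [y yJ yS] : exists2 y, y \in J & (y \in S) != (t y <= phi y w).
  apply/exists_inP; apply: contra_notT neq => /exists_inPn h.
  apply/setP => y; rewrite inE; have [yJ|yJ] := boolP (y \in J).
    by have := h y yJ; rewrite negbK => /eqP.
  by apply/negbTE; apply: contra yJ; exact: SJ.
rewrite /pattern (bigD1 y)//=; move: yS.
by case: (y \in S); case: (t y <= phi y w) => //= _; ring.
Qed.

Lemma active_expand (F : {set I} -> R) w :
  F (active w) = \sum_(S : {set I} | S \subset J) F S * pattern S w.
Proof.
rewrite (bigD1 (active w))/=; last by apply/fintype.subsetP => y; rewrite inE => /andP[].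
rewrite patternE; last by apply/fintype.subsetP => y; rewrite inE => /andP[].
rewrite eqxx mulr1 big1 ?addr0// => S /andP[SJ /negbTE SA].
by rewrite patternE// SA mulr0.
Qed.

Lemma splits_active (F : {set I} -> R) : splits (fun w => F (active w)).
Proof.
have mul : multiplier splits (fun w => \sum_(S : {set I} | S \subset J) F S * pattern S w).
  apply: multiplier_sum => [|S _]; first exact: splits_lin.
  have mp : multiplier splits (pattern S).
    apply: multiplier_prod => y yJ.
    have mi : multiplier splits (fun w => ((t y <= phi y w)%R)%:R).
      apply: (multiplier_ge (phi_field.1 y)).
      - by move=> f [].
      - exact: splits_lin.
      - exact: splits_lim.
      - by move=> f r u; exact: splits_cos.
    case: (y \in S) => //; apply: multiplier_lin => //; first exact: splits_lin.
    by apply: multiplier_cst; exact: splits_lin.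
  move=> f sf; have := splits_lin (F S) 0 (mp _ sf) sf; congr splits.
  by apply/funext => w; rewrite mul0r addr0; ring.
have := mul _ splits1; congr splits; apply/funext => w.
by rewrite mul1r active_expand.
Qed.

(** Second stage: [m], a function of the sites of [J], is now fixed, and the functions of [lin a0]
    are carried from cosines to indicators. *)
Definition splits_off (m g : T -> R) := bounded_mf g /\ forall s t',
  E (fun w => m w * g w * cos (s * lin a0 w + t')) =
  E m * E (fun w => g w * cos (s * lin a0 w + t')).

Lemma splits_off1 m : splits m -> splits_off m (fun=> 1).
Proof.
move=> [bm hm]; split; first exact: bounded_mf_cst.
move=> s t'; have := hm (fun=> 0) s 0 t' (fun _ _ => erefl).
have c0 w : cos (lin (fun=> 0) w + 0) = 1 by rewrite lin0 addr0 cos0.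
rewrite (@eq_mean_fun _ _ _ P _ (fun w => m w * 1 * cos (s * lin a0 w + t'))); last first.
  by move=> w; rewrite c0.
move=> ->; congr (_ * _); apply: eq_mean_fun => w; last by rewrite mul1r.
by rewrite c0 mulr1.
Qed.

Lemma splits_off_lin m : bounded_mf m -> forall a f b g,
  splits_off m f -> splits_off m g -> splits_off m (fun w => a * f w + b * g w).
Proof.
move=> bm a f b g [bf hf] [bg hg]; split; first exact: bounded_mf_lin.
move=> s t'; have bs := bounded_mf_cos_scale s t'.
rewrite (@eq_mean_fun _ _ _ P _ (fun w =>
   a * (m w * f w * cos (s * lin a0 w + t')) +
   b * (m w * g w * cos (s * lin a0 w + t')))); last by move=> w; ring.
rewrite mean_lin; try by apply: bounded_mfM => //; exact: bounded_mfM.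
rewrite hf hg mulrCA (mulrCA b) -mulrDr; congr (_ * _).
rewrite -mean_lin; try exact: bounded_mfM.
by apply: eq_mean_fun => w; ring.
Qed.

Lemma splits_off_lim m : bounded_mf m -> forall (f_ : nat -> T -> R) (f : T -> R) M,
  (forall k, splits_off m (f_ k)) ->
  (forall k w, `|f_ k w| <= M) -> measurable_fun setT f ->
  (forall w, f_ k w @[k --> \oo] --> f w) -> splits_off m f.
Proof.
move=> bm f_ f M sf_ fM mf cf.
have bf : bounded_mf f.
  split => //; exists M => w.
  by apply: (cvgr_to_le (cvg_norm (cf w))); apply: nearW => k.
split => // s t'; have bs := bounded_mf_cos_scale s t'.
have [mm [N mN]] := bm.
have lim1 : E (fun w => f_ k w * cos (s * lin a0 w + t')) @[k --> \oo] -->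
    E (fun w => f w * cos (s * lin a0 w + t')).
  apply: (@mean_lim _ _ _ _ _ _ M).
  - by move=> k; have [h _] := bounded_mfM (sf_ k).1 bs.
  - move=> k w; rewrite normrM -[leRHS]mulr1; apply: ler_pM => //; exact: cos_max.
  - by have [h _] := bounded_mfM bf bs.
  - by move=> w; apply: cvgM => //; exact: cvg_cst.
have lim2 : E (fun w => m w * f_ k w * cos (s * lin a0 w + t')) @[k --> \oo] -->
    E (fun w => m w * f w * cos (s * lin a0 w + t')).
  apply: (@mean_lim _ _ _ _ _ _ (N * M)).
  - by move=> k; have [h _] := bounded_mfM (bounded_mfM bm (sf_ k).1) bs.
  - move=> k w; rewrite !normrM -[leRHS]mulr1; apply: ler_pM => //.
    + exact: ler_pM.
    + exact: cos_max.
  - by have [h _] := bounded_mfM (bounded_mfM bm bf) bs.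
  - by move=> w; apply: cvgM; [apply: cvgM => //|]; exact: cvg_cst.
rewrite -(cvg_lim _ lim2)//; apply: cvg_lim => //.
under eq_cvg do rewrite (sf_ _).2.
by apply: cvgM => //; exact: cvg_cst.
Qed.

Lemma splits_off_cos m : bounded_mf m -> forall g r u, splits_off m g ->
  splits_off m (fun w => g w * cos (r * lin a0 w + u)).
Proof.
move=> bm g r u [bg hg]; split; first exact: bounded_mfM (bounded_mf_cos_scale _ _).
move=> s t'; have bgs s' v := bounded_mfM bg (bounded_mf_cos_scale s' v).
have cE w : cos (r * lin a0 w + u) * cos (s * lin a0 w + t') =
   1 / 2 * cos ((r + s) * lin a0 w + (u + t')) + 1 / 2 * cos ((r - s) * lin a0 w + (u - t')).
  by rewrite cos_mul; congr (_ * cos _ + _ * cos _); ring.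
transitivity (E (fun w => 1 / 2 * (m w * g w * cos ((r + s) * lin a0 w + (u + t')))
   + 1 / 2 * (m w * g w * cos ((r - s) * lin a0 w + (u - t'))))).
  by apply: eq_mean_fun => w; rewrite mulrA -(mulrA _ (cos _)) cE; ring.
rewrite mean_lin; try by apply: bounded_mfM; [exact: bounded_mfM|exact: bounded_mf_cos_scale].
rewrite !hg mulrCA (mulrCA (1 / 2)) -mulrDr; congr (_ * _).
rewrite -mean_lin; try exact: bgs.
by apply: eq_mean_fun => w; rewrite -(mulrA (g w)) cE; ring.
Qed.

Lemma bounded_mf_active (F : {set I} -> R) : bounded_mf (fun w => F (active w)).
Proof. by case: (splits_active F). Qed.

Lemma active_indep (F : {set I} -> R) u :
  E (fun w => F (active w) * ((u <= lin a0 w)%R)%:R) =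
  E (fun w => F (active w)) * E (fun w => ((u <= lin a0 w)%R)%:R).
Proof.
have sm := splits_active F; set m := fun w => F (active w) in sm *.
have [bm _] := sm.
have mul := multiplier_ge (measurable_lin a0) (fun g (h : splits_off m g) => h.1)
  (splits_off_lin bm) (splits_off_lim bm) (splits_off_cos bm) u.
(* At frequency and phase 0 the leftover cosine is 1. *)
have [_ h] := mul _ (splits_off1 sm); have := h 0 0.
have c0 w : cos (0 * lin a0 w + 0) = 1 by rewrite mul0r addr0 cos0.
rewrite (@eq_mean_fun _ _ _ P _ (fun w => m w * ((u <= lin a0 w)%R)%:R)); last first.
  by move=> w; rewrite c0 mul1r mulr1.
move=> ->; congr (_ * _); apply: eq_mean_fun => w.
by rewrite c0 mul1r mulr1.
Qed.

End GaussianIndependence.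

(** * Superharmonic functions on the lattice *)

Section PowerBound.
Variable R : realType.
Implicit Types (w b : R).

Definition quartic b (c2 c3 c4 : R) w : R :=
  1 - b * w + c2 * w ^+ 2 - c3 * w ^+ 3 + c4 * w ^+ 4.

(* [(1 + w) `^ b * quartic w] has derivative [(1 + w) `^ (b - 1) * w * r w] with
   [r] the cubic below, hence is minimal at [w = 0]. *)
Lemma powR_quartic b (c2 c3 c4 lo hi : R) : 0 < b -> -1 < lo -> lo <= 0 -> 0 <= hi ->
  (forall w, lo <= w <= hi ->
    0 <= (2 * c2 - b - b ^+ 2) + (2 * c2 - 3 * c3 + b * c2) * w +
         (4 * c4 - 3 * c3 - b * c3) * w ^+ 2 + (4 + b) * c4 * w ^+ 3) ->
  forall w, lo <= w <= hi -> (1 + w) `^ (- b) <= quartic b c2 c3 c4 w.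
Proof.
move=> b0 lo1 lo0 hi0 r_ge0 w /andP[low whi].
pose r w := (2 * c2 - b - b ^+ 2) + (2 * c2 - 3 * c3 + b * c2) * w +
         (4 * c4 - 3 * c3 - b * c3) * w ^+ 2 + (4 + b) * c4 * w ^+ 3.
pose G (x : R) : R := quartic b c2 c3 c4 (x - 1) * x `^ b.
pose dG (x : R) : R := x `^ (b - 1) * (x - 1) * r (x - 1).
have dGE (x : R) : 0 < x -> is_derive x 1 G (dG x).
  move=> x0.
  have dq : is_derive x 1 (fun x : R => quartic b c2 c3 c4 (x - 1))
    (- b + 2 * c2 * (x - 1) - 3 * c3 * (x - 1) ^+ 2 + 4 * c4 * (x - 1) ^+ 3).
    rewrite /quartic; apply: is_derive_eq.
    by rewrite /GRing.scale/= !mulr_natl; ring.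
  have dp := is_derive1_powR b x0.
  rewrite /G; apply: is_derive_eq.
  rewrite /dG /r /quartic /GRing.scale/=.
  have -> : x `^ b = x * x `^ (b - 1).
    transitivity (x `^ (1 + (b - 1))); first by congr powR; ring.
    by rewrite (@powRD _ x 1) ?lt0r_neq0 ?implybT// powRr1 ?ltW.
  by ring.
have G1 : G 1 = 1.
  by rewrite /G subrr /quartic powR1 !expr0n /= ; ring.
have cG (x y : R) : 0 < x -> {within `[x, y], continuous G}.
  move=> x0; apply: derivable_within_continuous => z; rewrite in_itv/= => /andP[xz _].
  by have [] := dGE z (lt_le_trans x0 xz).
have w1 : 0 < 1 + w by lra.
suff GE : 1 <= G (1 + w).
  have E : quartic b c2 c3 c4 w = G (1 + w) * (1 + w) `^ (- b).
    by rewrite /G addrC addKr -mulrA -powRD ?lt0r_neq0 ?implybT// subrr powRr0 mulr1.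
  by rewrite E ler_peMl// powR_ge0.
have [w0|w0|->] := ltgtP w 0; last by rewrite addr0 G1.
  have ab : 1 + w < 1 by lra.
  have dab x : x \in `]1 + w, 1[%R -> is_derive x 1 G (dG x).
    by rewrite in_itv/= => /andP[h _]; apply: dGE; exact: lt_trans h.
  have [c] := MVT ab dab (cG _ _ w1).
  rewrite in_itv/= => /andP[wc c1].
  rewrite G1 => H; have : dG c * (1 - (1 + w)) <= 0.
    rewrite /dG; rewrite mulr_le0_ge0//; last by lra.
    rewrite mulr_le0_ge0 ?r_ge0//; last by lra.
    by rewrite mulr_ge0_le0 ?powR_ge0//; lra.
  by lra.
have ab : 1 < 1 + w by lra.
have dab x : x \in `]1, 1 + w[%R -> is_derive x 1 G (dG x).
  by rewrite in_itv/= => /andP[h _]; apply: dGE; exact: lt_trans h.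
have [c] := MVT ab dab (cG _ _ ltr01).
rewrite in_itv/= => /andP[wc c1].
rewrite G1 => H; have : 0 <= dG c * (1 + w - 1).
  rewrite /dG; rewrite mulr_ge0//; last by lra.
  rewrite mulr_ge0 ?r_ge0//; last by lra.
  by rewrite mulr_ge0 ?powR_ge0//; lra.
by lra.
Qed.

End PowerBound.

Section Superharmonic.
Variables (R : realType) (d : nat).
Implicit Types (z : zpt d) (H : zpt d -> R) (K : nat).

Definition avg H z : R :=
  (d.*2)%:R^-1 * \sum_(i < d) (H (zshift z i (-1)) + H (zshift z i 1)).

Definition origin : zpt d := [ffun=> 0].

(** Truncation at [K] makes each comparison an induction on [K]; boundedness of the full series is a
    consequence, in [green_sum_bnd]. *)
Definition green_sum K z : R := \sum_(0 <= k < K) srw_p R k z.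

Lemma srw_p0 z : srw_p R 0 z = (z == origin)%:R.
Proof.
have -> : (z == origin) = [forall i, z i == 0].
  apply/eqP/forallP => [-> i|h]; first by rewrite ffunE.
  by apply/ffunP => i; rewrite ffunE; apply/eqP.
by rewrite /=; case: ifP.
Qed.

Lemma srw_p_ge0 k z : 0 <= srw_p R k z.
Proof.
elim: k z => [|k IH] z; first by rewrite srw_p0.
by rewrite /= mulr_ge0// sumr_ge0// => i _; rewrite addr_ge0.
Qed.

Lemma green_sum_ge0 K z : 0 <= green_sum K z.
Proof. by apply: sumr_ge0 => k _; exact: srw_p_ge0. Qed.

Lemma green_sumS K z : green_sum K.+1 z = (z == origin)%:R + avg (green_sum K) z.
Proof.
rewrite /green_sum big_nat_recl// srw_p0; congr (_ + _).
rewrite /avg /= -mulr_sumr exchange_big /=; congr (_ * _).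
by apply: eq_bigr => i _; rewrite big_split.
Qed.

Lemma le_avg H1 H2 z : (forall z, H1 z <= H2 z) -> avg H1 z <= avg H2 z.
Proof. by move=> h; rewrite ler_wpM2l// ler_sum// => i _; rewrite lerD. Qed.

Lemma avgZ c H z : avg (fun z => c * H z) z = c * avg H z.
Proof.
rewrite /avg [RHS]mulrCA; congr (_ * _); rewrite mulr_sumr.
by apply: eq_bigr => i _; rewrite mulrDr.
Qed.

Lemma green_sum_super H : (forall z, 0 <= H z) ->
  (forall z, (z == origin)%:R + avg H z <= H z) -> forall K z, green_sum K z <= H z.
Proof.
move=> H0 Hs; elim=> [|K IH] z; first by rewrite /green_sum big_nil.
by rewrite green_sumS; apply: le_trans (Hs z); rewrite lerD2l; exact: le_avg.
Qed.

(** A maximum principle: like the probability of ever hitting the origin, the normalised sum is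
    below any nonnegative function superharmonic off the origin and normalised there. The induction
    uses that the sums at the origin increase with [K]. *)
Lemma green_sum_ratio H : (forall z, 0 <= H z) ->
  (forall z, z != origin -> avg H z <= H z) ->
  forall K z, green_sum K z * H origin <= H z * green_sum K origin.
Proof.
move=> H0 Hs; elim=> [|K IH] z; first by rewrite /green_sum !big_nil mul0r mulr0.
have [->|z0] := eqVneq z origin; first by rewrite mulrC.
rewrite green_sumS (negbTE z0) add0r mulrC -avgZ.
apply: (@le_trans _ _ (avg (fun z => green_sum K origin * H z) z)).
  by apply: le_avg => z'; rewrite mulrC [leRHS]mulrC.
rewrite avgZ mulrC ler_pM ?green_sum_ge0//.
- by rewrite mulr_ge0// sumr_ge0// => i _; rewrite addr_ge0.
- exact: Hs.
- by rewrite /green_sum big_nat_recr//= lerDl srw_p_ge0.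
Qed.

Definition normsq z : R := \sum_i (z i)%:~R ^+ 2.

Lemma normsq_ge0 z : 0 <= normsq z.
Proof. by apply: sumr_ge0 => i _; exact: sqr_ge0. Qed.

Lemma normsq_zshift z i (s : int) :
  normsq (zshift z i s) = normsq z + 2 * s%:~R * (z i)%:~R + s%:~R ^+ 2.
Proof.
rewrite /normsq !(bigD1 i (P := predT))//= ffunE eqxx intrD.
rewrite (eq_bigr (fun j => (z j)%:~R ^+ 2)); first by ring.
by move=> j /negbTE ji; rewrite ffunE ji addr0.
Qed.

Lemma normsq_int z : exists u : nat, normsq z = u%:R.
Proof.
exists (\sum_i `|z i| ^ 2)%N; rewrite natr_sum; apply: eq_bigr => i _.
by rewrite natrX -[LHS]real_normK ?num_real// -intr_norm pmulrn abszE.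
Qed.

Lemma normsq_eq0 z : (normsq z == 0) = (z == origin).
Proof.
rewrite psumr_eq0; last by move=> i _; exact: sqr_ge0.
apply/allP/eqP => [h|-> i _]; last by rewrite ffunE mulr0z expr0n eqxx.
apply/ffunP => i; rewrite ffunE; have := h i (mem_index_enum _).
by rewrite sqrf_eq0 intr_eq0 => /eqP.
Qed.

Lemma normsq_ge1 z : z != origin -> 1 <= normsq z.
Proof.
rewrite -normsq_eq0; have [u ->] := normsq_int z.
by rewrite pnatr_eq0 ler1n lt0n.
Qed.

Lemma sqr_le_normsq z i : (z i)%:~R ^+ 2 <= normsq z.
Proof. by rewrite /normsq (bigD1 i)//= lerDl sumr_ge0// => j _; exact: sqr_ge0. Qed.

(* [(1 - 2 x) / S] and [(1 + 2 x) / S] are the relative increments of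
   [c + normsq] along the two steps in a direction. *)
Lemma avg_radial (b c c2 c3 c4 lo hi : R) z : (0 < d)%N -> 0 < b -> 0 < c ->
  (forall w, lo <= w <= hi -> (1 + w) `^ (- b) <= quartic b c2 c3 c4 w) ->
  (forall i, lo <= (1 - 2 * (z i)%:~R) / (c + normsq z) <= hi) ->
  (forall i, lo <= (1 + 2 * (z i)%:~R) / (c + normsq z) <= hi) ->
  -1 <= lo ->
  avg (fun z => (c + normsq z) `^ (- b)) z <= (c + normsq z) `^ (- b) *
  (1 - b / (c + normsq z) + c2 * (1 + 4 * normsq z / d%:R) / (c + normsq z) ^+ 2
    - c3 * (1 + 12 * normsq z / d%:R) / (c + normsq z) ^+ 3
    + c4 * (1 + 24 * normsq z / d%:R + 16 * (\sum_i (z i)%:~R ^+ 4) / d%:R)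
      / (c + normsq z) ^+ 4).
Proof.
move=> d0 b0 c0 pw wm wp lo1; set S := c + normsq z.
have S0 : 0 < S by rewrite ltr_wpDr ?normsq_ge0.
have dn0 : d%:R != 0 :> R by rewrite pnatr_eq0 -lt0n.
have step i (s : int) : s ^+ 2 = 1 -> lo <= (1 + 2 * s%:~R * (z i)%:~R) / S <= hi ->
   (c + normsq (zshift z i s)) `^ (- b) <=
   S `^ (- b) * quartic b c2 c3 c4 ((1 + 2 * s%:~R * (z i)%:~R) / S).
  move=> s1 wI; rewrite normsq_zshift -rmorphXn/= s1.
  have -> : c + (normsq z + 2 * s%:~R * (z i)%:~R + 1%:~R) =
      S * (1 + (1 + 2 * s%:~R * (z i)%:~R) / S).
    by rewrite /S; field; rewrite gt_eqF.
  have w0 : 0 <= 1 + (1 + 2 * s%:~R * (z i)%:~R) / S.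
    by case/andP: wI => h _; rewrite -lerBlDl sub0r (le_trans lo1 h).
  rewrite (powRM _ (ltW S0) w0).
  by rewrite ler_wpM2l ?powR_ge0// pw.
apply: (@le_trans _ _ ((d.*2)%:R^-1 * \sum_(i < d) S `^ (- b) *
    (quartic b c2 c3 c4 ((1 - 2 * (z i)%:~R) / S) +
     quartic b c2 c3 c4 ((1 + 2 * (z i)%:~R) / S)))).
  rewrite /avg ler_wpM2l// ler_sum// => i _; rewrite mulrDr lerD//.
    have := step i (-1) _ _; rewrite mulrN1 mulNr; apply => //.
  by have := step i 1 _ _; rewrite mulr1; apply.
rewrite -mulr_sumr mulrCA ler_wpM2l ?powR_ge0//.
(* Odd powers of the coordinates cancel between the two opposite steps. *)
rewrite (eq_bigr (fun i => 2 * (1 - b / S + c2 / S ^+ 2 - c3 / S ^+ 3 + c4 / S ^+ 4) +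
   (z i)%:~R ^+ 2 * (8 * c2 / S ^+ 2 - 24 * c3 / S ^+ 3 + 48 * c4 / S ^+ 4) +
   (z i)%:~R ^+ 4 * (32 * c4 / S ^+ 4))); last first.
  by move=> i _; rewrite /quartic; field; rewrite gt_eqF.
rewrite !big_split/= -!mulr_suml sumr_const card_ord -/(normsq z).
rewrite -muln2 natrM -mulr_natl.
rewrite le_eqVlt; apply/orP; left; apply/eqP.
set q := \sum_i _ ^+ 4; set u := normsq z.
by field; rewrite dn0 gt_eqF.
Qed.

End Superharmonic.

(** * Decay and off-diagonal bounds for the lattice Green function *)

Section GreenDecay.
Variables (R : realType) (d : nat).
Hypothesis d3 : (3 <= d)%N.
Implicit Types (z : zpt d).

Lemma dim_ge3 : 3 <= d%:R :> R.
Proof. by rewrite ler_nat. Qed.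

Lemma dim_gt0 : (0 < d)%N.
Proof. by apply: leq_trans d3. Qed.

Lemma green_sum_decay (b : R) : 0 < b -> b < (d%:R - 2) / 2 ->
  exists2 A : R, 0 < A & forall K z, green_sum R K z <= A * (1 + normsq R z) `^ (- b).
Proof.
move=> b0 bd; have dR3 := dim_ge3.
pose c2 := (b * (b + 1) / 2 + b * d%:R / 4) / 2.
(* [c2] is the midpoint between [b * (b + 1) / 2], the Taylor coefficient it must exceed for the
   quartic bound, and [b * d / 4], below which the drift [- gam] is negative. This interval is
   nonempty exactly when [b < (d - 2) / 2]. *)
have c20 : 0 < c2 by rewrite /c2; nra.
have eta0 : 0 < 2 * c2 - b - b ^+ 2 by rewrite /c2; nra.
pose gam := b - 4 * c2 / d%:R.
have gam0 : 0 < gam.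
  rewrite /gam subr_gt0 ltr_pdivrMr; last by lra.
  by rewrite /c2; nra.
pose w0 := Num.min (1 / 2) ((2 * c2 - b - b ^+ 2) / ((2 + b) * c2)).
have w0p : 0 < w0.
  by rewrite /w0 lt_min; apply/andP; split; [lra|rewrite divr_gt0// mulr_gt0//; lra].
have w0h : w0 <= 1 / 2 by rewrite /w0 ge_min lexx.
have w0e : w0 * ((2 + b) * c2) <= 2 * c2 - b - b ^+ 2.
  rewrite -ler_pdivlMr; last by rewrite mulr_gt0//; lra.
  by rewrite /w0 ge_min lexx orbT.
(* The second summand brings the relative increments into [[- w0, w0]], where the quartic bound
   holds; the third lets half of [gam] absorb the lower-order term [c2 / c]. *)
pose c := 1 + (1 + w0^-1) / w0 + 2 * c2 / gam.
have iw0 : 0 < w0^-1 by rewrite invr_gt0.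
have c1 : 1 <= c.
  rewrite /c -addrA lerDl addr_ge0// ltW// divr_gt0//; first by rewrite addr_gt0.
  by rewrite mulr_gt0.
have cw : 1 + w0^-1 <= w0 * c.
  rewrite /c !mulrDr mulr1 (mulrC w0 (_ / w0)) divfK ?gt_eqF//.
  have : 0 <= w0 * (2 * c2 / gam) by rewrite ltW// mulr_gt0// divr_gt0// mulr_gt0.
  by lra.
have cg : c2 / c <= gam / 2.
  rewrite ler_pdivrMr; last by lra.
  have : gam * (2 * c2 / gam) = 2 * c2 by field; rewrite gt_eqF.
  have : 0 <= gam * ((1 + w0^-1) / w0) by rewrite ltW// mulr_gt0// divr_gt0// addr_gt0.
  by rewrite /c; lra.
pose h z := (c + normsq R z) `^ (- b).
have pw w : - w0 <= w <= w0 -> (1 + w) `^ (- b) <= quartic b c2 0 0 w.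
  apply: powR_quartic => //; try lra.
  move=> v /andP[v1 v2].
  rewrite (_ : _ + _ = 2 * c2 - b - b ^+ 2 + v * ((2 + b) * c2)); last by ring.
  have : - w0 * ((2 + b) * c2) <= v * ((2 + b) * c2).
    by rewrite ler_wpM2r// mulr_ge0//; lra.
  by lra.
have hs z : avg h z <= h z * (1 - gam / 2 / (c + normsq R z)).
  have u0 := normsq_ge0 R z; set u := normsq R z in u0 *.
  have S0 : 0 < c + u by lra.
  have wI i (s : R) : s ^+ 2 = 1 -> - w0 <= (1 + 2 * s * (z i)%:~R) / (c + u) <= w0.
    move=> s1; have xu := sqr_le_normsq R z i; rewrite -/u in xu.
    set x := (z i)%:~R in xu *.
    rewrite ler_pdivlMr// ler_pdivrMr//.
    have h1 : 0 <= w0 * (w0^-1 - s * x) ^+ 2 by rewrite mulr_ge0 ?sqr_ge0// ltW.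
    have h2 : 0 <= w0 * (w0^-1 + s * x) ^+ 2 by rewrite mulr_ge0 ?sqr_ge0// ltW.
    have e1 : w0 * (w0^-1 - s * x) ^+ 2 = w0^-1 - 2 * s * x + w0 * x ^+ 2 * s ^+ 2.
      by field; rewrite gt_eqF.
    have e2 : w0 * (w0^-1 + s * x) ^+ 2 = w0^-1 + 2 * s * x + w0 * x ^+ 2 * s ^+ 2.
      by field; rewrite gt_eqF.
    rewrite s1 mulr1 in e1 e2; rewrite e1 in h1; rewrite e2 in h2.
    have h3 : w0 * x ^+ 2 <= w0 * u by rewrite ler_wpM2l// ltW.
    by apply/andP; split; lra.
  have := @avg_radial R d b c c2 0 0 (- w0) w0 z dim_gt0 b0 _ pw; rewrite -/u -/(h z) => H.
  apply: le_trans (H _ _ _ _) _.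
  - by lra.
  - move=> i; have := wI i (-1); rewrite sqrrN expr1n mulrN1 => /(_ erefl).
    by rewrite mulNr.
  - by move=> i; have := wI i 1; rewrite expr1n mulr1 => /(_ erefl).
  - by lra.
  rewrite ler_wpM2l ?powR_ge0// !mul0r subr0 addr0 -addrA lerD2l.
  have q1 : c2 * (1 + 4 * u / d%:R) / (c + u) ^+ 2 <=
      (c2 / c + 4 * c2 / d%:R) / (c + u).
    rewrite ler_pdivrMr ?exprn_gt0// expr2 mulrA divfK ?gt_eqF//.
    have e : (c2 / c + 4 * c2 / d%:R) * (c + u) =
      c2 * (1 + 4 * u / d%:R) + (c2 / c * u + 4 * c2 / d%:R * c).
      by field; apply/andP; split; rewrite gt_eqF//; lra.
    rewrite e lerDl addr_ge0// mulr_ge0//; try lra.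
      by rewrite divr_ge0//; lra.
    by rewrite divr_ge0//; lra.
  apply: (@le_trans _ _ (- (b / (c + u)) + (c2 / c + 4 * c2 / d%:R) / (c + u))).
    by rewrite lerD2l.
  rewrite -mulNr -mulrDl -mulNr ler_wpM2r ?invr_ge0 ?(ltW S0)//.
  by move: cg; rewrite /gam; lra.
(* With this factor the defect of superharmonicity at the origin is at least 1, which pays for the
   unit source there. *)
pose A := (h (origin d) * (gam / 2 / c))^-1.
have n0 : normsq R (origin d) = 0 by apply/eqP; rewrite normsq_eq0.
have h0 z : 0 < h z by rewrite powR_gt0//; have := normsq_ge0 R z; lra.
have A0 : 0 < A by rewrite /A invr_gt0 mulr_gt0// !divr_gt0//; lra.
exists A => // K z.
apply: (@le_trans _ _ (A * h z)).
  apply: (@green_sum_super R d (fun z => A * h z)).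
    by move=> y; rewrite mulr_ge0// ltW.
  move=> y; rewrite avgZ.
  have := hs y; rewrite -(ler_pM2l A0) => /(lerD (lexx (y == origin d)%:R)).
  move/le_trans; apply; rewrite mulrBr mulr1 mulrBr addrCA gerDl.
  rewrite subr_le0; have [->|_] := eqVneq y (origin d).
    by rewrite n0 addr0 /A mulVf ?gt_eqF// mulr_gt0// !divr_gt0//; lra.
  rewrite mulr_ge0 ?(ltW A0)// mulr_ge0 ?(ltW (h0 _))// divr_ge0//; first by lra.
  by have := normsq_ge0 R y; lra.
rewrite ler_wpM2l ?(ltW A0)// /h !powRN lef_pV2 ?posrE ?powR_gt0//.
- by apply: ge0_ler_powR; rewrite ?nnegrE; have := normsq_ge0 R z; lra.
- by have := normsq_ge0 R z; lra.
- by have := normsq_ge0 R z; lra.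
Qed.

(* Lattice points satisfy [4 * `|x| <= x ^+ 2 + 4], which keeps the relative
   increments of [2 + normsq] inside [[-1/2, 1]]. *)
Lemma avg_quarter z : z != origin d ->
  avg (fun z => (2 + normsq R z) `^ (- (1 / 4))) z <= (2 + normsq R z) `^ (- (1 / 4)).
Proof.
move=> z0; have dp : 0 < d%:R :> R by have := dim_ge3; lra.
have u1 := normsq_ge1 R z0; set u := normsq R z in u1 *.
have S0 : 0 < 2 + u by lra.
(* The Taylor coefficients are 5/32, 15/128 and 195/2048. The increments are not small near the
   origin, and these larger coefficients give a bound valid on the whole interval. *)
have pw (w : R) : - (1 / 2) <= w <= 1 ->
    (1 + w) `^ (- (1 / 4)) <= quartic (1 / 4) (1 / 6) (3 / 20) (4 / 25) w.
  apply: powR_quartic; try lra.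
  move=> v /andP[v1 v2].
  have [v0|v0] := leP 0 v; first by nra.
  have : 0 <= (v + 1 / 2) * v ^+ 2 by rewrite mulr_ge0 ?sqr_ge0//; lra.
  nra.
have wI i (s : R) : s ^+ 2 = 1 -> - (1 / 2) <= (1 + 2 * s * (z i)%:~R) / (2 + u) <= 1.
  move=> s1; have xu := sqr_le_normsq R z i; rewrite -/u in xu.
  set x := (z i)%:~R in xu *.
  have h1 : 0 <= (s * x - 1) ^+ 2 := sqr_ge0 _.
  have h2 : 0 <= (s * x + 2) ^+ 2 := sqr_ge0 _.
  have e1 : (s * x - 1) ^+ 2 = s ^+ 2 * x ^+ 2 - 2 * s * x + 1 by ring.
  have e2 : (s * x + 2) ^+ 2 = s ^+ 2 * x ^+ 2 + 4 * s * x + 4 by ring.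
  rewrite s1 mul1r in e1 e2; rewrite e1 in h1; rewrite e2 in h2.
  rewrite ler_pdivlMr// ler_pdivrMr//.
  by apply/andP; split; lra.
have := @avg_radial R d (1 / 4) 2 (1 / 6) (3 / 20) (4 / 25) (- (1 / 2)) 1 z dim_gt0 _ _ pw.
rewrite -/u => H; apply: le_trans (H _ _ _ _ _) _; try lra.
- move=> i; have := wI i (-1); rewrite sqrrN expr1n mulrN1 => /(_ erefl).
  by rewrite mulNr.
- by move=> i; have := wI i 1; rewrite expr1n mulr1 => /(_ erefl).
rewrite -[leRHS]mulr1 ler_wpM2l ?powR_ge0//.
set q := \sum_i _.
have qu : q <= u ^+ 2.
  rewrite /q /u /normsq expr2 mulr_suml; apply: ler_sum => i _.
  rewrite (_ : _ ^+ 4 = (z i)%:~R ^+ 2 * (z i)%:~R ^+ 2); last by ring.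
  by rewrite ler_wpM2l ?sqr_ge0// sqr_le_normsq.
have q0 : 0 <= q by apply: sumr_ge0 => i _; rewrite exprn_even_ge0.
set S := 2 + u in S0 *.
pose k : R := d%:R^-1.
have k0 : 0 < k by rewrite invr_gt0.
have k3 : k <= 1 / 3 by rewrite /k div1r lef_pV2 ?posrE//; exact: dim_ge3.
rewrite -/k.
rewrite (_ : _ + _ = 1 + (- (1 / 4 * S ^+ 3) + 1 / 6 * (1 + 4 * u * k) * S ^+ 2
   - 3 / 20 * (1 + 12 * u * k) * S + 4 / 25 * (1 + 24 * u * k + 16 * q * k)) / S ^+ 4); last first.
  by field; rewrite gt_eqF.
rewrite gerDl pmulr_lle0 ?invr_gt0 ?exprn_gt0//.
have h1 : q * k <= u ^+ 2 * k by rewrite ler_wpM2r// ltW.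
apply: (@le_trans _ _ (- (1 / 4 * S ^+ 3) + 1 / 6 * (1 + 4 * u * k) * S ^+ 2
   - 3 / 20 * (1 + 12 * u * k) * S + 4 / 25 * (1 + 24 * u * k + 16 * u ^+ 2 * k))).
  by lra.
(* The bound is affine in [k] with this nonnegative slope, so dimension 3 is the worst case and
   leaves a polynomial inequality in [u >= 1]. *)
have uB : 0 <= u * (4 / 6 * S ^+ 2 - 36 / 20 * S + 4 / 25 * (24 + 16 * u)).
  by rewrite mulr_ge0 /S//; nra.
have h2 := ler_wpM2r uB k3.
have h3 : - (1 / 4 * S ^+ 3) + 1 / 6 * S ^+ 2 - 3 / 20 * S + 4 / 25 +
  1 / 3 * (u * (4 / 6 * S ^+ 2 - 36 / 20 * S + 4 / 25 * (24 + 16 * u))) <= 0.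
  rewrite /S; have : 0 <= (u - 1) * u ^+ 2 by rewrite mulr_ge0 ?sqr_ge0//; lra.
  nra.
by lra.
Qed.

Lemma quarter_ge (y S : R) : 0 < S -> 0 <= y -> y ^+ 4 * S <= 1 -> y <= S `^ (- (1 / 4)).
Proof.
move=> S0 y0 yS; rewrite -(ler_pXn2r (ltn0Sn 3)) ?nnegrE ?powR_ge0//.
rewrite -[leRHS]powR_mulrn ?powR_ge0// -powRrM mulNr mul1r mulVf// (powR_inv1 (ltW S0)).
by rewrite -[leRHS]mul1r ler_pdivlMr.
Qed.

Lemma quarter_le (y S : R) : 0 < S -> 0 <= y -> 1 <= y ^+ 4 * S -> S `^ (- (1 / 4)) <= y.
Proof.
move=> S0 y0 yS; rewrite -(ler_pXn2r (ltn0Sn 3)) ?nnegrE ?powR_ge0//.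
rewrite -[leLHS]powR_mulrn ?powR_ge0// -powRrM mulNr mul1r mulVf// (powR_inv1 (ltW S0)).
by rewrite -[leLHS]mul1r ler_pdivrMr.
Qed.

(** 3, 4 and 6 are the values of [2 + normsq] at a neighbour of the origin and at the sites one
    sideways or one outward step further. The right-hand side is the value [h0] of
    [green_sum_return]. *)
Lemma quarter_gap :
  (2 * (d%:R - 1) / d%:R) * 3 `^ (- (1 / 4)) <=
  2 * d%:R * 3 `^ (- (1 / 4)) - 6 `^ (- (1 / 4)) - (2 * d%:R - 2) * 4 `^ (- (1 / 4)) :> R.
Proof.
have dR3 := dim_ge3.
have h1 : 759 / 1000 <= 3 `^ (- (1 / 4)) :> R by apply: quarter_ge; lra.
have h2 : 4 `^ (- (1 / 4)) <= 442 / 625 :> R by apply: quarter_le; lra.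
have h4 : 6 `^ (- (1 / 4)) <= 639 / 1000 :> R by apply: quarter_le; lra.
move: h1 h2 h4; set a := 3 `^ _; set b := 4 `^ _; set e := 6 `^ _ => h1 h2 h4.
rewrite -subr_ge0; set D : R := d%:R.
have D0 : 0 < D by rewrite /D; lra.
rewrite (_ : _ - _ = (D * ((2 * D - 2) * (a - b)) + 2 * a - D * e) / D); last first.
  by field; rewrite gt_eqF.
rewrite divr_ge0 ?ltW//.
have D1 : 0 <= D * (2 * D - 2) by rewrite mulr_ge0 /D//; lra.
have : 0 <= D * (2 * D - 2) * (a - 759 / 1000) by rewrite mulr_ge0 ?subr_ge0.
have : 0 <= D * (2 * D - 2) * (442 / 625 - b) by rewrite mulr_ge0 ?subr_ge0.
have : D * e <= D * (639 / 1000) by rewrite ler_wpM2l// ltW.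
(* The numerical bounds leave a positive quadratic in [D], with minimum near 18 / 5. *)
have := sqr_ge0 (D - 18 / 5).
lra.
Qed.

(** Bounds the probability of reaching the origin from another site. Its value is such that
    [1 + return_ratio < 2 * alpha] is the lower bound assumed on [alpha]. *)
Definition return_ratio : R := d%:R / (2 * (d%:R - 1)).

(* The comparison function is [(2 + normsq z) `^ (- (1 / 4))] away from the
   origin; its value [h0] at the origin is the largest one for which it remains
   superharmonic at the neighbours of the origin. *)
Lemma green_sum_return K z : z != origin d ->
  green_sum R K z <= return_ratio * green_sum R K (origin d).
Proof.
move=> z0; have dR3 := dim_ge3.
pose f (u : R) := (2 + u) `^ (- (1 / 4)).
pose h0 := 2 * d%:R * f 1 - f 4 - (2 * d%:R - 2) * f 2.
have gap : (2 * (d%:R - 1) / d%:R) * f 1 <= h0.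
  have e1 : 2 + 1 = 3 :> R by ring.
  have e2 : 2 + 2 = 4 :> R by ring.
  have e4 : 2 + 4 = 6 :> R by ring.
  by have := quarter_gap; rewrite /h0 /f e1 e2 e4.
have f0 u : 0 <= f u by exact: powR_ge0.
have f1 : 0 < f 1 by rewrite powR_gt0//; lra.
have h00 : 0 < h0.
  apply: lt_le_trans gap; rewrite mulr_gt0// divr_gt0//; lra.
pose H y := if y == origin d then h0 else f (normsq R y).
have H0 y : 0 <= H y by rewrite /H; case: ifP => _ //; exact: ltW.
have Hle y : y != origin d -> H y <= f 1.
  move=> y0; rewrite /H (negbTE y0) /f !powRN lef_pV2 ?posrE ?powR_gt0//.
  - by apply: ge0_ler_powR; rewrite ?nnegrE; have := normsq_ge1 R y0; lra.
  - by have := normsq_ge1 R y0; lra.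
have Hsup y : y != origin d -> avg H y <= H y.
  move=> y0; have [far|] := boolP [forall i, forall s : bool,
      zshift y i (if s then 1 else -1) != origin d].
    rewrite {2}/H (negbTE y0); apply: le_trans (avg_quarter y0).
    rewrite le_eqVlt; apply/orP; left; apply/eqP; rewrite /avg.
    congr (_ * _); apply: eq_bigr => i _; move/forallP: far => /(_ i)/forallP h.
    by rewrite /H (negbTE (h true)) (negbTE (h false)).
  rewrite negb_forall => /existsP[j]; rewrite negb_forall => /existsP[s].
  rewrite negbK => /eqP yj.
  pose e : int := if s then 1 else -1.
  have e2 : e ^+ 2 = 1 by rewrite /e; case: (s).
  have yE k : y k = if k == j then - e else 0.
    have := congr1 (fun g : zpt d => g k) yj; rewrite !ffunE -/e.
    by case: eqP => [_ /eqP|_]; [rewrite addr_eq0 => /eqP|rewrite addr0].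
  have ny : normsq R y = 1.
    rewrite /normsq (bigD1 j)//= yE eqxx big1 => [|k /negbTE kj].
      by rewrite addr0 -rmorphXn/= sqrrN e2.
    by rewrite yE kj mulr0z expr0n.
  have n0 : normsq R (origin d) = 0 by apply/eqP; rewrite normsq_eq0.
  have Hn x (u : R) : normsq R x = u -> 0 < u -> H x = f u.
    move=> <- u0; rewrite /H; case: eqP => // xo; move: u0.
    by rewrite xo n0 ltxx.
  (* Of the [2 * d] neighbours of a unit vector, one is the origin, one has squared norm 4, and all
     the others have squared norm 2. *)
  have avgH : avg H y = (d.*2)%:R^-1 * (h0 + f 4 + (d%:R - 1) * (f 2 + f 2)).
    rewrite /avg; congr (_ * _); rewrite (bigD1 j)//=; congr (_ + _).
      have no (s' : int) : s' = - e -> H (zshift y j s') = f 4.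
        move=> s'e; apply: Hn; last by lra.
        rewrite normsq_zshift ny yE eqxx s'e -rmorphXn/= sqrrN e2 -mulrA -rmorphM/=.
        by rewrite mulrNN -expr2 e2; ring.
      have o : H (zshift y j e) = h0 by rewrite /e yj /H eqxx.
      move: o no; rewrite /e; case: (s) => o no.
        by rewrite o (no (-1))// addrC.
      by rewrite o (no 1)// opprK.
    rewrite (eq_bigr (fun=> f 2 + f 2)) => [|i ij].
      rewrite sumr_const cardC1 card_ord -[LHS]mulr_natl; congr (_ * _).
      by rewrite -subn1 (natrB _ dim_gt0).
    by congr (_ + _); apply: Hn; (try lra); rewrite normsq_zshift ny yE (negbTE ij);
      rewrite mulr0z mulr0 addr0 -rmorphXn/= ?sqrrN expr1n.
  rewrite avgH /h0 (Hn _ _ ny)// -muln2 natrM.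
  rewrite le_eqVlt; apply/orP; left; apply/eqP; field.
  by rewrite gt_eqF//; lra.
have := @green_sum_ratio R d H H0 Hsup K z.
have Ho : H (origin d) = h0 by rewrite /H eqxx.
rewrite Ho => r; have g0 := green_sum_ge0 R K (origin d).
rewrite -(ler_pM2r h00); apply: le_trans r _.
rewrite mulrAC ler_wpM2r//; apply: le_trans (Hle _ z0) _.
have rp : 0 < return_ratio by rewrite /return_ratio divr_gt0//; lra.
have : return_ratio * ((2 * (d%:R - 1) / d%:R) * f 1) <= return_ratio * h0.
  by rewrite ler_wpM2l// ltW.
apply: le_trans; rewrite le_eqVlt; apply/orP; left; apply/eqP.
by rewrite /return_ratio; field; apply/andP; split; rewrite gt_eqF//; lra.
Qed.

End GreenDecay.

(** * The Green function of the box *)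

Section NonnegSeries.
Variable R : realType.
Variables (u : nat -> R) (M : R).
Hypothesis u0 : forall k, 0 <= u k.
Hypothesis uM : forall K, \sum_(0 <= k < K) u k <= M.
Let s K := \sum_(0 <= k < K) u k.
Let S := fine (\sum_(0 <= k <oo) (u k)%:E)%E.

Lemma nonneg_series_cvg : s K @[K --> \oo] --> S.
Proof.
have cs : cvgn s.
  apply: nondecreasing_is_cvgn.
    apply/nondecreasing_seqP => n; rewrite /s big_nat_recr//= lerDl.
    exact: u0.
  by exists M => _ [n _ <-]; exact: uM.
rewrite /S (_ : (\sum_(0 <= k <oo) (u k)%:E)%E = (limn s)%:E)//=.
rewrite -EFin_lim//; congr (limn _); apply/funext => n /=.
by rewrite sumEFin.
Qed.

Lemma nonneg_series_ge K : s K <= S.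
Proof.
apply: (cvgr_to_ge nonneg_series_cvg); exists K => // n /= Kn.
rewrite /s (big_cat_nat _ Kn)//= lerDl; apply: sumr_ge0 => i _; exact: u0.
Qed.

End NonnegSeries.

Section KilledWalk.
Variables (R : realType) (d n : nat).
Implicit Types (x y z : bpt d n).

Definition zdiff x y : zpt d := [ffun i => (x i)%:Z - (y i)%:Z].

Definition stepw x z : R := if adjb x z then (d.*2)%:R^-1 else 0.
Definition intr x : R := if Defs.interior x then 1 else 0.

Lemma stepw_ge0 x z : 0 <= stepw x z.
Proof. by rewrite /stepw; case: ifP => _ //; rewrite invr_ge0. Qed.

Lemma intr_ge0 x : 0 <= intr x.
Proof. by rewrite /intr; case: ifP. Qed.

Lemma intr_le1 x : intr x <= 1.
Proof. by rewrite /intr; case: ifP. Qed.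

Lemma adjbC x z : adjb x z = adjb z x.
Proof.
rewrite /adjb; congr (_ == _); apply: eq_bigr => i _.
by rewrite -abszN opprB.
Qed.

Lemma stepwC x z : stepw x z = stepw z x.
Proof. by rewrite /stepw adjbC. Qed.

Lemma killed_qS k x y :
  killed_q R k.+1 x y = intr x * \sum_z stepw x z * killed_q R k z y.
Proof. by []. Qed.

Lemma killed_q0 x y : killed_q R 0 x y = (x == y)%:R * intr x.
Proof. by rewrite /= /intr; case: eqP; case: Defs.interior; rewrite /= ?mulr1 ?mulr0 ?mul0r. Qed.

Lemma killed_q_ge0 k x y : 0 <= killed_q R k x y.
Proof.
elim: k x y => [|k IH] x y; first by rewrite killed_q0 mulr_ge0 ?intr_ge0.
rewrite killed_qS mulr_ge0 ?intr_ge0// sumr_ge0// => z _.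
by rewrite mulr_ge0 ?stepw_ge0.
Qed.

Lemma killed_q_last k x y :
  killed_q R k.+1 x y = \sum_z killed_q R k x z * stepw z y * intr y.
Proof.
elim: k x y => [|k IH] x y.
  rewrite killed_qS (bigD1 y)// big1; last first.
    by move=> z /andP[_ zy]; rewrite killed_q0 (negbTE zy) mul0r mulr0.
  rewrite [RHS](bigD1 x)// [X in _ = _ + X]big1; last first.
    by move=> z /andP[_ zx]; rewrite killed_q0 eq_sym (negbTE zx) !mul0r.
  by rewrite !killed_q0 !eqxx /=; ring.
rewrite killed_qS.
transitivity (intr x * \sum_z \sum_w stepw x z * (killed_q R k z w * stepw w y * intr y)).
  by congr (_ * _); apply: eq_bigr => z _; rewrite IH mulr_sumr.
rewrite exchange_big mulr_sumr; apply: eq_bigr => w _.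
rewrite killed_qS -!mulrA; congr (_ * _); rewrite mulr_suml.
by apply: eq_bigr => z _; rewrite !mulrA.
Qed.

Lemma killed_qC k x y : killed_q R k x y = killed_q R k y x.
Proof.
elim: k x y => [|k IH] x y.
  by rewrite !killed_q0 eq_sym; case: eqP => [->|]; rewrite ?mul0r.
rewrite killed_qS killed_q_last mulr_sumr; apply: eq_bigr => z _.
by rewrite (stepwC z) IH mulrC [stepw _ _ * _]mulrC.
Qed.

Lemma adjb_step x z : adjb x z ->
  exists i (s : bool), forall y, zdiff z y = zshift (zdiff x y) i (if s then 1 else -1).
Proof.
move=> xz; have [i xi] : exists i, (0 < `|(x i)%:Z - (z i)%:Z|)%N.
  apply/existsP; apply: contraLR xz => /existsPn h; rewrite /adjb big1// => i _.
  by have := h i; rewrite -leqNgt leqn0 => /eqP.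
move: xz; rewrite /adjb (bigD1 i)//= => xz.
have rest : (\sum_(j < d | j != i) `|(x j)%:Z - (z j)%:Z| = 0)%N.
  by move: xz xi; case: (`|_|%N) => // k; rewrite addSn eqSS addn_eq0 => /andP[_ /eqP].
have xi1 : `|(x i)%:Z - (z i)%:Z|%N = 1%N by move: xz; rewrite rest addn0 => /eqP.
have xj j : j != i -> (x j)%:Z = (z j)%:Z :> int.
  move=> ji; move/eqP: rest; rewrite sum_nat_eq0 => /forallP/(_ j)/implyP/(_ ji).
  by rewrite absz_eq0 subr_eq0 => /eqP.
have : ((z i)%:Z - (x i)%:Z == 1) || ((z i)%:Z - (x i)%:Z == -1).
  move: xi1; rewrite -abszN opprB.
  by case: ((z i)%:Z - (x i)%:Z) => [[|[|k]]|[|k]].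
move=> h; exists i, ((z i)%:Z - (x i)%:Z == 1) => y.
apply/ffunP => j; rewrite !ffunE; case: eqP => [->|/eqP ji]; last first.
  by rewrite addr0 xj.
move: h; case: eqP => [h _|_ /= /eqP h]; by rewrite -h; ring.
Qed.

Lemma zdiff_inj y : injective (zdiff ^~ y).
Proof.
move=> x z xz; apply/ffunP => i; have := congr1 (fun g : zpt d => g i) xz.
by rewrite !ffunE => /addIr/eqP; rewrite eqz_nat => /eqP/val_inj.
Qed.

(** Only an inequality, because [avg] also sees the neighbours outside the box. *)
Lemma step_avg (F : zpt d -> R) x y : (forall w, 0 <= F w) ->
  \sum_z stepw x z * F (zdiff z y) <= avg F (zdiff x y).
Proof.
move=> F0; rewrite /avg.
pose nb i (s : bool) := zshift (zdiff x y) i (if s then 1 else -1).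
have -> : \sum_(i < d) (F (zshift (zdiff x y) i (-1)) + F (zshift (zdiff x y) i 1)) =
   \sum_(p : 'I_d * bool) F (nb p.1 p.2).
  rewrite -(pair_bigA _ (fun i s => F (nb i s)))/=; apply: eq_bigr => i _.
  by rewrite big_bool addrC.
rewrite mulr_sumr.
apply: (@le_trans _ _ (\sum_z \sum_(p : 'I_d * bool | nb p.1 p.2 == zdiff z y)
    (d.*2)%:R^-1 * F (nb p.1 p.2))).
  apply: ler_sum => z _; rewrite /stepw; case: ifP => [xz|_]; last first.
    by rewrite mul0r sumr_ge0// => p _; rewrite mulr_ge0// invr_ge0.
  have [i [s zE]] := adjb_step xz.
  rewrite (bigD1 (i, s))/=; last by rewrite /nb zE.
  by rewrite /nb -zE lerDl sumr_ge0// => p _; rewrite mulr_ge0// invr_ge0.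
rewrite (exchange_big_dep xpredT)//=; apply: ler_sum => p _.
rewrite big_mkcond/=.
have [[z0 z0E]|nz] := pselect (exists z, nb p.1 p.2 = zdiff z y).
  rewrite (bigD1 z0)//= z0E eqxx big1 ?addr0 ?z0E// => z zz0.
  by case: eqP => // /zdiff_inj zE; rewrite zE eqxx in zz0.
rewrite big1 => [|z _]; first by rewrite mulr_ge0// invr_ge0.
by case: eqP => // zE; case: nz; exists z.
Qed.

Lemma step_mass x : \sum_z stepw x z <= 1.
Proof.
have := @step_avg (fun=> 1) x x (fun=> ler01).
under eq_bigr do rewrite mulr1.
move=> /le_trans; apply; rewrite /avg sumr_const card_ord.
have [->|d0] := posnP d; first by rewrite mulr0n mulr0.
rewrite -[_ *+ d]mulr_natr -muln2 natrM le_eqVlt; apply/orP; left; apply/eqP; field.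
by rewrite pnatr_eq0 -lt0n.
Qed.

Lemma killed_q_le_srw k x y : killed_q R k x y <= srw_p R k (zdiff x y).
Proof.
elim: k x y => [|k IH] x y.
  rewrite killed_q0 srw_p0; case: eqP => [->|_]; last by rewrite mul0r.
  rewrite (_ : zdiff y y = origin d) ?eqxx ?mul1r ?intr_le1//.
  by apply/ffunP => i; rewrite !ffunE subrr.
rewrite killed_qS; apply: (@le_trans _ _ (\sum_z stepw x z * killed_q R k z y)).
  rewrite -[leRHS]mul1r ler_wpM2r ?intr_le1// sumr_ge0// => z _.
  by rewrite mulr_ge0 ?stepw_ge0 ?killed_q_ge0.
apply: (@le_trans _ _ (\sum_z stepw x z * srw_p R k (zdiff z y))).
  by apply: ler_sum => z _; rewrite ler_wpM2l ?stepw_ge0.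
by apply: step_avg => w; exact: srw_p_ge0.
Qed.

End KilledWalk.

Section GreenBox.
Variables (R : realType) (d n : nat).
Hypothesis d3 : (3 <= d)%N.
Implicit Types (x y z : bpt d n).
Local Notation g := (@green_box R d n).
Local Notation G0 := (green0 R d).

Definition killed_sum K x y : R := \sum_(0 <= k < K) killed_q R k x y.

Lemma killed_sum_le_green K x y : killed_sum K x y <= green_sum R K (zdiff x y).
Proof. by apply: ler_sum => k _; exact: killed_q_le_srw. Qed.

(** This is transience: the exponent 1 / 4 is admissible because [(d - 2) / 2] is at least 1 / 2. *)
Lemma green_sum_bnd : exists M : R, forall K (z : zpt d), green_sum R K z <= M.
Proof.
have d3R := dim_ge3 R d3.
have [||A A0 H] := @green_sum_decay R d d3 (1 / 4); try lra.
exists A => K z; apply: le_trans (H K z) _.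
rewrite -[leRHS]mulr1 ler_wpM2l ?(ltW A0)// powRN.
have n0 := normsq_ge0 R z.
rewrite invf_le1 ?powR_gt0//; last by lra.
apply: (@le_trans _ _ (1 `^ (1 / 4))); first by rewrite powR1.
by apply: ge0_ler_powR; rewrite ?nnegrE; lra.
Qed.

Lemma green_sum_le_green0 K : green_sum R K (origin d) <= G0.
Proof.
have [M H] := green_sum_bnd.
exact: (@nonneg_series_ge R (fun k => srw_p R k (origin d)) M
  (fun k => srw_p_ge0 R k (origin d)) (fun K => H K (origin d))).
Qed.

Lemma green0_ge1 : 1 <= G0.
Proof.
apply: le_trans (green_sum_le_green0 1).
by rewrite /green_sum big_nat1 srw_p0 eqxx.
Qed.

Lemma killed_sum_cvg x y : killed_sum K x y @[K --> \oo] --> g x y.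
Proof.
have [M H] := green_sum_bnd.
apply: (@nonneg_series_cvg R (fun k => killed_q R k x y) M).
  by move=> k; exact: killed_q_ge0.
by move=> K; apply: le_trans (killed_sum_le_green K x y) (H _ _).
Qed.

Lemma killed_sum_le_box K x y : killed_sum K x y <= g x y.
Proof.
have [M H] := green_sum_bnd.
apply: (@nonneg_series_ge R (fun k => killed_q R k x y) M).
  by move=> k; exact: killed_q_ge0.
by move=> K'; apply: le_trans (killed_sum_le_green K' x y) (H _ _).
Qed.

Lemma green_box_le (L : R) x y : (forall K, green_sum R K (zdiff x y) <= L) -> g x y <= L.
Proof.
move=> H; apply: (cvgr_to_le (@killed_sum_cvg x y)); apply: nearW => K.
exact: le_trans (killed_sum_le_green K x y) (H K).
Qed.

Lemma green_box_ge0 x y : 0 <= g x y.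
Proof. by apply: le_trans (killed_sum_le_box 0 x y); rewrite /killed_sum big_nil. Qed.

Lemma green_box_diag_ge1 x : Defs.interior x -> 1 <= g x x.
Proof.
move=> xi; apply: le_trans (killed_sum_le_box 1 x x).
by rewrite /killed_sum big_nat1 killed_q0 eqxx /intr xi mulr1.
Qed.

Lemma zdiff_eq0 x y : (zdiff x y == origin d) = (x == y).
Proof.
apply/eqP/eqP => [xy|->].
  apply: (@zdiff_inj d n y); rewrite xy; apply/ffunP => i.
  by rewrite !ffunE subrr.
by apply/ffunP => i; rewrite !ffunE subrr.
Qed.

Lemma green_box_diag_le x : g x x <= G0.
Proof.
apply: green_box_le => K; rewrite (eqP (_ : zdiff x x == origin d)) ?zdiff_eq0//.
exact: green_sum_le_green0.
Qed.

Lemma return_ratio_ge0 : 0 <= return_ratio R d.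
Proof. by have := dim_ge3 R d3 => h; rewrite /return_ratio divr_ge0//; lra. Qed.

Lemma green_box_offdiag_le x y : x != y -> g x y <= return_ratio R d * G0.
Proof.
move=> xy; apply: green_box_le => K.
have z0 : zdiff x y != origin d by rewrite zdiff_eq0.
apply: le_trans (@green_sum_return R d d3 K _ z0) _.
by rewrite ler_wpM2l ?return_ratio_ge0// green_sum_le_green0.
Qed.

Lemma green_boxC x y : g x y = g y x.
Proof.
by rewrite /green_box; congr fine; apply: eq_eseriesr => k _; rewrite killed_qC.
Qed.

Lemma green_box_step x y :
  g x y = (x == y)%:R * intr R x + intr R x * \sum_z stepw R x z * g z y.
Proof.
have c1 : killed_sum K.+1 x y @[K --> \oo] --> g x y.
  by have := @killed_sum_cvg x y; rewrite -(cvg_shiftS (fun K => killed_sum K x y)).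
have E K : killed_sum K.+1 x y = (x == y)%:R * intr R x +
    intr R x * \sum_z stepw R x z * killed_sum K z y.
  rewrite /killed_sum big_nat_recl// killed_q0; congr (_ + _).
  under eq_bigr do rewrite killed_qS.
  rewrite -mulr_sumr exchange_big; congr (_ * _); apply: eq_bigr => z _.
  by rewrite -mulr_sumr.
rewrite -(cvg_lim _ c1)//; apply: cvg_lim => //.
under eq_cvg do rewrite E.
apply: cvgD; first exact: cvg_cst.
apply: cvgM; first exact: cvg_cst.
apply: cvg_big => [|z _]; first by move=> [a b]; exact: cvgD cvg_fst cvg_snd.
by apply: cvgM; [exact: cvg_cst|exact: killed_sum_cvg].
Qed.

Lemma green_box_boundary x y : ~~ Defs.interior x -> g x y = 0.
Proof. by move=> /negbTE xb; rewrite green_box_step /intr xb mul0r mulr0 addr0. Qed.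

(* Balayage: [c] plays the role of the harmonic measure of the complement of [s]
   seen from [x]. It is built by sweeping out the points of [s] one at a time. *)
Lemma balayage (s : seq (bpt d n)) x : exists c : bpt d n -> R,
  [/\ forall y, 0 <= c y, forall y, y \in s -> c y = 0, \sum_y c y <= 1 &
      forall z, z \notin s -> g x z = \sum_y c y * g y z].
Proof.
elim: s x => [|b s IH] x.
  exists (fun y => (y == x)%:R); split => //.
    by rewrite (bigD1 x)//= eqxx big1 ?addr0// => y /negbTE ->.
  move=> z _; rewrite (bigD1 x)//= eqxx mul1r big1 ?addr0// => y /negbTE ->.
  by rewrite mul0r.
have [bs|bs] := boolP (b \in s).
  have [c [c0 cs c1 cg]] := IH x; exists c; split => //.
    by move=> y; rewrite in_cons => /predU1P[->|]; exact: cs.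
  by move=> z; rewrite in_cons negb_or => /andP[_]; exact: cg.
(* [e] is the sweeping measure of the enlarged set seen from [b] itself. It is 0 when [b] is on the
   boundary, where the walk is killed. *)
have [e [e0 eb es e1 eg]] : exists e : bpt d n -> R,
    [/\ forall y, 0 <= e y, e b = 0, forall y, y \in s -> e y = 0, \sum_y e y <= 1 &
      forall z, z != b -> z \notin s -> g b z = \sum_y e y * g y z].
  have [bi|bi] := boolP (Defs.interior b); last first.
    exists (fun=> 0); split => //; first by rewrite big1.
    by move=> z _ _; rewrite green_box_boundary// big1// => y _; rewrite mul0r.
  have [cc ccP] := choice IH.
  (* [q] describes where the walk leaves [s] after one step from [b]. Its mass at [b] is a return,
     and dividing by [1 - q b] sums the geometric series of returns. *)
  pose q y := \sum_w stepw R b w * cc w y.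
  have q0 y : 0 <= q y.
    by apply: sumr_ge0 => w _; rewrite mulr_ge0 ?stepw_ge0//; have [] := ccP w.
  have qs y : y \in s -> q y = 0.
    by move=> ys; rewrite /q big1// => w _; have [_ -> //] := ccP w; rewrite mulr0.
  have q1 : \sum_y q y <= 1.
    rewrite exchange_big/=; apply: le_trans (step_mass R b).
    apply: ler_sum => w _; rewrite -mulr_sumr -[leRHS]mulr1.
    by rewrite ler_wpM2l ?stepw_ge0//; have [] := ccP w.
  have gb z : z \notin s -> g b z = (b == z)%:R + \sum_y q y * g y z.
    move=> zs; rewrite green_box_step /intr bi mulr1 mul1r; congr (_ + _).
    rewrite (eq_bigr (fun w => \sum_y stepw R b w * (cc w y * g y z))).
      rewrite exchange_big; apply: eq_bigr => y _; rewrite mulr_suml.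
      by apply: eq_bigr => w _; rewrite mulrA.
    by move=> w _; have [_ _ _ -> //] := ccP w; rewrite mulr_sumr.
  have gbb := gb b bs; rewrite eqxx (bigD1 b)//= in gbb.
  have rest0 : 0 <= \sum_(y | y != b) q y * g y b.
    by apply: sumr_ge0 => y _; rewrite mulr_ge0 ?green_box_ge0.
  have gbp : 0 < g b b by apply: lt_le_trans (green_box_diag_ge1 bi).
  (* By [gbb], the finite number [g b b] is at least [1 + q b * g b b]. *)
  have qb1 : q b < 1.
    rewrite -(ltr_pM2r gbp) mul1r.
    by rewrite {2}gbb; lra.
  have qb0 : 0 < 1 - q b by rewrite subr_gt0.
  exists (fun y => if y == b then 0 else q y / (1 - q b)); split.
  - by move=> y; case: ifP => // _; rewrite divr_ge0// ltW.
  - by rewrite eqxx.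
  - by move=> y ys; case: ifP => // _; rewrite qs// mul0r.
  - rewrite (bigD1 b)//= eqxx add0r.
    rewrite (eq_bigr (fun y => q y / (1 - q b))); last by move=> y /negbTE ->.
    rewrite -mulr_suml ler_pdivrMr// mul1r.
    by move: q1; rewrite (bigD1 b)//= => q1; lra.
  - move=> z zb zs; have := gb z zs; rewrite eq_sym (negbTE zb) add0r.
    rewrite (bigD1 b)//= => gbz.
    rewrite (bigD1 b)//= eqxx mul0r add0r.
    rewrite (eq_bigr (fun y => (1 - q b)^-1 * (q y * g y z))); last first.
      by move=> y /negbTE ->; ring.
    rewrite -mulr_sumr.
    have -> : \sum_(y | y != b) q y * g y z = (1 - q b) * g b z by lra.
    by rewrite mulKf// gt_eqF.
have [c [c0 cs c1 cg]] := IH x.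
(* The mass that [c] leaves on [b] is redistributed along [e]. *)
exists (fun y => if y == b then 0 else c y + c b * e y); split.
- by move=> y; case: ifP => // _; rewrite addr_ge0// mulr_ge0.
- move=> y; rewrite in_cons; case: eqP => //= _ ys.
  by rewrite cs// es// mulr0 addr0.
- rewrite (bigD1 b)//= eqxx add0r.
  rewrite (eq_bigr (fun y => c y + c b * e y)); last by move=> y /negbTE ->.
  rewrite big_split/= -mulr_sumr.
  move: c1 e1; rewrite (bigD1 b)//= [in X in _ -> X -> _](bigD1 b)//= eb add0r => c1 e1.
  by have := ler_wpM2l (c0 b) e1; rewrite mulr1; lra.
- move=> z; rewrite in_cons negb_or => /andP[zb zs].
  rewrite (cg z zs) (bigD1 b)//= (eg z zb zs) [RHS](bigD1 b)//= eqxx mul0r add0r.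
  rewrite [in X in _ * X](bigD1 b)//= eb mul0r add0r mulr_sumr -big_split/=.
  by apply: eq_bigr => y /negbTE ->; ring.
Qed.

End GreenBox.

(** * Decoupling a site from the sites outside a ball *)

Section Events.
Variables (R : realType) (dT : measure_display) (T : measurableType dT).
Variable P : probability T R.
Local Notation E f := (\int[P]_w f w).
Local Notation Pr b := (fine (P [set w | is_true (b w)])).
Implicit Types (b : T -> bool).

Definition event b := measurable_fun setT (fun w => (b w)%:R : R).

Lemma event_bmf b : event b -> bounded_mf (fun w => (b w)%:R : R).
Proof. by move=> mb; split => //; exists 1 => w; case: (b w); rewrite ?normr1 ?normr0. Qed.

Lemma measurable_event b : event b -> measurable [set w | b w].
Proof.
move=> mb; rewrite (_ : [set w | b w] = setT `&` (fun w => (b w)%:R : R) @^-1` [set 1]).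
  by apply: mb => //; exact: measurable_set1.
apply/seteqP; split => w /=; first by move=> ->.
by case: (b w) => // -[_ /eqP]; rewrite eq_sym oner_eq0.
Qed.

Lemma prob_event b : event b -> Pr b = E (fun w => (b w)%:R).
Proof.
move=> mb; rewrite /Rintegral.
rewrite (_ : (fun w => ((b w)%:R)%:E) = (fun w => (\1_[set w | b w] w)%:E)); last first.
  by apply/funext => w; rewrite indicE mem_setE.
by rewrite integral_indic ?setIT//; exact: measurable_event.
Qed.

Lemma mean_le_fun (f g : T -> R) : bounded_mf f -> bounded_mf g ->
  (forall w, f w <= g w) -> E f <= E g.
Proof.
by move=> bf bg fg; apply: le_Rintegral => //; exact: bounded_mf_integrable.
Qed.

Lemma bounded_mfD (f g : T -> R) : bounded_mf f -> bounded_mf g ->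
  bounded_mf (fun w => f w + g w).
Proof.
move=> bf bg; have := bounded_mf_lin 1 1 bf bg; congr bounded_mf.
by apply/funext => w; rewrite !mul1r.
Qed.

Lemma mean_add (f g : T -> R) : bounded_mf f -> bounded_mf g ->
  E f + E g = E (fun w => f w + g w).
Proof.
move=> bf bg; rewrite -[E f]mul1r -[E g]mul1r -mean_lin//.
by apply: eq_mean_fun => w; rewrite !mul1r.
Qed.

Lemma event_le (f : T -> R) t : measurable_fun setT f -> event (fun w => t <= f w).
Proof.
move=> mf; rewrite /event (_ : (fun w => _) = \1_[set w | t <= f w]); last first.
  by apply/funext => w; rewrite indicE mem_setE.
apply: measurable_indic; rewrite -[X in measurable X]setTI.
rewrite (_ : [set w | _] = f @^-1` `[t, +oo[%classic); first exact: mf.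
by apply/seteqP; split => w /=; rewrite in_itv/= andbT.
Qed.

Lemma prob_le b b' : event b -> event b' -> (forall w, b w -> b' w) -> Pr b <= Pr b'.
Proof.
move=> mb mb' bb'; rewrite !prob_event//; apply: mean_le_fun; try exact: event_bmf.
by move=> w; rewrite ler_nat; case: (b w) (bb' w) => //= /(_ isT) ->.
Qed.

End Events.

Section Decoupling.
Variables (R : realType) (dT : measure_display) (T : measurableType dT).
Variables (P : probability T R) (I : finType) (C : I -> I -> R).
Variable phi : I -> T -> R.
Hypothesis phi_field : is_centred_gaussian_field P C phi.
Hypothesis C_sym : forall x y, C x y = C y x.
Local Notation E f := (\int[P]_w f w).
Local Notation Pr b := (fine (P [set w | is_true (b w)])).

Variables (x : I) (c : I -> R) (J : {set I}) (G0 s2 eta t : R).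
Hypothesis c_ge0 : forall y, 0 <= c y.
Hypothesis c_le1 : \sum_y c y <= 1.
Hypothesis c_bal : forall y, c y != 0 -> C x y = \sum_z c z * C z y.
Hypothesis c_orth : forall y, y \in J -> C x y = \sum_z c z * C z y.
Hypothesis c_small : forall y, c y != 0 -> C x y <= s2.
Hypothesis C_bnd : 1 <= C x x <= G0.
Hypothesis s2_bnd : 0 < s2 <= 1 / 2.
Hypothesis eta_bnd : 0 < eta <= t.

Let xi_coef z : R := (z == x)%:R - c z.
Let xi := lin phi xi_coef.
Let psi := lin phi c.

Lemma xi_psi w : phi x w = xi w + psi w.
Proof.
rewrite /xi /psi -linD -lin_single; apply: eq_bigr => z _.
by rewrite /xi_coef subrK.
Qed.

(** [c_bal] holds wherever [c] charges and collapses one of the two sums. The variance of [psi] is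
    thus a subaverage of [C x y] over the support of [c]. *)
Lemma cov_psi : cov C c c = \sum_y c y * C x y.
Proof.
rewrite /cov exchange_big; apply: eq_bigr => y _.
have [->|cy] := eqVneq (c y) 0.
  by rewrite mul0r big1// => z _; rewrite mulr0 mul0r.
by rewrite c_bal// mulr_sumr; apply: eq_bigr => z _; ring.
Qed.

Lemma cov_psi_le : cov C c c <= s2.
Proof.
have [s20 _] := andP s2_bnd.
rewrite cov_psi; apply: (@le_trans _ _ (\sum_y c y * s2)).
  apply: ler_sum => y _; have [->|cy] := eqVneq (c y) 0; first by rewrite !mul0r.
  by rewrite ler_wpM2l// c_small.
by rewrite -mulr_suml -[leRHS]mul1r ler_wpM2r// ltW.
Qed.

(** Pythagoras: by [cov_psi], the variance of [psi] is also its covariance with [phi x]. *)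
Lemma cov_xi : cov C xi_coef xi_coef = C x x - cov C c c.
Proof.
have single b : cov C (fun z => (z == x)%:R) b = \sum_y b y * C x y.
  rewrite /cov (bigD1 x)//= eqxx [X in _ + X]big1 ?addr0; last first.
    by move=> z /negbTE ->; rewrite big1// => y _; rewrite !mul0r.
  by apply: eq_bigr => y _; rewrite mul1r.
have -> : cov C xi_coef xi_coef =
    cov C (fun z => (z == x)%:R + (-1) * c z) (fun z => (z == x)%:R + (-1) * c z).
  by rewrite /xi_coef; apply: eq_bigr => z _; apply: eq_bigr => y _; rewrite !mulN1r.
have sx : \sum_y (y == x)%:R * C x y = C x x.
  by rewrite (bigD1 x)//= eqxx mul1r big1 ?addr0// => y /negbTE ->; rewrite mul0r.
rewrite covDl !covDr// !(covZl, covZr)//.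
by rewrite (covC C_sym c (fun z => (z == x)%:R)) !single -cov_psi sx; ring.
Qed.

Lemma xi_orth y : y \in J -> \sum_z xi_coef z * C z y = 0.
Proof.
move=> yJ; rewrite /xi_coef.
rewrite (eq_bigr (fun z => (z == x)%:R * C z y - c z * C z y)); last first.
  by move=> z _; rewrite mulrBl.
rewrite sumrB (bigD1 x)//= eqxx mul1r big1 ?addr0; last first.
  by move=> z /negbTE ->; rewrite mul0r.
by rewrite c_orth// subrr.
Qed.

Let big w := eta <= psi w.
Let small w := eta <= lin phi (fun z => (-1) * c z) w.
Let pi0 := expR (- eta ^+ 2 / (s2 *+ 2)).

Lemma psi_tail : Pr big <= pi0 /\ Pr small <= pi0.
Proof.
have [s20 _] := andP s2_bnd; have [e0 _] := andP eta_bnd.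
have v0 := cov_ge0 phi_field C_sym c; split.
  apply: (gaussian_tail _ s20 e0 (lin_law phi_field c)).
  by rewrite v0 cov_psi_le.
apply: (gaussian_tail _ s20 e0 (lin_law phi_field (fun z => (-1) * c z))).
by rewrite !(covZl, covZr)// mulrA mulrNN !mul1r v0 cov_psi_le.
Qed.

Let Z w := t <= phi x w.
Let Zlo w := t - eta <= xi w.
Let Zhi w := t + eta <= xi w.

(** The variance of [xi] lies between [1 - s2 >= 1 / 2] and [G0], as [gaussian_interval]
    requires. *)
Lemma Zlo_Zhi : Pr Zlo - Pr Zhi <= 2 * eta * expR (- (t - eta) ^+ 2 / (G0 *+ 2)).
Proof.
have [e0 et] := andP eta_bnd; have [s20 s2h] := andP s2_bnd; have [C1 CG] := andP C_bnd.
have mxi := measurable_lin phi_field xi_coef.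
have elo : event R (fun w => t - eta <= xi w) := @event_le R dT T _ _ mxi.
have ehi : event R (fun w => t + eta <= xi w) := @event_le R dT T _ _ mxi.
have mid : Pr Zlo - Pr Zhi <= fine (P [set w | t - eta <= xi w <= t + eta]).
  have em : event R (fun w => t - eta <= xi w <= t + eta).
    rewrite /event (_ : (fun w => _) = (fun w => ((t - eta <= xi w)%R)%:R *
        (((- t - eta) <= lin phi (fun z => (-1) * xi_coef z) w)%R)%:R)).
      apply: measurable_funM; first exact: elo.
      exact: (@event_le R dT T _ _ (measurable_lin phi_field _)).
    apply/funext => w; rewrite linZ -natrM mulnb; congr (_ && _)%:R.
    by rewrite mulN1r -opprD lerN2.
  rewrite !prob_event// lerBlDr -[X in _ <= X + _]mul1r -[X in _ <= _ + X]mul1r.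
  rewrite -mean_lin; try exact: event_bmf.
  apply: mean_le_fun; try exact: event_bmf.
    by apply: bounded_mf_lin; exact: event_bmf.
  move=> w; rewrite !mul1r /Zlo /Zhi.
  have [_|_] := leP (t - eta) (xi w); last by rewrite /= add0r.
  have [h|h] := leP (xi w) (t + eta); first by rewrite /= lerDl.
  by rewrite (ltW h) /= add0r.
apply: le_trans mid _.
have -> : 2 * eta = (t + eta) - (t - eta) by ring.
apply: (gaussian_interval _ _ _ (lin_law phi_field xi_coef)); try lra.
have := cov_ge0 phi_field C_sym c; have := cov_psi_le; rewrite cov_xi => h1 h2.
by apply/andP; split; lra.
Qed.

Variable F : {set I} -> R.
Hypothesis F01 : forall S, 0 <= F S <= 1.
Variable tt : I -> R.
Let act := active phi J tt.

(** Off the events [big] and [small], [Zhi] implies [Z] and [Z] implies [Zlo]. The outer two depend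
    on [xi] alone, hence are independent of [act]; they sandwich both [Pr Z] and the mean of [Z]
    times [F]. *)
Lemma decouple :
  `|E (fun w => ((Z w)%:R - Pr Z) * F (act w))| <=
    2 * eta * expR (- (t - eta) ^+ 2 / (G0 *+ 2)) + 4 * pi0.
Proof.
have mphi := phi_field.1 x.
have eZ : event R Z := @event_le R dT T _ _ mphi.
have elo : event R Zlo := @event_le R dT T _ _ (measurable_lin phi_field xi_coef).
have ehi : event R Zhi := @event_le R dT T _ _ (measurable_lin phi_field xi_coef).
have eb : event R big := @event_le R dT T _ _ (measurable_lin phi_field c).
have es : event R small := @event_le R dT T _ _ (measurable_lin phi_field _).
have bF : bounded_mf (fun w => F (act w)) := bounded_mf_active phi_field C_sym xi_orth tt F.
have bZ := event_bmf eZ; have blo := event_bmf elo; have bhi := event_bmf ehi.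
have bb := event_bmf eb; have bs := event_bmf es.
have bbs : bounded_mf (fun w => (big w)%:R + (small w)%:R : R) := bounded_mfD bb bs.
have pbs : E (fun w => (big w)%:R + (small w)%:R) = Pr big + Pr small.
  by rewrite -mean_add// !prob_event.
have [p1 p2] := psi_tail.
have up w : ((Z w)%:R : R) <= (Zlo w)%:R + ((big w)%:R + (small w)%:R).
  rewrite /Z /Zlo /big /small linZ mulN1r -/psi xi_psi.
  have [h1|h1] := leP t; last by rewrite !addr_ge0.
  have [h2|h2] := leP (t - eta) (xi w); first by rewrite lerDl addr_ge0.
  rewrite (_ : eta <= psi w) ?add0r ?lerDl//; lra.
have dn w : ((Zhi w)%:R : R) <= (Z w)%:R + ((big w)%:R + (small w)%:R).
  rewrite /Z /Zhi /big /small linZ mulN1r -/psi xi_psi.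
  have [h1|h1] := leP (t + eta) (xi w); last by rewrite !addr_ge0.
  have [h2|h2] := leP t; first by rewrite lerDl addr_ge0.
  rewrite [X in _ + (_ + X)](_ : _ = 1); last by rewrite (_ : eta <= - psi w)//; lra.
  by rewrite add0r lerDr.
have ZF : E (fun w => ((Z w)%:R - Pr Z) * F (act w)) =
    E (fun w => (Z w)%:R * F (act w)) - Pr Z * E (fun w => F (act w)).
  rewrite -[X in X - _]mul1r -mulNr -mean_lin//; last exact: bounded_mfM.
  by apply: eq_mean_fun => w; ring.
have EF0 : 0 <= E (fun w => F (act w)).
  rewrite -(mean_cst_fun P 0); apply: mean_le_fun => //; first exact: bounded_mf_cst.
  by move=> w; have /andP[] := F01 (act w).
have EF1 : E (fun w => F (act w)) <= 1.
  rewrite -(mean_cst_fun P 1); apply: mean_le_fun => //; first exact: bounded_mf_cst.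
  by move=> w; have /andP[] := F01 (act w).
have ind u : E (fun w => ((u <= xi w)%R)%:R * F (act w)) =
    E (fun w => F (act w)) * Pr (fun w => u <= xi w).
  rewrite prob_event; last exact: (@event_le R dT T _ _ (measurable_lin phi_field _)).
  rewrite -(active_indep phi_field C_sym xi_orth tt F).
  by apply: eq_mean_fun => w; rewrite mulrC.
have zp : Pr Z <= Pr Zlo + (Pr big + Pr small).
  rewrite -pbs !prob_event// mean_add//.
  by apply: mean_le_fun => //; exact: bounded_mfD.
have zm : Pr Zhi <= Pr Z + (Pr big + Pr small).
  rewrite -pbs !prob_event// mean_add//.
  by apply: mean_le_fun => //; exact: bounded_mfD.
have zfp : E (fun w => (Z w)%:R * F (act w)) <=
    E (fun w => F (act w)) * Pr Zlo + (Pr big + Pr small).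
  rewrite -pbs -ind mean_add//; last exact: bounded_mfM.
  apply: mean_le_fun; [exact: bounded_mfM|apply: bounded_mfD => //; exact: bounded_mfM|].
  move=> w; have /andP[f0 f1] := F01 (act w); have := up w; rewrite -/(Zlo w).
  move=> /(ler_wpM2r f0) h; apply: le_trans h _.
  by rewrite mulrDl lerD2l -[leRHS]mulr1 ler_wpM2l// addr_ge0.
have zfm : E (fun w => F (act w)) * Pr Zhi <=
    E (fun w => (Z w)%:R * F (act w)) + (Pr big + Pr small).
  rewrite -pbs -ind mean_add//; last exact: bounded_mfM.
  apply: mean_le_fun; [exact: bounded_mfM|apply: bounded_mfD => //; exact: bounded_mfM|].
  move=> w; have /andP[f0 f1] := F01 (act w); have := dn w; rewrite -/(Zhi w).
  move=> /(ler_wpM2r f0) h; apply: le_trans h _.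
  by rewrite mulrDl lerD2l -[leRHS]mulr1 ler_wpM2l// addr_ge0.
have lh : Pr Zhi <= Pr Zlo.
  apply: prob_le => // w; rewrite /Zhi /Zlo; have [e0 _] := andP eta_bnd.
  by apply: le_trans; lra.
have b0 : 0 <= Pr big + Pr small.
  rewrite -pbs -(mean_cst_fun P 0); apply: mean_le_fun => //.
  exact: bounded_mf_cst.
have := Zlo_Zhi; rewrite ZF; move: b0 zp zm zfp zfm EF0 EF1 p1 p2 lh.
move: (E (fun w => F (act w))) (E (fun w => (Z w)%:R * F (act w))).
move: (Pr Z) (Pr Zlo) (Pr Zhi) (Pr big) (Pr small) (2 * eta * expR _) pi0.
move=> p q1 q2 b1 b2 X0 q f zf b0 zp zm zfp zfm f0 f1 h1 h2 lh hX.
have k1 : 0 <= f * (p + (b1 + b2) - q2) by rewrite mulr_ge0//; lra.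
have k2 : 0 <= f * (q1 + (b1 + b2) - p) by rewrite mulr_ge0//; lra.
have k3 : 0 <= (1 - f) * (q1 - q2 + (b1 + b2)) by rewrite mulr_ge0//; lra.
by rewrite ler_norml; apply/andP; split; lra.
Qed.

End Decoupling.

(** * Total variation bound at fixed size *)

Section FixedBox.
Variables (R : realType) (d n : nat) (delta alpha : R).
Variables (dT : measure_display) (T : measurableType dT) (P : probability T R).
Variable phi : bpt d n -> T -> R.
Hypothesis phi_dgff : is_DGFF P phi.
Hypothesis d3 : (3 <= d)%N.
Hypothesis delta01 : 0 < delta < 1.
Hypothesis n0 : (0 < n)%N.
Implicit Types (x y z : bpt d n) (S : {set bpt d n}).
Local Notation E f := (\int[P]_w f w).
Local Notation Pr b := (fine (P [set w | is_true (b w)])).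
Local Notation g := (@green_box R d n).
Local Notation G0 := (green0 R d).
Local Notation thr := (threshold d n alpha).
Local Notation mu := (law_high P delta alpha phi).
Local Notation rho := (return_ratio R d).

Definition inner_sites : {set bpt d n} := [set x | inner_box delta x].

Lemma inner_interior x : inner_box delta x -> Defs.interior x.
Proof.
have [dl0 dl1] := andP delta01; have nR : 0 < n%:R :> R by rewrite ltr0n.
move=> /forallP h; apply/forallP => i; have /andP[h1 h2] := h i.
apply/andP; split.
  by rewrite -(ltr0n R); apply: lt_le_trans h1; rewrite mulr_gt0.
rewrite -(ltr_nat R); apply: le_lt_trans h2 _.
by rewrite -[ltRHS]mul1r ltr_pM2r//; lra.
Qed.

Lemma high_setE w : high_set delta alpha phi w = active phi inner_sites (fun=> thr) w.
Proof. by apply/finset.setP => x; rewrite !inE. Qed.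

Lemma bounded_mf_high (F : {set bpt d n} -> R) :
  bounded_mf (fun w => F (high_set delta alpha phi w)).
Proof.
under eq_fun do rewrite high_setE.
(* The zero form is orthogonal to every site, so the measurability statement applies to all inner
   sites at once. *)
have orth y : y \in inner_sites -> \sum_x 0 * g x y = 0.
  by move=> _; rewrite big1// => x _; rewrite mul0r.
exact: (bounded_mf_active phi_dgff (@green_boxC R d n) orth (fun=> thr) F).
Qed.

Lemma law_highE S : mu S = E (fun w => (high_set delta alpha phi w == S)%:R).
Proof.
have bS := bounded_mf_high (fun S' => (S' == S)%:R).
rewrite -(prob_event P bS.1) /law_high; congr (fine (P _)).
by apply/seteqP; split => w /= /eqP.
Qed.

Lemma mean_sum_fun (s : seq {set bpt d n}) (f : {set bpt d n} -> T -> R) :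
  (forall S, bounded_mf (f S)) ->
  bounded_mf (fun w => \sum_(S <- s) f S w) /\
  \sum_(S <- s) E (f S) = E (fun w => \sum_(S <- s) f S w).
Proof.
move=> bf; elim: s => [|S s [IH1 IH2]].
  split; last first.
    rewrite big_nil -[LHS](mean_cst_fun P 0).
    by apply: eq_mean_fun => w; rewrite big_nil.
  have := bounded_mf_cst T (0 : R); congr bounded_mf.
  by apply/funext => w; rewrite big_nil.
have fE : (fun w => \sum_(S <- S :: s) f S w) = (fun w => f S w + \sum_(S <- s) f S w).
  by apply/funext => w; rewrite big_cons.
split; first by rewrite fE; exact: bounded_mfD.
by rewrite big_cons IH2 fE mean_add.
Qed.

Lemma mean_high (F : {set bpt d n} -> R) :
  mean mu F = E (fun w => F (high_set delta alpha phi w)).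
Proof.
rewrite /mean.
pose f S w : R := F S * (high_set delta alpha phi w == S)%:R.
have bS S : bounded_mf (fun w => (high_set delta alpha phi w == S)%:R : R).
  exact: (bounded_mf_high (fun S' => (S' == S)%:R)).
have bf S : bounded_mf (f S) by apply: bounded_mfM; [exact: bounded_mf_cst|].
rewrite (eq_bigr (fun S => E (f S))); last first.
  move=> S _; rewrite law_highE mulrC.
  have := mean_lin P (F S) 0 (bS S) (bS S); rewrite mul0r addr0 => <-.
  by apply: eq_mean_fun => w; rewrite mul0r addr0.
have [_ ->] := mean_sum_fun (index_enum _) bf.
apply: eq_mean_fun => w; rewrite (bigD1 (high_set delta alpha phi w))//= /f eqxx mulr1.
by rewrite big1 ?addr0// => S; rewrite eq_sym => /negbTE ->; rewrite mulr0.
Qed.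

Lemma law_high_ge0 S : 0 <= mu S.
Proof. by rewrite /law_high fine_ge0. Qed.

Lemma law_high_sum1 : \sum_S mu S = 1.
Proof.
transitivity (mean mu (fun=> 1)); first by apply: eq_bigr => S _; rewrite mulr1.
by rewrite mean_high mean_cst_fun.
Qed.

Lemma site_event x : event R (fun w => thr <= phi x w).
Proof. exact: (@event_le R dT T _ _ (phi_dgff.1 x)). Qed.

Lemma marg_high x : marg mu x = if inner_box delta x then Pr (fun w => thr <= phi x w) else 0.
Proof.
rewrite /marg mean_high; case: ifP => xi.
  rewrite prob_event; last exact: site_event.
  by apply: eq_mean_fun => w; rewrite inE xi.
by rewrite -[RHS](mean_cst_fun P 0); apply: eq_mean_fun => w; rewrite inE xi.
Qed.

Lemma marg2_high x y : marg2 mu x y = E (fun w =>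
  ((inner_box delta x && (thr <= phi x w)) && (inner_box delta y && (thr <= phi y w)))%:R).
Proof. by rewrite /marg2 mean_high; apply: eq_mean_fun => w; rewrite !inE. Qed.

(** Sites outside the inner box have marginal 0; this accounts for the case distinction in
    [nu_tilde]. *)
Lemma prod_law_high S : prod_law (marg mu) S = nu_tilde P delta alpha phi S.
Proof.
rewrite /prod_law /nu_tilde; case: ifPn => [SJ|/fintype.subsetPn[x xS xJ]].
  rewrite (bigID (inner_box delta))/= [X in _ * X]big1 ?mulr1; last first.
    move=> x xi; rewrite marg_high (negbTE xi) subr0.
    case: ifP => // xS; move/fintype.subsetP: SJ => /(_ _ xS).
    by move=> /set_mem /=; rewrite (negbTE xi).
  by apply: eq_bigr => x xi; rewrite marg_high xi.
have {}xJ : ~~ inner_box delta x by apply: contra xJ => h; exact: mem_set.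
rewrite (bigD1 x)//= xS marg_high (negbTE xJ) mul0r//.
Qed.

Lemma tv_dist_lindeberg (B : bpt d n -> {set bpt d n}) (e : bpt d n -> R) :
  (forall x (F : {set bpt d n} -> R), (forall S, 0 <= F S <= 1) ->
    `|mean mu (fun S => ((x \in S)%:R - marg mu x) * F (S :\: B x))| <= e x) ->
  (forall x, 0 <= e x) ->
  tv_dist mu (nu_tilde P delta alpha phi) <=
    \sum_x (2 * e x + 2 * pair_err mu B x).
Proof.
move=> dec e0; rewrite /tv_dist; apply: bigmax_le => [|A _].
  apply: sumr_ge0 => x _; rewrite addr_ge0 ?mulr_ge0// /pair_err sumr_ge0// => y _.
  rewrite addr_ge0 ?mulr_ge0 ?(marg_ge0 law_high_ge0)//.
  by apply: sumr_ge0 => S _; rewrite mulr_ge0 ?law_high_ge0.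
pose h (S : {set bpt d n}) : R := (S \in A)%:R.
have meanA (m : {set bpt d n} -> R) : \sum_(S in A) m S = mean m h.
  rewrite /mean big_mkcond/=; apply: eq_bigr => S _; rewrite /h.
  by case: (S \in A); rewrite ?mulr1 ?mulr0.
rewrite !meanA (_ : mean (nu_tilde _ _ _ _) h = mean (prod_law (marg mu)) h).
  apply: (lindeberg law_high_ge0 law_high_sum1 dec).
  by move=> S; rewrite /h; case: (S \in A); rewrite ?ler01 ?lexx.
by apply: eq_bigr => S _; rewrite prod_law_high.
Qed.

Definition sup_ball (m : nat) x : {set bpt d n} :=
  [set y : bpt d n | [forall i, `|(x i)%:Z - (y i)%:Z| <= m]%N].

Lemma card_sup_ball m x : (#|sup_ball m x| <= (2 * m + 1) ^ d)%N.
Proof.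
(* Adding [m] before the truncated subtraction keeps the map injective on the ball. *)
pose f (y : bpt d n) : {ffun 'I_d -> 'I_(2 * m).+1} := [ffun i => inord (y i + m - x i)].
have finj : {in sup_ball m x &, injective f}.
  move=> y z; rewrite !inE => /forallP hy /forallP hz fyz.
  apply/ffunP => i; have := congr1 (fun h : {ffun 'I_d -> 'I_(2 * m).+1} => val (h i)) fyz.
  have {}hy := hy i; have {}hz := hz i.
  rewrite !ffunE /= !inordK; [|lia|lia].
  by move=> h; apply: val_inj => /=; lia.
rewrite -(card_in_imset finj); apply: leq_trans (max_card _) _.
by rewrite card_ffun !card_ord addn1.
Qed.

Lemma card_sites : (#|{: bpt d n}| = n.+1 ^ d)%N.
Proof. by rewrite card_ffun !card_ord. Qed.

Lemma G0_gt0 : 0 < G0.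
Proof. by apply: lt_le_trans (green0_ge1 R d3). Qed.

Variables (m m0 : nat) (s2 r eta : R).
Hypothesis far_s2 : forall x z, z \notin sup_ball m x -> g x z <= s2.
Hypothesis far_r : forall x z, z \notin sup_ball m0 x -> g x z <= r.
Hypothesis r0 : 0 <= r.
Hypothesis s2_bnd : 0 < s2 <= 1 / 2.
Hypothesis eta_bnd : 0 < eta <= thr.

Definition err1 : R := 2 * eta * expR (- (thr - eta) ^+ 2 / (G0 *+ 2)) +
  4 * expR (- eta ^+ 2 / (s2 *+ 2)).

Lemma err1_ge0 : 0 <= err1.
Proof. by have [e0 _] := andP eta_bnd; rewrite addr_ge0 ?mulr_ge0 ?expR_ge0// ltW. Qed.

Lemma thr_gt0 : 0 < thr.
Proof. by have [e0 e1] := andP eta_bnd; exact: lt_le_trans e1. Qed.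

(** The sweeping measure from [balayage] vanishes on the ball, so it charges only points to which
    [far_s2] applies. *)
Lemma site_decouple x (F : {set bpt d n} -> R) : (forall S, 0 <= F S <= 1) ->
  `|mean mu (fun S => ((x \in S)%:R - marg mu x) * F (S :\: sup_ball m x))| <= err1.
Proof.
move=> F01; rewrite mean_high.
have [xi|xi] := boolP (inner_box delta x); last first.
  rewrite marg_high (negbTE xi).
  rewrite (@eq_mean_fun _ _ _ P _ (fun=> 0)); first by rewrite mean_cst_fun normr0 err1_ge0.
  by move=> w; rewrite inE (negbTE xi) subrr mul0r.
have [c [c0 cs c1 cg]] := balayage R d3 (enum (sup_ball m x)) x.
have cn y : c y != 0 -> y \notin sup_ball m x.
  by apply: contraNN => yB; rewrite cs ?mem_enum.
have bal y : y \notin sup_ball m x -> g x y = \sum_z c z * g z y.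
  by move=> yB; apply: cg; rewrite mem_enum.
have orth y : y \in inner_sites :\: sup_ball m x -> g x y = \sum_z c z * g z y.
  by rewrite inE => /andP[yB _]; exact: bal.
have Cb : 1 <= g x x <= G0.
  by rewrite green_box_diag_ge1 ?green_box_diag_le//; exact: inner_interior.
have := decouple phi_dgff (@green_boxC R d n) c0 c1 (fun y h => bal y (cn y h)) orth
  (fun y h => far_s2 (cn y h)) Cb s2_bnd eta_bnd F01 (fun=> thr).
apply: le_trans; rewrite le_eqVlt; apply/orP; left; apply/eqP; congr (`|_|).
apply: eq_mean_fun => w; rewrite marg_high xi inE xi; congr (_ * F _).
by rewrite high_setE; apply/finset.setP => y; rewrite !inE -andbA.
Qed.

Lemma marg_le x : marg mu x <= expR (- thr ^+ 2 / (G0 *+ 2)).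
Proof.
rewrite marg_high; case: ifP => _; last exact: expR_ge0.
have phiE w : phi x w = lin phi (fun z => (z == x)%:R) w by rewrite lin_single.
rewrite (_ : [set w | thr <= phi x w] =
  [set w | thr <= lin phi (fun z => (z == x)%:R) w]); last first.
  by apply/seteqP; split => w /=; rewrite phiE.
apply: (gaussian_tail _ G0_gt0 thr_gt0 (lin_law phi_dgff _)).
rewrite (cov_ge0 phi_dgff (@green_boxC R d n))/=.
rewrite /cov (bigD1 x)//= [X in _ + X]big1 ?addr0; last first.
  by move=> z /negbTE ->; rewrite big1// => y _; rewrite !mul0r.
rewrite (bigD1 x)//= big1 ?addr0; last first.
  by move=> z /negbTE ->; rewrite mulr0 mul0r.
by rewrite eqxx !mul1r green_box_diag_le.
Qed.

Lemma cov_pair x y : x != y ->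
  cov g (fun z => (z == x)%:R + (z == y)%:R) (fun z => (z == x)%:R + (z == y)%:R) =
  g x x + g y y + 2 * g x y.
Proof.
move=> xy; have s u v : cov g (fun z => (z == u)%:R) (fun z => (z == v)%:R) = g u v.
  rewrite /cov (bigD1 u)//= [X in _ + X]big1 ?addr0; last first.
    by move=> z /negbTE ->; rewrite big1// => y' _; rewrite !mul0r.
  rewrite (bigD1 v)//= big1 ?addr0; last first.
    by move=> z /negbTE ->; rewrite mulr0 mul0r.
  by rewrite !eqxx !mul1r.
rewrite covDl !covDr ?s; try exact: green_boxC.
by rewrite (green_boxC R y x); ring.
Qed.

Lemma marg2_le x y (q : R) : x != y -> 0 <= q -> g x y <= q ->
  marg2 mu x y <= expR (- thr ^+ 2 / (G0 + q)).
Proof.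
move=> xy q0 gq; rewrite marg2_high.
pose X := lin phi (fun z => (z == x)%:R + (z == y)%:R).
have eX : event R (fun w => 2 * thr <= X w).
  exact: (@event_le R dT T _ _ (measurable_lin phi_dgff _)).
apply: (@le_trans _ _ (Pr (fun w => 2 * thr <= X w))).
  rewrite prob_event//; apply: mean_le_fun; last first.
  - move=> w; rewrite ler_nat /X linD !lin_single.
    case: (leP thr (phi x w)) => h1; last by rewrite andbF.
    case: (leP thr (phi y w)) => h2; last by rewrite !andbF.
    by rewrite (_ : 2 * thr <= _) ?leq_b1//; lra.
  - exact: event_bmf.
  - have := bounded_mf_high (fun S => ((x \in S) && (y \in S))%:R : R).
    by congr bounded_mf; apply/funext => w; rewrite !inE.
have V0 : 0 < (G0 + q) *+ 2 by rewrite mulrn_wgt0// ltr_wpDr// G0_gt0.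
have t20 : 0 < 2 * thr by rewrite mulr_gt0// thr_gt0.
have := gaussian_tail (V := (G0 + q) *+ 2) _ V0 t20 (lin_law phi_dgff _).
move=> /(_ (fun z => (z == x)%:R + (z == y)%:R)) H.
apply: le_trans (H _) _.
  rewrite (cov_ge0 phi_dgff (@green_boxC R d n))/= cov_pair// mulr2n.
  have := green_box_diag_le R d3 x; have := green_box_diag_le R d3 y; lra.
rewrite ler_expR le_eqVlt; apply/orP; left; apply/eqP.
rewrite !mulr2n; field.
have := G0_gt0; move=> h; rewrite gt_eqF; lra.
Qed.

(** Pairs within distance [m0] have covariance at most [rho * G0], the other pairs of the ball at
    most [r]; the last exponential bounds the product of two marginals. *)
Definition err2 : R :=
  ((2 * m0 + 1) ^ d)%:R * expR (- thr ^+ 2 / (G0 + rho * G0)) +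
  ((2 * m + 1) ^ d)%:R * (expR (- thr ^+ 2 / (G0 + r)) + expR (- thr ^+ 2 / G0)).

Lemma pair_err_le x : pair_err mu (sup_ball m) x <= err2.
Proof.
pose near_ : R := expR (- thr ^+ 2 / (G0 + rho * G0)).
pose far_ : R := expR (- thr ^+ 2 / (G0 + r)).
pose sq_ : R := expR (- thr ^+ 2 / G0).
have rG : 0 <= rho * G0.
  by rewrite mulr_ge0 ?return_ratio_ge0 ?(ltW G0_gt0).
rewrite /pair_err.
apply: (@le_trans _ _ (\sum_(y in sup_ball m x | y != x)
    ((y \in sup_ball m0 x)%:R * near_ + (far_ + sq_)))).
  apply: ler_sum => y /andP[yB yx]; rewrite addrA; apply: lerD.
    have xy : x != y by rewrite eq_sym.
    have [yn|yf] := boolP (y \in sup_ball m0 x).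
      rewrite mul1r -[leLHS]addr0; apply: lerD; last exact: expR_ge0.
      by apply: marg2_le => //; exact: green_box_offdiag_le.
    by rewrite mul0r add0r; apply: marg2_le => //; exact: far_r.
  have -> : sq_ = expR (- thr ^+ 2 / (G0 *+ 2)) * expR (- thr ^+ 2 / (G0 *+ 2)).
    rewrite -expRD /sq_; congr expR; rewrite mulr2n; field.
    by rewrite -?mulr2n ?mulrn_eq0/= ?(gt_eqF G0_gt0).
  by apply: ler_pM; rewrite ?(marg_ge0 law_high_ge0) ?marg_le.
have fs0 : 0 <= far_ + sq_ by rewrite addr_ge0 ?expR_ge0.
rewrite big_split/=; apply: lerD.
  rewrite -mulr_suml ler_wpM2r ?expR_ge0//.
  apply: (@le_trans _ _ (\sum_(y in sup_ball m0 x) 1)).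
    rewrite big_mkcond [leRHS]big_mkcond/=; apply: ler_sum => y _.
    by case: (y \in sup_ball m0 x); case: ifP.
  by rewrite sumr_const ler_nat card_sup_ball.
apply: (@le_trans _ _ (\sum_(y in sup_ball m x) (far_ + sq_))).
  rewrite big_mkcond [leRHS]big_mkcond/=; apply: ler_sum => y _.
  by case: (y \in sup_ball m x); case: (y != x).
by rewrite sumr_const -[leLHS]mulr_natl ler_wpM2r// ler_nat card_sup_ball.
Qed.

Lemma tv_dist_le : tv_dist mu (nu_tilde P delta alpha phi) <=
  (n.+1 ^ d)%:R * (2 * err1 + 2 * err2).
Proof.
apply: le_trans (tv_dist_lindeberg site_decouple (fun=> err1_ge0)) _.
apply: (@le_trans _ _ (\sum_(x : bpt d n) (2 * err1 + 2 * err2))).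
  by apply: ler_sum => x _; rewrite lerD2l ler_wpM2l// pair_err_le.
by rewrite sumr_const card_sites -[leLHS]mulr_natl.
Qed.

End FixedBox.

(** * Choice of the exponents *)

Section Exponents.
Variable R : realType.
Implicit Types (y : R).

(** From [expR (y / k) >= y / k]. It turns the tail of the harmonic average, exponentially small in
    a power of [n], into an arbitrary negative power of [n]. *)
Lemma expRN_le (k : nat) y : 0 < y -> (0 < k)%N -> expR (- y) <= (k%:R / y) ^+ k.
Proof.
move=> y0 k0; have kR : 0 < k%:R :> R by rewrite ltr0n.
rewrite expRN -[leRHS]invrK lef_pV2 ?posrE ?expR_gt0//; last first.
  by rewrite invr_gt0 exprn_gt0// divr_gt0.
rewrite -exprVn invf_div.
have -> : y = k%:R * (y / k%:R) by field; rewrite gt_eqF.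
rewrite expRM_natl lerXn2r ?nnegrE ?expR_ge0//.
  by rewrite divr_ge0 ?mulr_ge0// ?ltW// divr_gt0.
rewrite mulrC mulKf ?gt_eqF//.
by apply: le_trans (expR_ge1Dx _); rewrite lerDr.
Qed.

Lemma cvg_expR_ln (c : R) : 0 < c -> expR (- (c * ln n%:R)) @[n --> \oo] --> (0 : R).
Proof.
move=> c0; apply/cvgrPdist_lt => e e0; near=> n.
have n1 : 1 <= n%:R :> R by near: n; exact: nbhs_infty_ger.
have n0 : 0 < n%:R :> R by lra.
rewrite sub0r normrN ger0_norm ?expR_ge0//.
have : ln (expR (- ln e / c)) < ln n%:R.
  rewrite ltr_ln ?posrE ?expR_gt0//; near: n; exact: nbhs_infty_gtr.
rewrite expRK ltr_pdivrMr// => h.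
rewrite -[ltRHS]lnK ?posrE// ltr_expR; lra.
Unshelve. all: by end_near. Qed.

Lemma exponents_exist (d : nat) (alpha : R) : (3 <= d)%N ->
  3 / 4 * ((d%:R - 2 / 3) / (d%:R - 1)) < alpha -> alpha < 1 ->
  exists kap b tau : R, [/\ 0 < tau, 0 < b < (d%:R - 2) / 2, 0 < kap,
    d%:R * (1 - alpha) < b * kap - tau & 1 + kap < 2 * alpha / (1 + tau / 2)].
Proof.
move=> d3 a1 a2; have d3R := dim_ge3 R d3; set D : R := d%:R in d3R a1 *.
(* The slack in [D * (1 - alpha) < b * kap] at the limiting values [b = (D - 2) / 2] and
   [kap = 2 * alpha - 1]. It is positive exactly under the lower bound on [alpha]. *)
pose Del := (D - 2) * (2 * alpha - 1) / 2 - D * (1 - alpha).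
have Del0 : 0 < Del.
  move: a1; rewrite mulrA ltr_pdivrMr; last by lra.
  by rewrite /Del; lra.
have a34 : 3 / 4 < alpha.
  apply: lt_trans a1; rewrite -[ltLHS]mulr1 ltr_pM2l; last by lra.
  by rewrite ltr_pdivlMr; lra.
(* Lowering both [b] and [kap] by [tau] and then subtracting [tau] costs less than
   [tau * (D / 2 + 1)], which is [Del / 2]. *)
pose tau := Del / (D + 2).
have tau0 : 0 < tau by rewrite divr_gt0//; lra.
have tauE : tau * (D + 2) = Del by rewrite /tau divfK// gt_eqF//; lra.
have tau1 : tau < 2 * alpha - 1.
  rewrite /tau ltr_pdivrMr; last by lra.
  by rewrite /Del; nra.
have tau2 : tau < (D - 2) / 2.
  rewrite /tau ltr_pdivrMr; last by lra.
  by rewrite /Del; nra.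
exists (2 * alpha - 1 - tau), ((D - 2) / 2 - tau), tau; split => //.
- by apply/andP; split; lra.
- by lra.
- have : tau * (D + 2) * 1 <= Del by lra.
  have : 0 < tau * tau by rewrite mulr_gt0.
  have : 0 < tau * (1 - alpha) by rewrite mulr_gt0//; lra.
  have : 0 < tau * D by rewrite mulr_gt0//; lra.
  rewrite /Del in tauE *; nra.
- rewrite ltr_pdivlMr; last by lra.
  have : 0 < tau * (1 - alpha) by rewrite mulr_gt0//; lra.
  have : 0 < tau * tau by rewrite mulr_gt0.
  by lra.
Qed.

Lemma return_exponent (d : nat) (alpha : R) : (3 <= d)%N ->
  3 / 4 * ((d%:R - 2 / 3) / (d%:R - 1)) < alpha ->
  1 < 2 * alpha / (1 + return_ratio R d).
Proof.
move=> d3 a1; have d3R := dim_ge3 R d3; rewrite /return_ratio.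
set D : R := d%:R in d3R a1 *.
have -> : 1 + D / (2 * (D - 1)) = (3 * D - 2) / (2 * (D - 1)).
  by field; rewrite gt_eqF//; lra.
rewrite ltr_pdivlMr; last by rewrite divr_gt0//; lra.
rewrite mul1r ltr_pdivrMr; last by lra.
by move: a1; rewrite mulrA ltr_pdivrMr; lra.
Qed.

End Exponents.

(** * Convergence as the box grows *)

Section Asymptotics.
Variables (R : realType) (d : nat) (alpha : R).
Hypothesis d3 : (3 <= d)%N.
Hypothesis alpha_lb : 3 / 4 * ((d%:R - 2 / 3) / (d%:R - 1)) < alpha.
Hypothesis alpha_lt1 : alpha < 1.
Local Notation G0 := (green0 R d).
Local Notation rho := (return_ratio R d).

Lemma green_box_far (b : R) : 0 < b -> b < (d%:R - 2) / 2 ->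
  exists2 A : R, 0 < A & forall n m (x z : bpt d n) (D : R),
    z \notin sup_ball m x -> 0 < D -> D <= m.+1%:R ->
    green_box R x z <= A * expR (- (2 * b * ln D)).
Proof.
move=> b0 bd; have [A A0 H] := @green_sum_decay R d d3 b b0 bd.
exists A => // n m x z D zB D0 Dm.
apply: (green_box_le d3) => K; apply: le_trans (H K _) _.
rewrite ler_wpM2l ?(ltW A0)//.
have [i mi] : exists i, (m < `|(x i)%:Z - (z i)%:Z|)%N.
  move: zB; rewrite inE negb_forall => /existsP[i]; rewrite -ltnNge => h.
  by exists i.
have D2 : D ^+ 2 <= normsq R (zdiff x z).
  apply: le_trans (sqr_le_normsq R _ i); rewrite ffunE.
  have -> : ((x i)%:Z - (z i)%:Z)%:~R ^+ 2 = `|(x i)%:Z - (z i)%:Z|%N%:R ^+ 2 :> R.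
    by rewrite -[LHS]real_normK ?num_real// -intr_norm pmulrn abszE.
  rewrite lerXn2r ?nnegrE ?(ltW D0)//.
  by apply: le_trans Dm _; rewrite ler_nat.
have n0 := normsq_ge0 R (zdiff x z).
rewrite powRN /powR gt_eqF; last by lra.
rewrite -expRN ler_expR lerN2 [leLHS]mulrAC -mulrA.
have -> : 2 * (ln D * b) = b * ln (D ^+ 2) by rewrite lnXn// mulr2n; ring.
by rewrite ler_wpM2l ?(ltW b0)// ler_ln ?posrE ?exprn_gt0//; lra.
Qed.

Lemma threshold_sqr n : (0 < n)%N ->
  threshold d n alpha ^+ 2 = 2 * alpha * d%:R * G0 * ln n%:R.
Proof.
move=> n0; rewrite /threshold sqr_sqrtr//.
have d3R := dim_ge3 R d3; have G1 := green0_ge1 R d3.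
have a0 : 0 < alpha.
  apply: lt_trans alpha_lb; rewrite mulr_gt0// divr_gt0//; lra.
by rewrite !mulr_ge0 ?ln_ge0 ?ler1n//; lra.
Qed.

(* Balls of radius [n ^ kap], fluctuation window [eta = n ^ (tau - b * kap)]. The
   four exponents come from the window, the tail of the harmonic average, the
   pairs at distance at most [K0], and the remaining pairs of a ball. *)
Lemma tv_dist_eventually (delta : R) (dT : measure_display) (T : measurableType dT)
    (P : probability T R) (phi : forall n : nat, bpt d n -> T -> R) :
  0 < delta < 1 -> (forall n, is_DGFF P (phi n)) ->
  exists c1 c2 c3 c4 : R, exists g1 g2 g3 g4 : R,
    [/\ 0 < g1, 0 < g2, 0 < g3 & 0 < g4] /\
    \forall n \near \oo, tv_dist (law_high P delta alpha (phi n))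
                      (nu_tilde P delta alpha (phi n)) <=
      c1 * expR (- (g1 * ln n%:R)) + c2 * expR (- (g2 * ln n%:R)) +
      (c3 * expR (- (g3 * ln n%:R)) + c4 * expR (- (g4 * ln n%:R))).
Proof.
move=> delta01 dgff; have d3R := dim_ge3 R d3; have G1 := green0_ge1 R d3.
have G00 : 0 < G0 by lra.
have [kap [b [tau [tau0 /andP[b0 bd] kap0 hlb klb]]]] :=
  exponents_exist d3 alpha_lb alpha_lt1.
have al1 : 0 < 1 - alpha by rewrite subr_gt0.
have rho0 := return_ratio_ge0 R d3.
have [q3 q3E q31] : exists2 q, 2 * alpha = q * (1 + rho) & 1 < q.
  exists (2 * alpha / (1 + rho)); last exact: return_exponent.
  by rewrite divfK// gt_eqF// ltr_wpDr.
have [q4 q4E q41] : exists2 q, 2 * alpha = q * (1 + tau / 2) & 1 + kap < q.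
  exists (2 * alpha / (1 + tau / 2)); last exact: klb.
  by rewrite divfK// gt_eqF// ltr_wpDr// divr_ge0// ltW.
clear klb.
set D : R := d%:R in d3R bd hlb.
have [h hE] : exists h, h = b * kap - tau by exists (b * kap - tau).
have h0 : 0 < h.
  by rewrite hE; apply: lt_trans hlb; apply: mulr_gt0; [lra|exact: al1].
have a34 : 3 / 4 < alpha.
  apply: lt_trans alpha_lb; rewrite -[ltLHS]mulr1 ltr_pM2l; last by lra.
  by rewrite -/D ltr_pdivlMr; lra.
have [A A0 far] := green_box_far b0 bd.
(* [K0] does not depend on [n]: beyond it covariances are at most [tau / 2 * G0], so only boundedly
   many pairs per site need the ratio [rho]. Points outside the ball of radius [K0] are at distance
   at least [K0.+1]. *)
have [K0 K0r] : exists K0 : nat, A * expR (- (2 * b * ln K0.+1%:R)) <= tau / 2 * G0.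
  have b20 : 0 < 2 * b by rewrite mulr_gt0.
  have /cvgrPdist_lt/(_ (tau / 2 * G0 / A)) := cvg_expR_ln b20.
  case; first by rewrite !mulr_gt0 ?invr_gt0//; lra.
  move=> N _ /(_ N.+1 (leqnSn N)) /=.
  rewrite sub0r normrN ger0_norm ?expR_ge0// ltr_pdivlMr// mulrC => /ltW hN.
  by exists N.
(* The power for [expRN_le]: large enough that [n] to the power [- (2 * tau * k)] is at most [n] to
   the power [- (D + 1)]. *)
pose k := (Num.truncn ((D + 1) / (2 * tau))).+1.
have kP : D + 1 <= 2 * tau * k%:R.
  have : (D + 1) / (2 * tau) < k%:R by exact: truncnS_gt.
  by rewrite ltr_pdivrMr ?mulr_gt0// mulrC => /ltW.
(* Bounds [expR (thr * eta / G0)], the price of lowering the threshold by [eta]: [thr] grows at most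
   like [ln n], while [ln n * eta <= 1 / h]. *)
pose M := expR (1 + 2 * D / h).
pose C4 := (k%:R * (2 * A)) ^+ k.
have C40 : 0 <= C4 by rewrite exprn_ge0// !mulr_ge0// ltW.
exists (2 ^+ d * (4 * M)), (2 ^+ d * (8 * C4)),
  (2 ^+ d * (2 * ((2 * K0 + 1) ^ d)%:R)), (2 ^+ d * (4 * 3 ^+ d)).
exists (h + alpha * D - D), 1, (q3 * D - D), (q4 * D - D - D * kap).
split.
  split => //; first by rewrite hE; lra.
    have : 0 < (q3 - 1) * D by rewrite mulr_gt0//; lra.
    by lra.
  have : 0 < (q4 - 1 - kap) * D by rewrite mulr_gt0//; lra.
  by lra.
have s2ev : \forall n \near \oo, A * expR (- (2 * b * kap * ln n%:R)) < 1 / 2.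
  have bk0 : 0 < 2 * b * kap by rewrite !mulr_gt0.
  have cv : A * expR (- (2 * b * kap * ln n%:R)) @[n --> \oo] --> (0 : R).
    by rewrite -(mulr0 A); apply: cvgM; [exact: cvg_cst|exact: cvg_expR_ln].
  by apply: (cvgr_lt _ cv); lra.
near=> n.
have n1R : 1 <= n%:R :> R by near: n; exact: nbhs_infty_ger.
have s2n : A * expR (- (2 * b * kap * ln n%:R)) < 1 / 2 by near: n; exact: s2ev.
have n0 : (0 < n)%N by rewrite -(ltr_nat R); lra.
pose L : R := ln n%:R; rewrite -/L in s2n *.
have L1 : 1 <= L.
  rewrite /L -[leLHS]expRK ler_ln ?posrE ?expR_gt0//; last by lra.
  by near: n; exact: nbhs_infty_ger.
have nL : n%:R = expR L by rewrite /L lnK// posrE; lra.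
pose u (x : R) := expR (x * L).
have uD x y : u x * u y = u (x + y) by rewrite /u -expRD mulrDl.
have u0 x : 0 < u x by exact: expR_gt0.
have uX x j : u x ^+ j = u (j%:R * x) by rewrite /u -mulrA expRM_natl.
pose s2 := A * u (- (2 * b * kap)).
have s20 : 0 < s2 by rewrite mulr_gt0.
have s2h : s2 <= 1 / 2.
  by rewrite /s2 /u mulNr ltW.
pose eta := u (- h).
have eta0 : 0 < eta := u0 _.
have eta1 : eta <= 1.
  by rewrite /eta /u -expR0 ler_expR mulNr oppr_le0 mulr_ge0 ?(ltW h0)// (le_trans ler01 L1).
pose thr := threshold d n alpha.
have thr2 : thr ^+ 2 = 2 * alpha * D * G0 * L by exact: threshold_sqr.
have thr0 : 0 <= thr by exact: sqrtr_ge0.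
have DG : 3 <= D * G0.
  by clear -d3R G1; have : 0 <= (D - 3) * (G0 - 1) by [rewrite mulr_ge0//; lra]; lra.
have DGL : 3 <= D * G0 * L.
  by clear -DG L1; have : 0 <= (D * G0 - 3) * (L - 1) by [rewrite mulr_ge0//; lra]; lra.
have thr1 : 1 <= thr.
  rewrite -(ler_pXn2r (ltn0Sn 1)) ?nnegrE// expr1n thr2.
  clear -a34 DGL.
  have : 0 <= (alpha - 3 / 4) * (D * G0 * L) by rewrite mulr_ge0//; lra.
  by lra.
have thrL : thr <= 1 + 2 * D * G0 * L.
  clear -al1 DGL thr1 thr2.
  have : 0 <= (1 - alpha) * (D * G0 * L) by rewrite mulr_ge0//; lra.
  have : 0 <= (thr - 1) * thr by rewrite mulr_ge0//; lra.
  by lra.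
pose m := Num.truncn (u kap).
have mU : m%:R <= u kap by rewrite /m truncn_le ltW.
have mL : u kap <= m.+1%:R by rewrite ltW// /m; exact: truncnS_gt.
have lnu : ln (u kap) = kap * L by rewrite /u expRK.
have far_s2 (x z : bpt d n) : z \notin sup_ball m x -> green_box R x z <= s2.
  move=> zB; apply: le_trans (far n m x z _ zB (u0 _) mL) _.
  by rewrite lnu /s2 /u mulNr !mulrA.
have far_r (x z : bpt d n) : z \notin sup_ball K0 x -> green_box R x z <= tau / 2 * G0.
  by move=> zB; apply: le_trans (far n K0 x z _ zB (ltr0Sn _ _) (lexx _)) K0r.
have r0 : 0 <= tau / 2 * G0 by rewrite mulr_ge0 ?divr_ge0 ?(ltW tau0) ?(ltW G00).
have s2b : 0 < s2 <= 1 / 2 by rewrite s20.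
have etab : 0 < eta <= thr by rewrite eta0 (le_trans eta1 thr1).
apply: le_trans (tv_dist_le (dgff n) d3 delta01 n0 far_s2 far_r r0 s2b etab) _.
rewrite -/thr.
have e1 : err1 d n alpha s2 eta <= 2 * M * u (- h - alpha * D) + 4 * C4 * u (- (D + 1)).
  rewrite /err1 -/thr; apply: lerD.
    have -> : 2 * M * u (- h - alpha * D) = 2 * eta * (u (- (alpha * D)) * M).
      by rewrite -uD /eta; ring.
    rewrite ler_wpM2l ?mulr_ge0 ?(ltW eta0)//.
    rewrite /u /M -expRD ler_expR.
    rewrite ler_pdivrMr; last by rewrite mulrn_wgt0.
    have Leta : L * eta <= 1 / h.
      rewrite ler_pdivlMr// mulrAC /eta /u mulNr expRN ler_pdivrMr ?expR_gt0// mul1r.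
      by rewrite mulrC; apply: le_trans (expR_ge1Dx _); rewrite lerDr.
    have te : thr * eta <= G0 * (1 + 2 * D / h).
      apply: (@le_trans _ _ (eta + 2 * D * G0 * (L * eta))).
        by have := ler_wpM2r (ltW eta0) thrL; clear; lra.
      have : 2 * D * G0 * (L * eta) <= 2 * D * G0 * (1 / h).
        by rewrite ler_wpM2l// !mulr_ge0//; clear -d3R G00; lra.
      rewrite (_ : G0 * (1 + 2 * D / h) = G0 + 2 * D * G0 * (1 / h)); last first.
        by field; rewrite gt_eqF.
      by clear -eta1 G1; lra.
    rewrite mulr2n.
    have -> : (- (alpha * D) * L + (1 + 2 * D / h)) * (G0 + G0) =
       - (2 * alpha * D * G0 * L) + 2 * (G0 * (1 + 2 * D / h)) by ring.
    by rewrite -thr2; have := sqr_ge0 eta; clear -te; lra.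
  rewrite -mulrA ler_wpM2l//.
  (* [eta] exceeds the square root of the variance bound [s2] by a factor of order [n] to the power
     [tau]. *)
  have -> : - eta ^+ 2 / (s2 *+ 2) = - (u (2 * tau) / (2 * A)).
    rewrite /eta /s2 uX mulr2n.
    have -> : u (2 * - h) = u (2 * tau) * u (- (2 * b * kap)).
      by rewrite uD; congr u; rewrite hE; ring.
    by field; apply/andP; split; rewrite gt_eqF.
  have y0 : 0 < u (2 * tau) / (2 * A) by rewrite divr_gt0// mulr_gt0.
  apply: (le_trans (@expRN_le R k _ y0 isT)).
  have -> : k%:R / (u (2 * tau) / (2 * A)) = k%:R * (2 * A) * u (- (2 * tau)).
    rewrite /u mulNr expRN; field; apply/andP; split; rewrite gt_eqF//.
    exact: expR_gt0.
  rewrite exprMn -/C4 ler_wpM2l// uX /u ler_expR ler_wpM2r//.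
  by rewrite (le_trans ler01 L1).
  by clear -kP; lra.
have e2 : err2 d n alpha m K0 (tau / 2 * G0) <=
    ((2 * K0 + 1) ^ d)%:R * u (- (q3 * D)) +
    3 ^+ d * (2 * u (D * kap - q4 * D)).
  rewrite /err2 -/thr thr2; apply: lerD.
    rewrite ler_wpM2l// /u ler_expR q3E le_eqVlt; apply/orP; left; apply/eqP.
    clear -G00 rho0; field; rewrite -{1}[G0]mul1r -mulrDl mulf_neq0// gt_eqF//; lra.
  have m3 : ((2 * m + 1) ^ d)%:R <= 3 ^+ d * u (D * kap).
    rewrite natrX -uX -exprMn lerXn2r ?nnegrE ?mulr_ge0 ?(ltW (u0 _))//.
    rewrite natrD natrM; have : 1 <= u kap; last by clear -mU; lra.
    by rewrite /u -expR0 ler_expR mulr_ge0 ?(ltW kap0)// (le_trans ler01 L1).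
  rewrite -uD (_ : 3 ^+ d * (2 * _) = 3 ^+ d * u (D * kap) *
     (2 * u (- (q4 * D)))); last by ring.
  have e3 : expR (- (2 * alpha * D * G0 * L) / (G0 + tau / 2 * G0)) =
      u (- (q4 * D)).
    rewrite /u q4E; congr expR; field.
    have Gt : 0 < G0 * tau by rewrite mulr_gt0.
    by rewrite gt_eqF//; clear -G00 Gt; lra.
  have e4 : expR (- (2 * alpha * D * G0 * L) / G0) <=
      u (- (q4 * D)).
    rewrite /u ler_expR.
    rewrite (_ : - (2 * alpha * D * G0 * L) / G0 = - (2 * alpha * D) * L); last first.
      by field; rewrite gt_eqF.
    rewrite ler_wpM2r ?(le_trans ler01 L1)// lerN2 ler_wpM2r ?(le_trans _ d3R)//.
    have : 0 < q4 * tau by rewrite mulr_gt0//; clear -q41 kap0; lra.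
    by clear -q4E; lra.
  apply: ler_pM => //; try by rewrite addr_ge0 ?expR_ge0.
  by rewrite e3; clear -e4; lra.
have nd : (n.+1 ^ d)%:R <= 2 ^+ d * u D.
  rewrite natrX (_ : u D = expR L ^+ d); last by rewrite /u expRM_natl.
  rewrite -nL -exprMn lerXn2r ?nnegrE ?mulr_ge0//.
  by rewrite -natr1; lra.
apply: (@le_trans _ _ (2 ^+ d * u D *
   (2 * (2 * M * u (- h - alpha * D) + 4 * C4 * u (- (D + 1))) +
    2 * (((2 * K0 + 1) ^ d)%:R * u (- (q3 * D)) +
    3 ^+ d * (2 * u (D * kap - q4 * D)))))).
  apply: ler_pM => //; last by apply: lerD; rewrite ler_wpM2l.
  have E1 := @err1_ge0 R d n alpha s2 eta etab.
  have E2 : 0 <= err2 d n alpha m K0 (tau / 2 * G0).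
    by apply: addr_ge0; rewrite mulr_ge0 ?addr_ge0 ?expR_ge0.
  by rewrite addr_ge0// mulr_ge0.
rewrite le_eqVlt; apply/orP; left; apply/eqP.
have f1 : expR (- ((h + alpha * D - D) * L)) = u D * u (- h - alpha * D).
  by rewrite uD /u; congr expR; ring.
have f2 : expR (- (1 * L)) = u D * u (- (D + 1)).
  by rewrite uD /u; congr expR; ring.
have f3 : expR (- ((q3 * D - D) * L)) =
    u D * u (- (q3 * D)).
  by rewrite uD /u; congr expR; ring.
have f4 : expR (- ((q4 * D - D - D * kap) * L)) =
    u D * u (D * kap - q4 * D).
  by rewrite uD /u; congr expR; ring.
rewrite f1 f2 f3 f4.
move: (u D) (u (- h - alpha * D)) (u (- (D + 1))) (u (- (q3 * D))).
move: (u (D * kap - _)) (2 ^+ d) (3 ^+ d) (((2 * K0 + 1) ^ d)%:R : R).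
by move=> *; ring.
Unshelve. all: by end_near. Qed.

End Asymptotics.

Unset Implicit Arguments.

Theorem theorem1p3 (R : realType) (d : nat) (delta alpha : R)
    (dT : measure_display) (T : measurableType dT) (P : probability T R)
    (phi : forall n : nat, bpt d n -> T -> R) :
  (3 <= d)%N ->
  0 < delta < 1 ->
  3 / 4 * ((d%:R - 2 / 3) / (d%:R - 1)) < alpha ->
  alpha < 1 ->
  (forall n, is_DGFF P (phi n)) ->
  (fun n => tv_dist (law_high P delta alpha (phi n))
                    (nu_tilde P delta alpha (phi n))) @ \oo --> (0 : R).
Proof.
move=> d3 delta01 alpha_lb alpha_lt1 dgff.
have [c1 [c2 [c3 [c4 [g1 [g2 [g3 [g4 [[g10 g20 g30 g40] tv_le]]]]]]]]] :=
  tv_dist_eventually d3 alpha_lb alpha_lt1 delta01 dgff.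
have term (c g : R) : 0 < g -> c * expR (- (g * ln n%:R)) @[n --> \oo] --> (0 : R).
  by move=> g0; rewrite -(mulr0 c); apply: cvgM; [exact: cvg_cst|exact: cvg_expR_ln].
have bound_cvg : c1 * expR (- (g1 * ln n%:R)) + c2 * expR (- (g2 * ln n%:R)) +
    (c3 * expR (- (g3 * ln n%:R)) + c4 * expR (- (g4 * ln n%:R)))
    @[n --> \oo] --> (0 : R).
  rewrite -[X in _ --> X](addr0 0); apply: cvgD.
    by rewrite -[X in _ --> X](addr0 0); apply: cvgD; exact: term.
  by rewrite -[X in _ --> X](addr0 0); apply: cvgD; exact: term.
apply: squeeze_cvgr (cvg_cst 0) bound_cvg.
by apply: filterS tv_le => n tvn; apply/andP; split; [exact: bigmax_ge_id|exact: tvn].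
Qed.
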